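(* Knapsack with multiplicities can be solved by a deterministic algorithm in time $\mathcal{O}(n+s^3)$, where $n$ is the number of distinct items and $s=\max_{i\in[n]} s_i$ is the maximum item size.
   Context: Knapsack with multiplicities: the input consists of $n$ distinct items, item $i\in[n]=\{1,\dots,n\}$ having a positive integer size $s_i$, an integer value $v_i$, and a binary-encoded positive integer multiplicity $u_i$, together with a capacity $t$. The task is to solve the integer program: maximize $\sum_{i\in[n]} v_i x_i$ subject to $\sum_{i\in[n]} s_i x_i\le t$, $x_i\in\mathbb{Z}$ and $0\le x_i\le u_i$ for all $i$ (the algorithm outputs an optimal solution). The model of computation is the word RAM, where each input integer fits in one word and arithmetic on integers polynomial in the sum of the input integers takes constant time. *)

(* Defs.v *)
From Stdlib Require Import ZArith List Bool.
Import ListNotations.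
Open Scope Z_scope.

(** * Knapsack with multiplicities *)

Record item := Item { item_size : Z; item_value : Z; item_mult : Z }.

Record instance := Instance { items : list item; capacity : Z }.

Definition valid (I : instance) : Prop :=
  Forall (fun it => 0 < item_size it /\ 0 < item_mult it) (items I)
  /\ 0 <= capacity I.

Definition zsum (l : list Z) : Z := fold_right Z.add 0 l.

Definition weighted_sum (f : item -> Z) (I : instance) (x : list Z) : Z :=
  zsum (map (fun p => f (fst p) * snd p) (combine (items I) x)).

(* [Forall2] forces [x] to have exactly one entry per item. *)
Definition feasible (I : instance) (x : list Z) : Prop :=
  Forall2 (fun it xi => 0 <= xi <= item_mult it) (items I) x
  /\ weighted_sum item_size I x <= capacity I.

Definition optimal (I : instance) (x : list Z) : Prop :=
  feasible I x
  /\ forall y, feasible I y ->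
       weighted_sum item_value I y <= weighted_sum item_value I x.

Definition num_items (I : instance) : nat := length (items I).

(* Sizes are positive in a valid instance, so the default 0 is only reached
   when there are no items. *)
Definition max_size (I : instance) : Z :=
  fold_right Z.max 0 (map item_size (items I)).

Definition input_sum (I : instance) : Z :=
  capacity I
  + zsum (map (fun it => item_size it + Z.abs (item_value it) + item_mult it)
              (items I)).

(** * Word RAM

    A program is a fixed finite list of instructions acting on registers (only
    the finitely many named in the program matter) and on a word-addressed
    memory.  Words are the integers of absolute value at most [W].  Every
    instruction costs one step; one that would produce a value outside the
    word range, address a cell outside [0..W], divide by zero or shift by a
    negative amount faults, and a faulting execution never halts. *)

Inductive binop :=
  | Add | Sub | Mul | Div | Mod | And | Or | Xor | Shl | Shr.

Definition eval_binop (o : binop) (a b : Z) : option Z :=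
  match o with
  | Add => Some (a + b)
  | Sub => Some (a - b)
  | Mul => Some (a * b)
  | Div => if b =? 0 then None else Some (a / b)
  | Mod => if b =? 0 then None else Some (a mod b)
  | And => Some (Z.land a b)
  | Or  => Some (Z.lor a b)
  | Xor => Some (Z.lxor a b)
  | Shl => if b <? 0 then None else Some (Z.shiftl a b)
  | Shr => if b <? 0 then None else Some (Z.shiftr a b)
  end.

Inductive instr :=
  | IConst (d : nat) (c : Z)          (* R[d] := c *)
  | IOp (o : binop) (d a b : nat)     (* R[d] := R[a] o R[b] *)
  | ILoad (d a : nat)                 (* R[d] := M[R[a]] *)
  | IStore (a b : nat)                (* M[R[a]] := R[b] *)
  | IJump (l : nat)                   (* goto l *)
  | IJumpLt (a b : nat) (l : nat)     (* if R[a] < R[b] then goto l *)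
  | IHalt.

Definition program := list instr.

Record state := State { pc : nat; reg : nat -> Z; mem : nat -> Z }.

Definition update (f : nat -> Z) (i : nat) (z : Z) : nat -> Z :=
  fun j => if Nat.eqb j i then z else f j.

Definition set_reg (W : Z) (st : state) (d : nat) (z : Z) : option state :=
  if Z.abs z <=? W
  then Some (State (S (pc st)) (update (reg st) d z) (mem st))
  else None.

Definition is_address (W a : Z) : bool := (0 <=? a) && (a <=? W).

Definition step_instr (W : Z) (i : instr) (st : state) : option state :=
  match i with
  | IConst d c => set_reg W st d c
  | IOp o d a b =>
      match eval_binop o (reg st a) (reg st b) with
      | Some z => set_reg W st d z
      | None => None
      end
  | ILoad d a =>
      if is_address W (reg st a)
      then set_reg W st d (mem st (Z.to_nat (reg st a)))
      else None
  | IStore a b =>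
      if is_address W (reg st a)
      then Some (State (S (pc st)) (reg st)
                       (update (mem st) (Z.to_nat (reg st a)) (reg st b)))
      else None
  | IJump l => Some (State l (reg st) (mem st))
  | IJumpLt a b l =>
      Some (State (if reg st a <? reg st b then l else S (pc st))
                  (reg st) (mem st))
  | IHalt => None
  end.

(* [exec W P st T st']: started in [st], the program [P] reaches [IHalt] in
   state [st'] after exactly [T] steps, without faulting. *)
Inductive exec (W : Z) (P : program) : state -> nat -> state -> Prop :=
  | exec_halt st :
      nth_error P (pc st) = Some IHalt ->
      exec W P st 0 st
  | exec_step st i st1 T st2 :
      nth_error P (pc st) = Some i ->
      step_instr W i st = Some st1 ->
      exec W P st1 T st2 ->
      exec W P st (S T) st2.

(** * Input and output conventions

    Initially [R[0] = n], [R[1] = t], item [i] (counted from 0) occupies cells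
    [3i], [3i+1], [3i+2], and everything else is 0.  On halting, cell [i] holds
    the number of copies taken of item [i]. *)

Definition encode_items (l : list item) : list Z :=
  flat_map (fun it => [item_size it; item_value it; item_mult it]) l.

Definition init_state (I : instance) : state :=
  State 0
        (fun r => nth r [Z.of_nat (num_items I); capacity I] 0)
        (fun a => nth a (encode_items (items I)) 0).

Definition output (I : instance) (st : state) : list Z :=
  map (mem st) (seq 0 (num_items I)).

(* Main.v *)
Require Import Defs.
From Stdlib Require Import ZArith List Bool Lia.
Import Defs ListNotations.
Open Scope Z_scope.

(** Take copies greedily by the ratio of value to size.  A solution that
    differs from the greedy one in more than [2s] copies contains, by pigeonhole
    on partial sums in a window of [2s] values, added and removed copies of equal
    total size; undoing them loses nothing.  So some optimal solution is within
    [2s] copies of the greedy one, and it suffices to run a dynamic program over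
    size changes of absolute value at most [2 s^2].  For each of the [s] sizes it
    has one step for added and one for removed copies.  Since the gain of the best
    [j] copies of one size is concave in [j], a step is, on each residue class, a
    row-maximum problem for an inverse Monge matrix, which SMAWK solves in linear
    time: [O(s^2)] per step.

    The greedy solution and the [2s] best copies of each size come from linear-time
    weighted selection.  Its pivot is an approximate median: sort blocks by
    insertion, keep every fourth element, double the block size, repeat. *)

(** * A structured language over registers and arrays *)

(** The bound [n + s^3] leaves no room for a logarithm. Hence selection replaces sorting (only lists
    of at most [2 s] copies are ever sorted), and SMAWK replaces divide and conquer. The classes of
    equal size partition the items and each class is visited twice, so all selections together cost
    [O(n)]. Impossible changes in a step are not undefined but cost a penalty [BIG] per copy. This
    makes every gain table concave on its whole range, so the matrices are total and inverse Monge.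
    [BIG] exceeds all true gains together, so a path of nonnegative total gain never uses a
    penalized change. Items of value at most 0 get multiplicity 0, so that taking everything is
    optimal whenever everything fits. The machine has no recursion: the pivot search and SMAWK are
    loops over levels whose work shrinks geometrically. The program is verified in a small
    structured language, whose cost model counts loop tests; compilation multiplies the cost by the
    constant length of the code. *)

Inductive expr :=
  | EV (x : nat)
  | EC (z : Z)
  | EO (o : binop) (a b : expr)
  | EL (q : nat) (i : expr).

Inductive cond :=
  | CLt (a b : expr)
  | CAnd (c d : cond).

Inductive cmd :=
  | Skip
  | Asg (x : nat) (e : expr)
  | Sto (q : nat) (i e : expr)
  | Seq (c d : cmd)
  | If (b : cond) (c d : cmd)
  | While (b : cond) (c : cmd).

Record st := St { rg : nat -> Z; ar : nat -> Z -> Z }.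

Definition setr (s : st) (x : nat) (z : Z) : st := St (update (rg s) x z) (ar s).

Definition seta (s : st) (q : nat) (i z : Z) : st :=
  St (rg s)
     (fun q' => if Nat.eqb q' q
                then (fun j => if j =? i then z else ar s q j)
                else ar s q').

(** Programs here need only four operations; the others get a dummy value and are excluded by
    [op_ok]. *)
Definition op_val (o : binop) (a b : Z) : Z :=
  match o with
  | Add => a + b
  | Sub => a - b
  | Mul => a * b
  | Div => a / b
  | _ => 0
  end.

Definition op_ok (o : binop) (b : Z) : Prop :=
  match o with
  | Add | Sub | Mul => True
  | Div => b <> 0
  | _ => False
  end.

Fixpoint ev (s : st) (e : expr) : Z :=
  match e with
  | EV x => rg s x
  | EC z => z
  | EO o a b => op_val o (ev s a) (ev s b)
  | EL q i => ar s q (ev s i)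
  end.

Fixpoint tvp (s : st) (b : cond) : Prop :=
  match b with
  | CLt a b => ev s a < ev s b
  | CAnd c d => tvp s c /\ tvp s d
  end.

Lemma tvp_dec s b : tvp s b \/ ~ tvp s b.
Proof. induction b; cbn; [lia | tauto]. Qed.

(** [B] bounds all words of the structured program and [n] is the number of
    items.  Array 0 is the raw memory below address [3n]. *)
Section Semantics.

Variables B n : Z.

Definition idx_ok (q : nat) (i : Z) : Prop :=
  match q with O => 0 <= i < 3 * n | S _ => 0 <= i <= B end.

Fixpoint safe (s : st) (e : expr) : Prop :=
  match e with
  | EV x => True
  | EC z => Z.abs z <= B
  | EO o a b => safe s a /\ safe s b /\ op_ok o (ev s b)
                /\ Z.abs (op_val o (ev s a) (ev s b)) <= B
  | EL q i => safe s i /\ idx_ok q (ev s i)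
  end.

Fixpoint safec (s : st) (b : cond) : Prop :=
  match b with
  | CLt a b => safe s a /\ safe s b
  | CAnd c d => safec s c /\ (tvp s c -> safec s d)
  end.

(* The cost counts loop tests only: between two of them the compiled code runs
   forward, hence takes at most as many steps as the program is long. *)
Inductive bs : cmd -> st -> Z -> st -> Prop :=
  | bs_skip s : bs Skip s 0 s
  | bs_asg s x e : safe s e -> bs (Asg x e) s 0 (setr s x (ev s e))
  | bs_sto s q i e : safe s i -> safe s e -> idx_ok q (ev s i) ->
      bs (Sto q i e) s 0 (seta s q (ev s i) (ev s e))
  | bs_seq s c d t1 s1 t2 s2 : bs c s t1 s1 -> bs d s1 t2 s2 ->
      bs (Seq c d) s (t1 + t2) s2
  | bs_if_t s b c d t s' : safec s b -> tvp s b -> bs c s t s' ->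
      bs (If b c d) s t s'
  | bs_if_f s b c d t s' : safec s b -> ~ tvp s b -> bs d s t s' ->
      bs (If b c d) s t s'
  | bs_while_f s b c : safec s b -> ~ tvp s b -> bs (While b c) s 1 s
  | bs_while_t s b c t1 s1 t2 s2 : safec s b -> tvp s b -> bs c s t1 s1 ->
      bs (While b c) s1 t2 s2 -> bs (While b c) s (1 + t1 + t2) s2.

Lemma bs_nonneg c s t s' : bs c s t s' -> 0 <= t.
Proof. induction 1; lia. Qed.

(** * Total correctness with running time, and frame conditions *)

Definition wp (c : cmd) (s : st) (Q : st -> Z -> Prop) : Prop :=
  exists s' t, bs c s t s' /\ Q s' t.

Definition inb (x : nat) (l : list nat) : bool := existsb (Nat.eqb x) l.

Fixpoint modr (c : cmd) : list nat :=
  match c with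
  | Asg x _ => [x]
  | Seq c d | If _ c d => modr c ++ modr d
  | While _ c => modr c
  | _ => []
  end.

Fixpoint moda (c : cmd) : list nat :=
  match c with
  | Sto q _ _ => [q]
  | Seq c d | If _ c d => moda c ++ moda d
  | While _ c => moda c
  | _ => []
  end.

(** The frame is read off the syntax. Membership is a boolean, so that [frs] can show by [eq_refl]
    that a name is not modified. *)
Definition fr (c : cmd) (s s' : st) : Prop :=
  (forall x, inb x (modr c) = false -> rg s' x = rg s x)
  /\ (forall q, inb q (moda c) = false -> ar s' q = ar s q).

Lemma fr_refl c s : fr c s s.
Proof. split; auto. Qed.

Lemma fr_trans c s1 s2 s3 : fr c s1 s2 -> fr c s2 s3 -> fr c s1 s3.
Proof.
  intros [A1 A2] [B1 B2]; split; intros x Hx;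
    [rewrite B1, A1 | rewrite B2, A2]; auto.
Qed.

Lemma inb_app x l1 l2 : inb x (l1 ++ l2) = inb x l1 || inb x l2.
Proof. apply existsb_app. Qed.

Lemma fr_sub c d s s' :
  (forall x, inb x (modr d) = false -> inb x (modr c) = false) ->
  (forall q, inb q (moda d) = false -> inb q (moda c) = false) ->
  fr c s s' -> fr d s s'.
Proof. intros H1 H2 [A1 A2]; split; auto. Qed.

Lemma bs_fr c s t s' : bs c s t s' -> fr c s s'.
Proof.
  induction 1; try apply fr_refl.
  - split; cbn; intros y Hy; auto. unfold update.
    destruct (Nat.eqb y x); auto; discriminate.
  - split; cbn; intros y Hy; auto.
    destruct (Nat.eqb y q); auto; discriminate.
  - eapply fr_trans; [eapply fr_sub, IHbs1 | eapply fr_sub, IHbs2];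
      cbn [modr moda]; intros ?; rewrite inb_app; intros ?%orb_false_iff; tauto.
  - eapply fr_sub, IHbs; cbn [modr moda]; intros ?; rewrite inb_app;
      intros ?%orb_false_iff; tauto.
  - eapply fr_sub, IHbs; cbn [modr moda]; intros ?; rewrite inb_app;
      intros ?%orb_false_iff; tauto.
  - eapply fr_trans; [eapply fr_sub, IHbs1 | eapply fr_sub, IHbs2]; auto.
Qed.

(** Specifications of subprograms are used through this rule. It supplies the frame condition, so
    they need not list what stays unchanged. *)
Lemma wp_conseq c s (Q Q' : st -> Z -> Prop) :
  wp c s Q -> (forall s' t, 0 <= t -> fr c s s' -> Q s' t -> Q' s' t) ->
  wp c s Q'.
Proof.
  intros (s' & t & Hb & HQ) H. exists s', t. split; auto.
  apply H; eauto using bs_fr, bs_nonneg.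
Qed.

Lemma wp_skip s (Q : st -> Z -> Prop) : Q s 0 -> wp Skip s Q.
Proof. eexists _, _; split; eauto using bs. Qed.

Lemma wp_asg s x e (Q : st -> Z -> Prop) :
  safe s e -> Q (setr s x (ev s e)) 0 -> wp (Asg x e) s Q.
Proof. eexists _, _; split; eauto using bs. Qed.

Lemma wp_sto s q i e (Q : st -> Z -> Prop) :
  (safe s i /\ safe s e /\ idx_ok q (ev s i)) ->
  Q (seta s q (ev s i) (ev s e)) 0 -> wp (Sto q i e) s Q.
Proof. intros (?&?&?); eexists _, _; split; eauto using bs. Qed.

Lemma wp_seq s c d (Q : st -> Z -> Prop) :
  wp c s (fun s1 t1 => wp d s1 (fun s2 t2 => Q s2 (t1 + t2))) ->
  wp (Seq c d) s Q.
Proof.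
  intros (s1 & t1 & H1 & s2 & t2 & H2 & HQ).
  exists s2, (t1 + t2); split; eauto using bs.
Qed.

Lemma wp_asg_seq s x e d Q :
  safe s e -> wp d (setr s x (ev s e)) Q -> wp (Seq (Asg x e) d) s Q.
Proof.
  intros. apply wp_seq, wp_asg; auto.
Qed.

Lemma wp_sto_seq s q i e d Q :
  (safe s i /\ safe s e /\ idx_ok q (ev s i)) ->
  wp d (seta s q (ev s i) (ev s e)) Q -> wp (Seq (Sto q i e) d) s Q.
Proof.
  intros. apply wp_seq, wp_sto; auto.
Qed.

Lemma wp_skip_seq s d Q : wp d s Q -> wp (Seq Skip d) s Q.
Proof. intros. apply wp_seq, wp_skip; auto. Qed.

Lemma wp_seq_assoc s c d e Q :
  wp (Seq c (Seq d e)) s Q -> wp (Seq (Seq c d) e) s Q.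
Proof.
  intros (s3 & t & H & HQ). inversion H; subst.
  match goal with H : bs (Seq d e) _ _ _ |- _ => inversion H; subst end.
  eexists s3, _. split; [|exact HQ]. rewrite Z.add_assoc. eauto using bs.
Qed.

Lemma wp_if s b c d Q :
  safec s b -> (tvp s b -> wp c s Q) -> (~ tvp s b -> wp d s Q) ->
  wp (If b c d) s Q.
Proof.
  intros Hs H1 H2. destruct (tvp_dec s b) as [H|H];
    [destruct (H1 H) as (s'&t&?&?) | destruct (H2 H) as (s'&t&?&?)];
    exists s', t; split; auto using bs_if_t, bs_if_f.
Qed.

(** The continuation is verified once in each branch, which saves inventing an assertion for the
    join. *)
Lemma wp_if_seq s b c d e Q :
  safec s b -> (tvp s b -> wp (Seq c e) s Q) ->
  (~ tvp s b -> wp (Seq d e) s Q) ->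
  wp (Seq (If b c d) e) s Q.
Proof.
  intros Hs H1 H2. apply wp_seq, wp_if; auto.
  - intros H. destruct (H1 H) as (s'&t&Hb&?). inversion Hb; subst.
    exists s1, t1; split; auto. exists s', t2; auto.
  - intros H. destruct (H2 H) as (s'&t&Hb&?). inversion Hb; subst.
    exists s1, t1; split; auto. exists s', t2; auto.
Qed.

(* The potential [phi] bounds both the number of iterations and their cost. *)
Lemma wp_while (I : st -> Prop) (phi : st -> Z) s b c (Q : st -> Z -> Prop) :
  I s ->
  (forall s1, fr c s s1 -> I s1 -> safec s1 b /\ 0 <= phi s1) ->
  (forall s1, fr c s s1 -> I s1 -> tvp s1 b ->
     wp c s1 (fun s2 t => I s2 /\ t + 1 + phi s2 <= phi s1)) ->
  (forall s1 t, 0 <= t -> fr c s s1 -> I s1 -> ~ tvp s1 b ->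
     t <= phi s - phi s1 + 1 -> Q s1 t) ->
  wp (While b c) s Q.
Proof.
  intros HI Hsafe Hbody Hexit.
  assert (H : forall k s1, phi s1 <= Z.of_nat k -> fr c s s1 -> I s1 ->
    exists s2 t, bs (While b c) s1 t s2 /\ fr c s s2 /\ I s2 /\ ~ tvp s2 b
                 /\ t <= phi s1 - phi s2 + 1).
  { induction k as [|k IH]; intros s1 Hk Hf H1;
      destruct (Hsafe s1 Hf H1) as [Hs Hp];
      (destruct (tvp_dec s1 b) as [Hb|Hb];
        [destruct (Hbody s1 Hf H1 Hb) as (s2 & t & Hb2 & HI2 & Ht)
        |exists s1, 1; repeat split; auto using bs_while_f; try apply Hf; lia]);
      pose proof (bs_nonneg _ _ _ _ Hb2);
      assert (Hf2 : fr c s s2) by (eapply fr_trans; eauto using bs_fr);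
      destruct (Hsafe s2 Hf2 HI2) as [Hs2 Hp2]; [lia|].
    destruct (IH s2) as (s3 & t3 & H3 & Hf3 & HI3 & Hb3 & Ht3); auto; [lia|].
    exists s3, (1 + t + t3).
    split; [eapply bs_while_t; eauto | repeat (split; [assumption|]); lia]. }
  destruct (Hsafe s (fr_refl c s) HI) as [_ Hp].
  destruct (H (Z.to_nat (phi s)) s) as (s2 & t & Hb & Hf & HI2 & Hnb & Ht);
    auto using fr_refl; [lia|].
  exists s2, t; split; auto. apply Hexit; auto. eauto using bs_nonneg.
Qed.

End Semantics.

(** * Compilation to the word RAM *)

(** Registers from 100 on serve as evaluation stack; the registers named in programs lie below. *)
Definition tmp : nat := 100.

(** Arrays 1 to 31 are interleaved with stride 32: cell [i] of array [q] has address
    [32 (n + i) + q]. No array length has to be fixed in advance, and the lowest such address lies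
    beyond the input, which is array 0. Register 0 contributes [n]. *)
Definition addr_code (q d : nat) : list instr :=
  match q with
  | O => []
  | S _ => [IOp Add (tmp + d) (tmp + d) 0; IConst (tmp + S d) 32;
            IOp Mul (tmp + d) (tmp + d) (tmp + S d);
            IConst (tmp + S d) (Z.of_nat q);
            IOp Add (tmp + d) (tmp + d) (tmp + S d)]
  end.

(** The value of the expression ends up at level [d] of the stack. There is no move instruction, but
    [And] of a register with itself copies it, negative words included. *)
Fixpoint ce (d : nat) (e : expr) : list instr :=
  match e with
  | EV x => [IOp And (tmp + d) x x]
  | EC z => [IConst (tmp + d) z]
  | EO o a b => ce d a ++ ce (S d) b ++ [IOp o (tmp + d) (tmp + d) (tmp + S d)]
  | EL q i => ce d i ++ addr_code q d ++ [ILoad (tmp + d) (tmp + d)]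
  end.

(** The length does not depend on position and targets, so jump targets can be computed before the
    code that contains them. *)
Fixpoint cnd_len (b : cond) : nat :=
  match b with
  | CLt a b => length (ce 0 a) + length (ce 1 b) + 2
  | CAnd c d => cnd_len c + cnd_len d
  end.

Fixpoint cnd (p : nat) (b : cond) (lf : nat) : list instr :=
  match b with
  | CLt a b => ce 0 a ++ ce 1 b
      ++ [IJumpLt tmp (tmp + 1) (p + length (ce 0 a) + length (ce 1 b) + 2);
          IJump lf]
  | CAnd c d => cnd p c lf ++ cnd (p + cnd_len c) d lf
  end.

Fixpoint cc (p : nat) (c : cmd) : list instr :=
  match c with
  | Skip => []
  | Asg x e => ce 0 e ++ [IOp And x tmp tmp]
  | Sto q i e => ce 0 i ++ addr_code q 0 ++ ce 1 e ++ [IStore tmp (tmp + 1)]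
  | Seq c d => let l := cc p c in l ++ cc (p + length l) d
  | If b c d =>
      let l1 := cc (p + cnd_len b) c in
      let lf := (p + cnd_len b + length l1 + 1)%nat in
      let l2 := cc lf d in
      cnd p b lf ++ l1 ++ [IJump (lf + length l2)] ++ l2
  | While b c =>
      let l := cc (p + cnd_len b) c in
      cnd p b (p + cnd_len b + length l + 1) ++ l ++ [IJump p]
  end.

Fixpoint ok_e (e : expr) : bool :=
  match e with
  | EV x => Nat.ltb x tmp
  | EC _ => true
  | EO _ a b => ok_e a && ok_e b
  | EL q i => Nat.ltb q 32 && ok_e i
  end.

Fixpoint ok_b (b : cond) : bool :=
  match b with
  | CLt a b => ok_e a && ok_e b
  | CAnd c d => ok_b c && ok_b d
  end.

(* Register 0 holds the number of items, which the addresses depend on. *)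
Fixpoint ok_c (c : cmd) : bool :=
  match c with
  | Skip => true
  | Asg x e => Nat.ltb 0 x && Nat.ltb x tmp && ok_e e
  | Sto q i e => Nat.ltb q 32 && ok_e i && ok_e e
  | Seq c d => ok_c c && ok_c d
  | If b c d => ok_b b && ok_c c && ok_c d
  | While b c => ok_b b && ok_c c
  end.

Lemma cnd_length b : forall p lf, length (cnd p b lf) = cnd_len b.
Proof.
  induction b; intros; cbn; rewrite !length_app; cbn; [lia|].
  rewrite IHb1, IHb2; lia.
Qed.

(** * Simulation of the structured language by the machine *)

Section Compile.

Variables (B n W : Z) (P : program).
Hypothesis HB : 32 <= B.
Hypothesis Hn : 0 <= n.
Hypothesis HW : 32 * (n + B) + 32 <= W.

Inductive steps : state -> nat -> state -> Prop :=
  | steps_0 st : steps st 0 st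
  | steps_S st i st1 T st2 :
      nth_error P (pc st) = Some i -> step_instr W i st = Some st1 ->
      steps st1 T st2 -> steps st (S T) st2.

Lemma steps_trans a t1 b t2 c :
  steps a t1 b -> steps b t2 c -> steps a (t1 + t2) c.
Proof. induction 1; cbn; intros; auto. econstructor; eauto. Qed.

Lemma steps_1 a i b :
  nth_error P (pc a) = Some i -> step_instr W i a = Some b -> steps a 1 b.
Proof. intros; econstructor; eauto; constructor. Qed.

Lemma steps_exec a t b t' c :
  steps a t b -> exec W P b t' c -> exec W P a (t + t') c.
Proof. induction 1; cbn; intros; auto. econstructor; eauto. Qed.

Definition code_at (p : nat) (l : list instr) : Prop :=
  exists pre post, P = pre ++ l ++ post /\ length pre = p.

Lemma code_at_app p l1 l2 :
  code_at p (l1 ++ l2) -> code_at p l1 /\ code_at (p + length l1) l2.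
Proof.
  intros (pre & post & HP & <-). split.
  - exists pre, (l2 ++ post). now rewrite HP, !app_assoc.
  - exists (pre ++ l1), post. now rewrite HP, length_app, !app_assoc.
Qed.

Lemma code_at_cons p i l :
  code_at p (i :: l) -> nth_error P p = Some i /\ code_at (S p) l.
Proof.
  intros (pre & post & HP & <-). split.
  - rewrite HP, nth_error_app2, Nat.sub_diag; auto.
  - exists (pre ++ [i]), post. rewrite HP, length_app, <- !app_assoc. cbn.
    split; auto; lia.
Qed.

Definition cell (q : nat) (i : Z) : nat :=
  match q with O => Z.to_nat i | S _ => Z.to_nat (32 * (n + i) + Z.of_nat q) end.

Definition valid_idx (q : nat) (i : Z) : Prop :=
  match q with O => 0 <= i < 3 * n | S _ => 0 <= i end.

(** Division by 32 with remainder recovers [i] and [q], and all interleaved cells lie above the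
    cells of array 0. *)
Lemma cell_inj q i q' i' :
  (q < 32)%nat -> (q' < 32)%nat -> valid_idx q i -> valid_idx q' i' ->
  cell q i = cell q' i' -> q = q' /\ i = i'.
Proof. destruct q, q'; cbn [cell valid_idx]; lia. Qed.

Definition wf (s : st) : Prop :=
  (forall x, (x < tmp)%nat -> Z.abs (rg s x) <= B)
  /\ (forall q i, Z.abs (ar s q i) <= B)
  /\ rg s 0 = n.

Definition mt (s : st) (r : nat -> Z) (m : nat -> Z) : Prop :=
  (forall x, (x < tmp)%nat -> r x = rg s x)
  /\ (forall q i, (q < 32)%nat -> valid_idx q i -> m (cell q i) = ar s q i).

Definition runs (p : nat) (r m : nat -> Z) (k p' : nat) (r' m' : nat -> Z) :=
  steps (State p r m) k (State p' r' m').

Lemma set_reg_ok (s : state) d z :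
  Z.abs z <= W ->
  set_reg W s d z = Some (State (S (pc s)) (update (reg s) d z) (mem s)).
Proof. intros H. unfold set_reg. now rewrite (proj2 (Z.leb_le _ _) H). Qed.

Lemma update_same f x z : update f x z x = z.
Proof. unfold update. now rewrite Nat.eqb_refl. Qed.

Lemma update_other f x z y : y <> x -> update f x z y = f y.
Proof. unfold update. intros H. now rewrite (proj2 (Nat.eqb_neq _ _) H). Qed.

Ltac upd := repeat (rewrite update_same || rewrite update_other by lia).

Lemma op_step (s : state) i o d a b z :
  nth_error P (pc s) = Some i -> i = IOp o d a b ->
  eval_binop o (reg s a) (reg s b) = Some z -> Z.abs z <= W ->
  steps s 1 (State (S (pc s)) (update (reg s) d z) (mem s)).
Proof.
  intros H -> He Hz. eapply steps_1; eauto. cbn. rewrite He.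
  now apply set_reg_ok.
Qed.

Lemma const_step (s : state) d z :
  nth_error P (pc s) = Some (IConst d z) -> Z.abs z <= W ->
  steps s 1 (State (S (pc s)) (update (reg s) d z) (mem s)).
Proof. intros H Hz. eapply steps_1; eauto. cbn. now apply set_reg_ok. Qed.

Lemma addr_code_ok q d p r m i :
  (q < 32)%nat -> code_at p (addr_code q d) -> r 0%nat = n ->
  r (tmp + d)%nat = i -> idx_ok B n q i ->
  exists r', runs p r m (length (addr_code q d)) (p + length (addr_code q d)) r' m
    /\ (forall x, (x < tmp + d)%nat -> r' x = r x)
    /\ r' (tmp + d)%nat = Z.of_nat (cell q i) /\ 0 <= Z.of_nat (cell q i) <= W.
Proof.
  intros Hq Hc H0 Hi Hok. destruct q as [|q];
    cbn [addr_code length cell idx_ok] in *.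
  - exists r. rewrite Nat.add_0_r. repeat split; auto; try lia. constructor.
  - apply code_at_cons in Hc as [C1 Hc]. apply code_at_cons in Hc as [C2 Hc].
    apply code_at_cons in Hc as [C3 Hc]. apply code_at_cons in Hc as [C4 Hc].
    apply code_at_cons in Hc as [C5 _].
    set (d0 := (tmp + d)%nat) in *. set (d1 := (tmp + S d)%nat) in *.
    assert (Hd : d1 = S d0) by (unfold d0, d1; lia).
    assert (Hd0 : (0 < d0)%nat) by (unfold d0, tmp; lia).
    eexists. split; [|split; [|split]].
    + unfold runs.
      change 5%nat with (1 + (1 + (1 + (1 + 1))))%nat at 1.
      eapply steps_trans;
        [eapply op_step; [exact C1|reflexivity|cbn [eval_binop]; reflexivity|]|].
      { cbn [reg]. rewrite Hi, H0. lia. }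
      eapply steps_trans; [eapply const_step; [exact C2|lia]|].
      eapply steps_trans;
        [eapply op_step; [exact C3|reflexivity|cbn [eval_binop]; reflexivity|]|].
      { cbn [reg pc mem]. upd. rewrite Hi, H0. lia. }
      eapply steps_trans; [eapply const_step; [exact C4|lia]|].
      cbn [reg pc mem]. replace (p + 5)%nat with (S (S (S (S (S p))))) by lia.
      eapply op_step; [exact C5|reflexivity|cbn [eval_binop reg]; reflexivity|].
      upd. rewrite Hi, H0. lia.
    + intros x Hx. cbn [reg]. now upd.
    + cbn [reg]. upd. rewrite Hi, H0. lia.
    + lia.
Qed.

Lemma ev_bound s e :
  wf s -> ok_e e = true -> safe B n s e -> Z.abs (ev s e) <= B.
Proof.
  intros (H1 & H2 & H3). destruct e; cbn; intros Hok Hs; auto.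
  - apply H1. now apply Nat.ltb_lt.
  - tauto.
Qed.

(** The clause on the registers below [tmp + d] lets the value of a left operand survive the
    evaluation of the right one, which works one level higher. *)
Lemma ce_ok s m e : wf s -> ok_e e = true -> safe B n s e ->
  forall d p r, code_at p (ce d e) -> mt s r m ->
  exists r', runs p r m (length (ce d e)) (p + length (ce d e)) r' m
    /\ (forall x, (x < tmp + d)%nat -> r' x = r x)
    /\ r' (tmp + d)%nat = ev s e.
Proof.
  intros Hwf. pose proof (fun e => ev_bound s e Hwf) as Hev.
  destruct Hwf as (W1 & W2 & W3).
  induction e as [x|z|o a IHa b IHb|q i IHi]; intros Hok Hs d p r Hc Hm.
  - apply code_at_cons in Hc as [Hc _]. cbn [ok_e] in Hok.
    apply Nat.ltb_lt in Hok.
    eexists. split; [|split]; cbn -[tmp].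
    + rewrite Nat.add_1_r. eapply op_step; [exact Hc|reflexivity|reflexivity|].
      cbn. rewrite Z.land_diag, (proj1 Hm) by auto. specialize (W1 x Hok). lia.
    + intros y Hy. apply update_other. lia.
    + cbn. rewrite update_same, Z.land_diag. apply (proj1 Hm); auto.
  - apply code_at_cons in Hc as [Hc _]. cbn in Hs.
    eexists. split; [|split]; cbn -[tmp].
    + rewrite Nat.add_1_r. eapply const_step; [exact Hc|lia].
    + intros y Hy. apply update_other. lia.
    + apply update_same.
  - assert (Hres := Hev _ Hok Hs).
    cbn -[tmp] in Hc, Hok, Hs. apply andb_true_iff in Hok as [Oa Ob].
    destruct Hs as (Sa & Sb & So & Sv).
    apply code_at_app in Hc as [Ca Hc]. apply code_at_app in Hc as [Cb Co].
    apply code_at_cons in Co as [Co _].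
    destruct (IHa Oa Sa d p r Ca Hm) as (r1 & R1 & F1 & E1).
    destruct (IHb Ob Sb (S d) _ r1 Cb) as (r2 & R2 & F2 & E2).
    { split; [|apply Hm]. intros x Hx. rewrite F1 by lia. apply Hm; auto. }
    eexists. split; [|split].
    + cbn -[tmp]. rewrite !length_app. unfold runs.
      eapply steps_trans; [exact R1|]. eapply steps_trans; [exact R2|].
      cbn -[tmp].
      replace (p + (length (ce d a) + (length (ce (S d) b) + 1)))%nat
        with (S (p + length (ce d a) + length (ce (S d) b))) by lia.
      eapply op_step with (z := op_val o (ev s a) (ev s b));
        [exact Co|reflexivity| |].
      * cbn -[tmp]. rewrite F2, E1, E2 by lia.
        destruct o; cbn in So |- *; try tauto.
        destruct (Z.eqb_spec (ev s b) 0); tauto.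
      * cbn in Hres. lia.
    + intros x Hx. cbn -[tmp]. rewrite update_other, F2, F1 by lia. auto.
    + cbn. now rewrite update_same.
  - cbn -[tmp addr_code Nat.ltb] in Hc, Hok, Hs. apply andb_true_iff in Hok as [Oq Oi].
    apply Nat.ltb_lt in Oq. destruct Hs as (Si & Hidx).
    apply code_at_app in Hc as [Ca Hc]. apply code_at_app in Hc as [Cb Co].
    apply code_at_cons in Co as [Co _].
    destruct (IHi Oi Si d p r Ca Hm) as (r1 & R1 & F1 & E1).
    destruct (addr_code_ok q d _ r1 m (ev s i) Oq Cb) as (r2 & R2 & F2 & E2 & E3);
      auto.
    { rewrite F1 by (unfold tmp; lia). rewrite (proj1 Hm) by (unfold tmp; lia).
      auto. }
    assert (Hcell : m (cell q (ev s i)) = ar s q (ev s i)).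
    { apply Hm; auto. destruct q; cbn in *; lia. }
    eexists. split; [|split].
    + cbn -[tmp addr_code]. rewrite !length_app. unfold runs.
      eapply steps_trans; [exact R1|]. eapply steps_trans; [exact R2|].
      cbn -[tmp addr_code].
      match goal with |- steps _ _ (State ?x _ _) =>
        replace x with (S (p + length (ce d i) + length (addr_code q d))) by lia
      end.
      eapply steps_1; [exact Co|]. cbn -[tmp]. rewrite E2.
      unfold is_address. rewrite Nat2Z.id, Hcell.
      rewrite (proj2 (Z.leb_le _ _) (proj1 E3)), (proj2 (Z.leb_le _ _) (proj2 E3)).
      cbn -[tmp]. apply set_reg_ok. specialize (W2 q (ev s i)). lia.
    + intros x Hx. cbn -[tmp]. rewrite update_other, F2, F1 by lia. auto.
    + cbn. now rewrite update_same.
Qed.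

Lemma cnd_ok s m b : wf s -> ok_b b = true -> safec B n s b ->
  forall p r lf, code_at p (cnd p b lf) -> mt s r m ->
  exists r' k, (k <= cnd_len b)%nat /\ mt s r' m
    /\ ((tvp s b /\ runs p r m k (p + cnd_len b) r' m)
        \/ (~ tvp s b /\ runs p r m k lf r' m)).
Proof.
  intros Hwf. induction b as [a b|b1 IH1 b2 IH2]; intros Hok Hs p r lf Hc Hm.
  - cbn -[tmp] in Hc, Hok, Hs. apply andb_true_iff in Hok as [Oa Ob].
    apply code_at_app in Hc as [Ca Hc]. apply code_at_app in Hc as [Cb Co].
    apply code_at_cons in Co as [C1 Co]. apply code_at_cons in Co as [C2 _].
    destruct (ce_ok s m a Hwf Oa (proj1 Hs) 0 p r Ca Hm) as (r1 & R1 & F1 & E1).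
    assert (Hm1 : mt s r1 m).
    { split; [|apply Hm]. intros x Hx. rewrite F1 by lia. apply Hm; auto. }
    destruct (ce_ok s m b Hwf Ob (proj2 Hs) 1 _ r1 Cb Hm1) as (r2 & R2 & F2 & E2).
    assert (Hm2 : mt s r2 m).
    { split; [|apply Hm]. intros x Hx. rewrite F2 by lia. apply Hm1; auto. }
    assert (H1 : step_instr W
        (IJumpLt tmp (tmp + 1) (p + length (ce 0 a) + length (ce 1 b) + 2))
        (State (p + length (ce 0 a) + length (ce 1 b)) r2 m)
        = Some (State (if ev s a <? ev s b
                       then p + length (ce 0 a) + length (ce 1 b) + 2
                       else S (p + length (ce 0 a) + length (ce 1 b))) r2 m)).
    { cbn -[tmp]. rewrite E2, F2 by lia. rewrite Nat.add_0_r in E1.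
      now rewrite E1. }
    destruct (Z.ltb_spec (ev s a) (ev s b)).
    + exists r2, (length (ce 0 a) + (length (ce 1 b) + 1))%nat.
      split; [cbn; lia|]. split; auto. left. split; auto.
      eapply steps_trans; [exact R1|]. eapply steps_trans; [exact R2|].
      eapply steps_1; [exact C1|]. rewrite H1. cbn. do 2 f_equal. lia.
    + exists r2, (length (ce 0 a) + (length (ce 1 b) + 2))%nat.
      split; [cbn; lia|]. split; auto. right. split; [cbn; lia|].
      eapply steps_trans; [exact R1|]. eapply steps_trans; [exact R2|].
      econstructor; [exact C1|exact H1|].
      eapply steps_1; [exact C2|reflexivity].
  - cbn in Hc, Hok, Hs. apply andb_true_iff in Hok as [O1 O2].
    apply code_at_app in Hc as [C1 C2]. rewrite cnd_length in C2.
    destruct (IH1 O1 (proj1 Hs) p r lf C1 Hm)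
      as (r1 & k1 & Hk1 & Hm1 & [[T1 R1]|[T1 R1]]).
    + destruct (IH2 O2 (proj2 Hs T1) _ r1 lf C2 Hm1)
        as (r2 & k2 & Hk2 & Hm2 & H2).
      exists r2, (k1 + k2)%nat. split; [cbn; lia|]. split; auto.
      destruct H2 as [[T2 R2]|[T2 R2]]; [left|right]; cbn.
      * split; auto. rewrite Nat.add_assoc. eapply steps_trans; eauto.
      * split; [tauto|]. eapply steps_trans; eauto.
    + exists r1, k1. split; [cbn; lia|]. split; auto. right. cbn; tauto.
Qed.

Lemma wf_setr s x z :
  wf s -> (0 < x)%nat -> Z.abs z <= B -> wf (setr s x z).
Proof.
  intros (H1 & H2 & H3) Hx Hz. repeat split; cbn; auto.
  - intros y Hy. unfold update. destruct (Nat.eqb y x); auto.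
  - rewrite update_other; auto; lia.
Qed.

Lemma wf_seta s q i z : wf s -> Z.abs z <= B -> wf (seta s q i z).
Proof.
  intros (H1 & H2 & H3) Hz. repeat split; cbn; auto.
  intros q' j. destruct (Nat.eqb q' q); auto. destruct (j =? i); auto.
Qed.

Lemma cc_ok c s t s' : bs B n c s t s' -> ok_c c = true -> wf s ->
  forall p r m, code_at p (cc p c) -> mt s r m ->
  exists r' m' k, runs p r m k (p + length (cc p c)) r' m'
    /\ mt s' r' m' /\ wf s'
    /\ Z.of_nat k <= Z.of_nat (length (cc p c)) * (t + 1).
Proof.
  assert (Hlen : forall c p p', length (cc p c) = length (cc p' c)).
  { clear. induction c; intros; cbn -[tmp]; auto.
    - rewrite !length_app. erewrite IHc1, IHc2; eauto.
    - rewrite !length_app, !cnd_length. cbn. erewrite IHc1, IHc2; eauto.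
    - rewrite !length_app, !cnd_length. erewrite IHc; eauto. }
  induction 1 as [s|s x e Hs|s q i e Hi He Hq|s c d t1 s1 t2 s2 H1 IH1 H2 IH2
    |s b c d t s' Hs Hb H IH|s b c d t s' Hs Hb H IH|s b c Hs Hb
    |s b c t1 s1 t2 s2 Hs Hb H1 IH1 H2 IH2];
    intros Hok Hwf p r m Hc Hm.
  - exists r, m, 0%nat. rewrite Nat.add_0_r. repeat split; try apply Hm; try apply Hwf; cbn; auto; try lia.
    constructor.
  - cbn -[tmp Nat.ltb] in Hc, Hok. rewrite !andb_true_iff, !Nat.ltb_lt in Hok.
    destruct Hok as [[X1 X2] Oe].
    apply code_at_app in Hc as [C1 C2]. apply code_at_cons in C2 as [C2 _].
    destruct (ce_ok s m e Hwf Oe Hs 0 p r C1 Hm) as (r1 & R1 & F1 & E1).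
    assert (Hb := ev_bound s e Hwf Oe Hs). rewrite Nat.add_0_r in E1.
    eexists _, _, _. split; [|split; [|split]].
    + cbn -[tmp]. rewrite length_app. unfold runs.
      eapply steps_trans; [exact R1|]. cbn -[tmp].
      rewrite Nat.add_assoc, Nat.add_1_r.
      eapply op_step with (z := ev s e); [exact C2|reflexivity| |].
      * cbn -[tmp]. rewrite E1, Z.land_diag. auto.
      * lia.
    + split; cbn -[tmp]; [|apply Hm]. intros y Hy. unfold update.
      destruct (Nat.eqb y x); auto. rewrite F1 by lia. apply Hm; auto.
    + apply wf_setr; auto.
    + cbn -[tmp]. rewrite length_app. cbn. lia.
  - cbn -[tmp addr_code Nat.ltb] in Hc, Hok. rewrite !andb_true_iff, !Nat.ltb_lt in Hok.
    destruct Hok as [[X1 Oi] Oe].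
    apply code_at_app in Hc as [C1 C2]. apply code_at_app in C2 as [C2 C3].
    apply code_at_app in C3 as [C3 C4]. apply code_at_cons in C4 as [C4 _].
    destruct (ce_ok s m i Hwf Oi Hi 0 p r C1 Hm) as (r1 & R1 & F1 & E1).
    destruct (addr_code_ok q 0 _ r1 m (ev s i) X1 C2) as (r2 & R2 & F2 & E2 & E3);
      auto.
    { rewrite F1 by (unfold tmp; lia). rewrite (proj1 Hm) by (unfold tmp; lia).
      apply Hwf. }
    assert (Hm2 : mt s r2 m).
    { split; [|apply Hm]. intros x Hx. rewrite F2, F1 by lia. apply Hm; auto. }
    destruct (ce_ok s m e Hwf Oe He 1 _ r2 C3 Hm2) as (r3 & R3 & F3 & E4).
    assert (Hb := ev_bound s e Hwf Oe He). rewrite Nat.add_0_r in E2.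
    eexists _, _, _. split; [|split; [|split]].
    + cbn -[tmp addr_code]. rewrite !length_app. unfold runs.
      eapply steps_trans; [exact R1|]. eapply steps_trans; [exact R2|].
      eapply steps_trans; [exact R3|]. cbn -[tmp addr_code].
      rewrite !Nat.add_assoc, Nat.add_1_r.
      eapply steps_1; [exact C4|]. cbn -[tmp addr_code].
      rewrite F3 by lia. rewrite E2, E4. unfold is_address.
      rewrite Nat2Z.id.
      now rewrite (proj2 (Z.leb_le _ _) (proj1 E3)), (proj2 (Z.leb_le _ _) (proj2 E3)).
    + split; cbn -[tmp].
      * intros x Hx. rewrite F3 by lia. apply Hm2; auto.
      * intros q' j Hq' Hj. unfold update.
        assert (Hv : valid_idx q (ev s i)) by (destruct q; cbn in *; lia).
        destruct (Nat.eqb_spec (cell q' j) (cell q (ev s i))) as [Heq|Hne].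
        -- apply cell_inj in Heq as [-> ->]; auto.
           now rewrite Nat.eqb_refl, Z.eqb_refl.
        -- rewrite (proj2 Hm) by auto. destruct (Nat.eqb_spec q' q) as [->|]; auto.
           destruct (Z.eqb_spec j (ev s i)) as [->|]; auto. now elim Hne.
    + apply wf_seta; auto.
    + cbn -[tmp addr_code]. rewrite !length_app. cbn. lia.
  - cbn -[tmp] in Hc, Hok |- *. apply andb_true_iff in Hok as [O1 O2].
    apply code_at_app in Hc as [C1 C2].
    destruct (IH1 O1 Hwf p r m C1 Hm) as (r1 & m1 & k1 & R1 & M1 & W1 & K1).
    destruct (IH2 O2 W1 _ r1 m1 C2 M1) as (r2 & m2 & k2 & R2 & M2 & W2 & K2).
    apply bs_nonneg in H1, H2.
    exists r2, m2, (k1 + k2)%nat. split; [|split; [|split]]; auto.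
    + rewrite length_app, Nat.add_assoc. eapply steps_trans; eauto.
    + rewrite length_app, Nat2Z.inj_add. nia.
  - cbn -[tmp] in Hc, Hok |- *. rewrite !andb_true_iff in Hok.
    destruct Hok as [[O1 O2] O3].
    apply code_at_app in Hc as [C1 C2]. rewrite cnd_length in C2.
    apply code_at_app in C2 as [C2 C3]. apply code_at_cons in C3 as [C3 C4].
    destruct (cnd_ok s m b Hwf O1 Hs _ r _ C1 Hm)
      as (r1 & k1 & Hk1 & Hm1 & [[T1 R1]|[T1 R1]]); [|tauto].
    destruct (IH O2 Hwf _ r1 m C2 Hm1) as (r2 & m2 & k2 & R2 & M2 & W2 & K2).
    apply bs_nonneg in H.
    exists r2, m2, (k1 + (k2 + 1))%nat. split; [|split; [|split]]; auto.
    + eapply steps_trans; [exact R1|]. eapply steps_trans; [exact R2|].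
      eapply steps_1; [exact C3|]. cbn. do 2 f_equal.
      rewrite !length_app, cnd_length. cbn. lia.
    + rewrite !length_app, cnd_length. cbn [length]. nia.
  - cbn -[tmp] in Hc, Hok |- *. rewrite !andb_true_iff in Hok.
    destruct Hok as [[O1 O2] O3].
    apply code_at_app in Hc as [C1 C2]. rewrite cnd_length in C2.
    apply code_at_app in C2 as [C2 C3]. apply code_at_cons in C3 as [C3 C4].
    destruct (cnd_ok s m b Hwf O1 Hs _ r _ C1 Hm)
      as (r1 & k1 & Hk1 & Hm1 & [[T1 R1]|[T1 R1]]); [tauto|].
    replace (S (p + cnd_len b + length (cc (p + cnd_len b) c))) with
      (p + cnd_len b + length (cc (p + cnd_len b) c) + 1)%nat in C4 by lia.
    destruct (IH O3 Hwf _ r1 m C4 Hm1) as (r2 & m2 & k2 & R2 & M2 & W2 & K2).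
    apply bs_nonneg in H.
    exists r2, m2, (k1 + k2)%nat. split; [|split; [|split]]; auto.
    + eapply steps_trans; [exact R1|].
      match goal with |- steps _ _ (State ?x _ _) =>
        match type of R2 with runs _ _ _ _ ?y _ _ => replace x with y end end.
      { exact R2. }
      rewrite !length_app, cnd_length. cbn. lia.
    + rewrite !length_app, cnd_length. cbn [length]. nia.
  - cbn -[tmp] in Hc, Hok |- *. apply andb_true_iff in Hok as [O1 O2].
    apply code_at_app in Hc as [C1 C2]. rewrite cnd_length in C2.
    destruct (cnd_ok s m b Hwf O1 Hs _ r _ C1 Hm)
      as (r1 & k1 & Hk1 & Hm1 & [[T1 R1]|[T1 R1]]); [tauto|].
    exists r1, m, k1. split; [|split; [|split]]; auto.
    + rewrite !length_app, cnd_length. cbn [length].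
      rewrite !Nat.add_assoc. exact R1.
    + rewrite !length_app, cnd_length. cbn [length]. lia.
  - assert (Hc0 := Hc).
    cbn -[tmp] in Hc, Hok. apply andb_true_iff in Hok as [O1 O2].
    apply code_at_app in Hc as [C1 C2]. rewrite cnd_length in C2.
    apply code_at_app in C2 as [C2 C3]. apply code_at_cons in C3 as [C3 _].
    destruct (cnd_ok s m b Hwf O1 Hs _ r _ C1 Hm)
      as (r1 & k1 & Hk1 & Hm1 & [[T1 R1]|[T1 R1]]); [|tauto].
    destruct (IH1 O2 Hwf _ r1 m C2 Hm1) as (r2 & m2 & k2 & R2 & M2 & W2 & K2).
    destruct (IH2 ltac:(cbn; rewrite O1, O2; auto) W2 p r2 m2 Hc0 M2)
      as (r3 & m3 & k3 & R3 & M3 & W3 & K3).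
    apply bs_nonneg in H1, H2.
    exists r3, m3, (k1 + (k2 + (1 + k3)))%nat. split; [|split; [|split]]; auto.
    + eapply steps_trans; [exact R1|]. eapply steps_trans; [exact R2|].
      econstructor; [exact C3|reflexivity|]. exact R3.
    (* This iteration takes at most the code length times [t1 + 1], the rest of the loop the code
       length times [t2 + 1]; the test charged here pays for the second [+ 1]. *)
    + cbn [cc] in K3 |- *. rewrite !length_app, cnd_length in K3 |- *.
      cbn [length] in K3 |- *. rewrite !Nat2Z.inj_add in *. nia.
Qed.

End Compile.

Theorem compile_exec B n W c s t s' m :
  32 <= B -> 0 <= n -> 32 * (n + B) + 32 <= W ->
  ok_c c = true -> wf B n s -> bs B n c s t s' ->
  (forall q i, (q < 32)%nat -> valid_idx n q i -> m (cell n q i) = ar s q i) ->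
  let P := cc 0 c ++ [IHalt] in
  exists T st, exec W P (State 0 (rg s) m) T st
    /\ (forall q i, (q < 32)%nat -> valid_idx n q i -> mem st (cell n q i) = ar s' q i)
    /\ Z.of_nat T <= Z.of_nat (length P) * (t + 1).
Proof.
  intros HB Hn HW Hok Hwf Hbs Hm P.
  destruct (cc_ok B n W P HB Hn HW c s t s' Hbs Hok Hwf 0 (rg s) m)
    as (r' & m' & k & R & M & _ & K).
  - exists [], [IHalt]. auto.
  - split; auto.
  - exists (k + 0)%nat, (State (length (cc 0 c)) r' m'). split; [|split].
    + eapply steps_exec; [exact R|]. constructor. cbn.
      unfold P. rewrite nth_error_app2, Nat.sub_diag; auto.
    + apply M.
    + apply bs_nonneg in Hbs. unfold P. rewrite length_app. cbn [length]. nia.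
Qed.

(** * Sums over integer intervals *)

Fixpoint sumn (f : Z -> Z) (lo : Z) (k : nat) : Z :=
  match k with
  | O => 0
  | S k => sumn f lo k + f (lo + Z.of_nat k)
  end.

Definition sumz (f : Z -> Z) (lo hi : Z) : Z := sumn f lo (Z.to_nat (hi - lo)).

Lemma sumz_empty f lo hi : hi <= lo -> sumz f lo hi = 0.
Proof. intros. unfold sumz. now replace (Z.to_nat (hi - lo)) with O by lia. Qed.

Lemma sumz_last f lo hi : lo <= hi -> sumz f lo (hi + 1) = sumz f lo hi + f hi.
Proof.
  intros. unfold sumz.
  replace (Z.to_nat (hi + 1 - lo)) with (S (Z.to_nat (hi - lo))) by lia.
  cbn. do 2 f_equal. lia.
Qed.

Lemma interval_ind (lo : Z) (P : Z -> Prop) :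
  P lo -> (forall h, lo <= h -> P h -> P (h + 1)) -> forall hi, lo <= hi -> P hi.
Proof.
  intros H0 HS hi Hhi. replace hi with (lo + Z.of_nat (Z.to_nat (hi - lo))) by lia.
  induction (Z.to_nat (hi - lo)) as [|k IH]; [now rewrite Z.add_0_r|].
  rewrite Nat2Z.inj_succ. replace (lo + Z.succ (Z.of_nat k))
    with (lo + Z.of_nat k + 1) by lia. apply HS; auto; lia.
Qed.

Lemma sumz_ext f g lo hi :
  (forall i, lo <= i < hi -> f i = g i) -> sumz f lo hi = sumz g lo hi.
Proof.
  destruct (Z.le_gt_cases lo hi); [|now rewrite !sumz_empty by lia].
  revert hi H. apply (interval_ind lo (fun hi => (forall i, lo <= i < hi -> f i = g i)
    -> sumz f lo hi = sumz g lo hi)).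
  - now rewrite !sumz_empty by lia.
  - intros h Hh IH He. rewrite !sumz_last by lia.
    rewrite IH by (intros; apply He; lia). now rewrite He by lia.
Qed.

Lemma sumz_le f g lo hi :
  (forall i, lo <= i < hi -> f i <= g i) -> sumz f lo hi <= sumz g lo hi.
Proof.
  destruct (Z.le_gt_cases lo hi); [|now rewrite !sumz_empty by lia].
  revert hi H. apply (interval_ind lo (fun hi => (forall i, lo <= i < hi -> f i <= g i)
    -> sumz f lo hi <= sumz g lo hi)).
  - now rewrite !sumz_empty by lia.
  - intros h Hh IH He. rewrite !sumz_last by auto.
    specialize (He h ltac:(lia)) as H1.
    enough (sumz f lo h <= sumz g lo h) by lia. apply IH. intros; apply He; lia.
Qed.

Lemma sumz_zero f lo hi : (forall i, lo <= i < hi -> f i = 0) -> sumz f lo hi = 0.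
Proof.
  destruct (Z.le_gt_cases lo hi); [|now rewrite !sumz_empty by lia].
  revert hi H. apply (interval_ind lo (fun hi => (forall i, lo <= i < hi -> f i = 0)
    -> sumz f lo hi = 0)).
  - now rewrite !sumz_empty by lia.
  - intros h Hh IH He. rewrite !sumz_last by lia.
    rewrite IH by (intros; apply He; lia). now rewrite He by lia.
Qed.

Lemma sumz_nonneg f lo hi :
  (forall i, lo <= i < hi -> 0 <= f i) -> 0 <= sumz f lo hi.
Proof.
  intros. rewrite <- (sumz_zero (fun _ => 0) lo hi) by auto. now apply sumz_le.
Qed.

Lemma sumz_add f g lo hi :
  sumz (fun i => f i + g i) lo hi = sumz f lo hi + sumz g lo hi.
Proof.
  unfold sumz. induction (Z.to_nat (hi - lo)); cbn; lia.
Qed.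

Lemma sumz_scal c f lo hi : sumz (fun i => c * f i) lo hi = c * sumz f lo hi.
Proof.
  unfold sumz. induction (Z.to_nat (hi - lo)); cbn -[Z.mul]; lia.
Qed.

Lemma sumz_const c lo hi : lo <= hi -> sumz (fun _ => c) lo hi = c * (hi - lo).
Proof.
  intros. unfold sumz. replace (hi - lo) with (Z.of_nat (Z.to_nat (hi - lo))) at 2 by lia.
  induction (Z.to_nat (hi - lo)); cbn -[Z.mul Z.of_nat]; lia.
Qed.

Lemma sumz_split f lo mid hi :
  lo <= mid <= hi -> sumz f lo hi = sumz f lo mid + sumz f mid hi.
Proof.
  intros [H1 H2]. revert hi H2. apply (interval_ind mid (fun hi =>
    sumz f lo hi = sumz f lo mid + sumz f mid hi)).
  - rewrite (sumz_empty f mid mid); lia.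
  - intros h Hh IH. rewrite !sumz_last by lia. lia.
Qed.

Lemma sumz_first f lo hi : lo < hi -> sumz f lo hi = f lo + sumz f (lo + 1) hi.
Proof.
  intros. rewrite (sumz_split f lo (lo + 1)) by lia.
  rewrite sumz_last, sumz_empty by lia. lia.
Qed.

Lemma sumz_shift f lo hi c :
  sumz f (lo + c) (hi + c) = sumz (fun i => f (i + c)) lo hi.
Proof.
  unfold sumz. replace (hi + c - (lo + c)) with (hi - lo) by lia.
  induction (Z.to_nat (hi - lo)); cbn; auto. rewrite IHn. do 2 f_equal. lia.
Qed.

Lemma sumz_exchange (f : Z -> Z -> Z) lo hi lo' hi' :
  sumz (fun i => sumz (fun j => f i j) lo' hi') lo hi
  = sumz (fun j => sumz (fun i => f i j) lo hi) lo' hi'.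
Proof.
  unfold sumz at 1. change (sumn ?g lo ?k) with (sumn g lo k).
  set (k := Z.to_nat (hi - lo)).
  transitivity (sumz (fun j => sumn (fun i => f i j) lo k) lo' hi'); [|reflexivity].
  induction k; cbn.
  - now rewrite sumz_zero.
  - rewrite IHk, sumz_add. auto.
Qed.

Lemma sumz_term f lo hi i :
  (forall j, lo <= j < hi -> 0 <= f j) -> lo <= i < hi -> f i <= sumz f lo hi.
Proof.
  intros H Hi. rewrite (sumz_split f lo i), (sumz_first f i) by lia.
  assert (0 <= sumz f lo i) by (apply sumz_nonneg; intros; apply H; lia).
  assert (0 <= sumz f (i + 1) hi) by (apply sumz_nonneg; intros; apply H; lia).
  lia.
Qed.

Lemma sumz_pos_ex f lo hi : 0 < sumz f lo hi -> exists i, lo <= i < hi /\ 0 < f i.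
Proof.
  destruct (Z.le_gt_cases lo hi); [|rewrite !sumz_empty; lia].
  revert hi H. apply (interval_ind lo (fun hi => 0 < sumz f lo hi ->
    exists i, lo <= i < hi /\ 0 < f i)).
  - rewrite sumz_empty; lia.
  - intros h Hh IH. rewrite sumz_last by lia. intros Hs.
    destruct (Z.le_gt_cases (f h) 0).
    + destruct IH as (i & ? & ?); [lia|]. exists i; split; [lia|auto].
    + exists h; lia.
Qed.

Lemma sumz_single f lo hi i :
  lo <= i < hi -> (forall j, lo <= j < hi -> j <> i -> f j = 0) ->
  sumz f lo hi = f i.
Proof.
  intros Hi H. rewrite (sumz_split f lo i), (sumz_first f i) by lia.
  rewrite !sumz_zero by (intros; apply H; lia). lia.
Qed.

(* Arrays are compared as multisets through the sums of all functions. *)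
Definition same_multiset (Y Y' : Z -> Z) (lo hi : Z) : Prop :=
  forall f : Z -> Z, sumz (fun i => f (Y' i)) lo hi = sumz (fun i => f (Y i)) lo hi.

(** Take the indicator of the value [Y' i] as test function. *)
Lemma same_multiset_in Y Y' lo hi i :
  same_multiset Y Y' lo hi -> lo <= i < hi -> exists j, lo <= j < hi /\ Y j = Y' i.
Proof.
  intros H Hi. specialize (H (fun z => if z =? Y' i then 1 else 0)).
  assert (1 <= sumz (fun i0 => if Y' i0 =? Y' i then 1 else 0) lo hi).
  { pose proof (sumz_term (fun i0 => if Y' i0 =? Y' i then 1 else 0) lo hi i) as Ht.
    cbn in Ht. rewrite Z.eqb_refl in Ht. apply Ht; auto.
    intros; destruct (Y' j =? Y' i); lia. }
  rewrite H in H0. destruct (sumz_pos_ex (fun i0 => if Y i0 =? Y' i then 1 else 0) lo hi)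
    as (j & Hj & Hj'); [lia|].
  exists j. split; auto. destruct (Z.eqb_spec (Y j) (Y' i)); auto; lia.
Qed.

(** * Symbolic execution *)

Declare Scope ex_scope.
Delimit Scope ex_scope with ex.
Bind Scope ex_scope with expr.
Notation "$ x" := (EV x) (at level 1, format "$ x") : ex_scope.
Notation "# z" := (EC z) (at level 1, format "# z") : ex_scope.
Notation "a + b" := (EO Add a b) : ex_scope.
Notation "a - b" := (EO Sub a b) : ex_scope.
Notation "a * b" := (EO Mul a b) : ex_scope.
Notation "a / b" := (EO Div a b) : ex_scope.
Notation "q @[ e ]" := (EL q e) (at level 2, left associativity) : ex_scope.
Notation "c ;; d" := (Seq c d) (at level 65, right associativity).

Ltac simp :=
  cbn [rg ar setr seta update Nat.eqb ev op_val tvp safec safe op_ok idx_ok] in *.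

(* Rewrites registers and arrays left alone by the commands executed so far back
   to the states before those commands. *)
Ltac frs :=
  simp;
  repeat (match goal with
  | F : fr _ _ ?s', H : context [rg ?s' ?x] |- _ => rewrite (proj1 F x eq_refl) in H
  | F : fr _ _ ?s' |- context [rg ?s' ?x] => rewrite (proj1 F x eq_refl)
  | F : fr _ _ ?s', H : context [ar ?s' ?x] |- _ => rewrite (proj2 F x eq_refl) in H
  | F : fr _ _ ?s' |- context [ar ?s' ?x] => rewrite (proj2 F x eq_refl)
  end; simp).

Ltac fold_all i :=
  let b := eval unfold i in i in
  repeat match goal with H : context [b] |- _ => progress fold i in H end;
  fold i.

Ltac sfty :=
  frs; repeat match goal with |- _ /\ _ => split | |- True => exact I end;
  try (intros; lia).

Ltac ws1 :=
  lazymatch goal with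
  | |- wp _ _ (Seq (Seq _ _) _) _ _ => apply wp_seq_assoc
  | |- wp _ _ (Seq Skip _) _ _ => apply wp_skip_seq
  | |- wp _ _ (Seq (Asg _ _) _) _ _ => apply wp_asg_seq; [sfty|frs]
  | |- wp _ _ (Seq (Sto _ _ _) _) _ _ => apply wp_sto_seq; [sfty|frs]
  | |- wp _ _ (Seq (If _ _ _) _) _ _ =>
      apply wp_if_seq; [sfty|intro; frs|intro; frs]
  | |- wp _ _ (Asg _ _) _ _ => apply wp_asg; [sfty|frs]
  | |- wp _ _ (Sto _ _ _) _ _ => apply wp_sto; [sfty|frs]
  | |- wp _ _ Skip _ _ => apply wp_skip; frs
  | |- wp _ _ (If _ _ _) _ _ => apply wp_if; [sfty|intro; frs|intro; frs]
  end.
Ltac ws := repeat ws1.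

(** * Registers and arrays *)

Notation r_n := 0%nat.    Notation r_t := 1%nat.    Notation r_s := 2%nat.
Notation r_vm := 3%nat.   Notation r_rem := 4%nat.  Notation r_D := 5%nat.
Notation r_NN := 6%nat.   Notation r_BIG := 7%nat.  Notation r_L := 8%nat.
Notation r_lo := 10%nat.  Notation r_hi := 11%nat.  Notation r_si := 12%nat.
Notation r_sj := 13%nat.  Notation r_x1 := 14%nat.  Notation r_x2 := 15%nat.
Notation r_m := 16%nat.   Notation r_cap := 17%nat. Notation r_xv := 18%nat.
Notation r_xs := 19%nat.  Notation r_acc := 20%nat. Notation r_fnd := 21%nat.
Notation r_wg := 22%nat.  Notation r_we := 23%nat.  Notation r_i := 24%nat.
Notation r_o := 25%nat.   Notation r_dir := 26%nat. Notation r_m0 := 27%nat.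
Notation r_pq := 28%nat.  Notation r_pb := 29%nat.  Notation r_nb := 30%nat.
Notation r_blk := 31%nat. Notation r_out := 32%nat. Notation r_pi := 33%nat.
Notation r_px := 34%nat.

Notation a_in := 0%nat.   Notation a_S := 1%nat.    Notation a_V := 2%nat.
Notation a_U := 3%nat.    Notation a_P := 4%nat.    Notation a_kV := 5%nat.
Notation a_kS := 6%nat.   Notation a_kW := 7%nat.   Notation a_kI := 8%nat.
Notation a_X := 9%nat.    Notation a_Y := 10%nat.   Notation a_Z := 11%nat.

(** * Insertion sort of index arrays by key *)

(* The key of [e] is the ratio [kv e / ks e]. *)
Definition key_ge (kv ks : Z -> Z) (e f : Z) : bool := kv f * ks e <=? kv e * ks f.

(** Multiply the two inequalities by [ks g] and [ks e], chain them, and divide by the positive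
    [ks f]. *)
Lemma key_ge_trans kv ks e f g :
  0 < ks e -> 0 < ks f -> 0 < ks g ->
  key_ge kv ks e f = true -> key_ge kv ks f g = true -> key_ge kv ks e g = true.
Proof.
  unfold key_ge. rewrite !Z.leb_le. intros.
  assert (ks f * (kv g * ks e) <= ks f * (kv e * ks g)) by nia. nia.
Qed.

Definition insort : cmd :=
  Asg r_si ($r_lo) ;;
  While (CLt ($r_si) ($r_hi))
    (Asg r_sj ($r_si) ;;
     While (CAnd (CLt ($r_lo) ($r_sj))
              (CLt (a_kV@[a_Y@[$r_sj - #1]] * a_kS@[a_Y@[$r_sj]])
                   (a_kV@[a_Y@[$r_sj]] * a_kS@[a_Y@[$r_sj - #1]])))
       (Asg r_x1 (a_Y@[$r_sj]) ;; Asg r_x2 (a_Y@[$r_sj - #1]) ;;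
        Sto a_Y ($r_sj) ($r_x2) ;; Sto a_Y ($r_sj - #1) ($r_x1) ;;
        Asg r_sj ($r_sj - #1)) ;;
     Asg r_si ($r_si + #1)).

Definition sorted_desc (kv ks Y : Z -> Z) (lo hi : Z) : Prop :=
  forall p q, lo <= p < q -> q < hi -> key_ge kv ks (Y p) (Y q) = true.

(** Ratios are compared by cross-multiplication, so the products must fit into a word. *)
Definition keys_ok (B : Z) (kv ks : Z -> Z) (m : Z) : Prop :=
  m <= B /\ forall e, 0 <= e < m -> 0 < ks e /\
    forall f, 0 <= f < m -> Z.abs (kv e * ks f) <= B.

Lemma same_multiset_swap Y Y' lo hi j :
  lo < j < hi -> Y' j = Y (j - 1) -> Y' (j - 1) = Y j ->
  (forall i, i <> j -> i <> j - 1 -> Y' i = Y i) -> same_multiset Y Y' lo hi.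
Proof.
  intros Hj H1 H2 H3 f.
  rewrite !(sumz_split _ lo (j - 1) hi) by lia.
  rewrite !(sumz_first _ (j - 1)) by lia. replace (j - 1 + 1) with j by lia.
  rewrite !(sumz_first _ j) by lia. rewrite H1, H2.
  rewrite (sumz_ext (fun i => f (Y' i)) (fun i => f (Y i)) lo (j - 1))
    by (intros; rewrite H3; auto; lia).
  rewrite (sumz_ext (fun i => f (Y' i)) (fun i => f (Y i)) (j + 1) hi)
    by (intros; rewrite H3; auto; lia).
  lia.
Qed.

Lemma insort_spec B n s kv ks m lo hi :
  1 <= B -> rg s r_lo = lo -> rg s r_hi = hi -> ar s a_kV = kv -> ar s a_kS = ks ->
  0 <= lo <= hi -> hi <= B -> keys_ok B kv ks m ->
  (forall i, lo <= i < hi -> 0 <= ar s a_Y i < m) ->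
  wp B n insort s (fun s' t =>
    same_multiset (ar s a_Y) (ar s' a_Y) lo hi
    /\ (forall i, i < lo \/ hi <= i -> ar s' a_Y i = ar s a_Y i)
    /\ sorted_desc kv ks (ar s' a_Y) lo hi
    /\ t <= (hi - lo + 1) * (hi - lo + 1)).
Proof.
  intros HB Hlo Hhi Hkv Hks Hr HhB [HmB Hk] HY. unfold insort. ws.
  set (Y0 := ar s a_Y) in *.
  eapply wp_while with
    (I := fun s1 => lo <= rg s1 r_si <= hi
      /\ same_multiset Y0 (ar s1 a_Y) lo hi
      /\ (forall i, i < lo \/ hi <= i -> ar s1 a_Y i = Y0 i)
      /\ sorted_desc kv ks (ar s1 a_Y) lo (rg s1 r_si))
    (phi := fun s1 => (hi - rg s1 r_si) * (hi - lo + 2)).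
  - simp. repeat split; auto; try lia. intros p q; lia.
  - intros s1 F (I1 & I2 & I3 & I4). frs. split; [sfty|nia].
  - intros s1 F (I1 & I2 & I3 & I4) Hb. frs. ws.
    assert (HY1 : forall i, lo <= i < hi -> 0 <= ar s1 a_Y i < m).
    { intros i Hi. destruct (same_multiset_in _ _ _ _ _ I2 Hi) as (j & Hj & <-). auto. }
    apply wp_seq. set (i0 := rg s1 r_si) in *.
    (* Invariant: up to [i0] only pairs whose later member is the moving element, at [r_sj], may be
       out of order. *)
    eapply wp_while with
      (I := fun s2 => lo <= rg s2 r_sj <= i0
        /\ same_multiset Y0 (ar s2 a_Y) lo hi
        /\ (forall i, lo <= i < hi -> 0 <= ar s2 a_Y i < m)
        /\ (forall i, i < lo \/ hi <= i -> ar s2 a_Y i = Y0 i)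
        /\ (forall p q, lo <= p < q -> q <= i0 -> q <> rg s2 r_sj ->
              key_ge kv ks (ar s2 a_Y p) (ar s2 a_Y q) = true))
      (phi := fun s2 => rg s2 r_sj - lo).
    + simp. repeat split; auto; try lia; try apply HY1; auto.
      intros p q Hp Hq Hne. apply I4; lia.
    + intros s2 F2 (J1 & J2 & J3 & J4 & J5). frs. split; [|lia].
      rewrite ?Hlo, ?Hkv, ?Hks in *. sfty.
      intros Hl. assert (A := J3 (rg s2 r_sj) ltac:(lia)).
      assert (A' := J3 (rg s2 r_sj - 1) ltac:(lia)).
      destruct (Hk _ A) as [K1 K2], (Hk _ A') as [K1' K2'].
      specialize (K2 _ A'). specialize (K2' _ A).
      repeat (split; try lia).
    + intros s2 F2 (J1 & J2 & J3 & J4 & J5) Hb2. frs.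
      rewrite ?Hlo, ?Hkv, ?Hks in *. destruct Hb2 as [Hb1 Hb2].
      set (j := rg s2 r_sj) in *. ws. fold j.
      split; [|lia]. split; [lia|].
      assert (Hs : same_multiset (ar s2 a_Y) (fun i => if i =? j - 1 then ar s2 a_Y j else
        if i =? j then ar s2 a_Y (j - 1) else ar s2 a_Y i) lo hi).
      { apply same_multiset_swap with j; try lia.
        - destruct (Z.eqb_spec j (j - 1)); [lia|]. now rewrite Z.eqb_refl.
        - now rewrite Z.eqb_refl.
        - intros i H1 H2. destruct (Z.eqb_spec i (j - 1)), (Z.eqb_spec i j); auto; lia. }
      split; [|split; [|split]].
      * intros f. rewrite Hs. apply J2.
      * intros i Hi. destruct (Z.eqb_spec i (j - 1)), (Z.eqb_spec i j); apply J3; lia.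
      * intros i Hi. destruct (Z.eqb_spec i (j - 1)), (Z.eqb_spec i j); try lia. auto.
      * intros p q Hp Hq Hne.
        assert (Hpos : forall i, lo <= i < hi -> 0 < ks (ar s2 a_Y i))
          by (intros; apply Hk; auto).
        destruct (Z.eqb_spec p (j - 1)), (Z.eqb_spec p j), (Z.eqb_spec q (j - 1)),
          (Z.eqb_spec q j); subst; try lia; try (apply J5; lia).
        -- unfold key_ge. apply Z.leb_le. lia.
    + intros s2 t Ht F2 (J1 & J2 & J3 & J4 & J5) Hb2 Ht2. frs.
      rewrite ?Hlo, ?Hkv, ?Hks in *. set (j := rg s2 r_sj) in *. ws. fold i0.
      split; [|nia]. split; [lia|]. split; [auto|]. split; [auto|].
      intros p q Hp Hq. destruct (Z.eq_dec q j) as [->|]; [|apply J5; lia].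
      (* The stopped loop puts positions [j - 1] and [j] in order; earlier positions follow by
         transitivity. *)
      assert (Hj : key_ge kv ks (ar s2 a_Y (j - 1)) (ar s2 a_Y j) = true).
      { unfold key_ge. apply Z.leb_le.
        destruct (Z_lt_le_dec lo j); [|lia]. tauto || (apply Z.nlt_ge; intro; apply Hb2; split; lia). }
      destruct (Z.eq_dec p (j - 1)) as [->|]; auto.
      eapply key_ge_trans; [| | |apply J5|exact Hj]; try apply Hk; try apply J3; lia.
  - intros s1 t Ht F (I1 & I2 & I3 & I4) Hb Ht2. frs.
    replace (rg s1 r_si) with hi in * by lia.
    repeat split; auto. nia.
Qed.

(** * Approximate medians *)

(** The kept element comes last in its group of four, where [f] is smallest. *)
Lemma decimate_nonincreasing f lo c :
  0 <= c -> (forall p q, lo <= p <= q -> q < lo + 4 * c -> f q <= f p) ->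
  4 * sumz (fun i => f (lo + 4 * i + 3)) 0 c <= sumz f lo (lo + 4 * c).
Proof.
  revert c. apply (interval_ind 0 (fun c => _ -> _)).
  - intros _. rewrite !sumz_empty; lia.
  - intros c Hc IH H. rewrite sumz_last by lia.
    replace (lo + 4 * (c + 1)) with (lo + 4 * c + 1 + 1 + 1 + 1) by lia.
    rewrite !sumz_last by lia.
    specialize (IH ltac:(intros; apply H; lia)).
    pose proof (H (lo + 4 * c) (lo + 4 * c + 3)).
    pose proof (H (lo + 4 * c + 1) (lo + 4 * c + 3)).
    pose proof (H (lo + 4 * c + 1 + 1) (lo + 4 * c + 3)).
    replace (lo + 4 * c + 1 + 1 + 1) with (lo + 4 * c + 3) by lia. lia.
Qed.

(** Charge a kept element to itself and the three elements after it. Only the last kept element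
    lacks these three, which costs at most 3 since [f] is at most 1. *)
Lemma decimate_nondecreasing f lo c :
  0 <= c -> (forall p q, lo <= p <= q -> q < lo + 4 * c -> f p <= f q) ->
  (forall p, 0 <= f p <= 1) ->
  4 * sumz (fun i => f (lo + 4 * i + 3)) 0 c <= sumz f lo (lo + 4 * c) + 3.
Proof.
  intros Hc H H1.
  enough (4 * sumz (fun i => f (lo + 4 * i + 3)) 0 c
    <= sumz f lo (lo + 4 * c) + (if c =? 0 then 0 else 3 * f (lo + 4 * c - 1))).
  { destruct (c =? 0); [lia|]. specialize (H1 (lo + 4 * c - 1)). lia. }
  revert c Hc H. apply (interval_ind 0 (fun c => _ -> _)).
  - intros _. rewrite !sumz_empty by lia. cbn. lia.
  - intros c Hc IH H. rewrite sumz_last by lia.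
    replace (lo + 4 * (c + 1)) with (lo + 4 * c + 1 + 1 + 1 + 1) by lia.
    rewrite !sumz_last by lia.
    specialize (IH ltac:(intros; apply H; lia)).
    replace (c + 1 =? 0) with false by lia.
    replace (lo + 4 * c + 1 + 1 + 1 + 1 - 1) with (lo + 4 * c + 3) by lia.
    replace (lo + 4 * c + 1 + 1 + 1) with (lo + 4 * c + 3) by lia.
    destruct (Z.eqb_spec c 0).
    + pose proof (H1 (lo + 4 * c)). pose proof (H1 (lo + 4 * c + 1)).
      pose proof (H1 (lo + 4 * c + 1 + 1)). lia.
    + pose proof (H (lo + 4 * c - 1) (lo + 4 * c)).
      pose proof (H (lo + 4 * c - 1) (lo + 4 * c + 1)).
      pose proof (H (lo + 4 * c - 1) (lo + 4 * c + 1 + 1)). lia.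
Qed.

Definition count_ge kv ks (Y : Z -> Z) (lo hi x : Z) : Z :=
  sumz (fun i => Z.b2z (key_ge kv ks (Y i) x)) lo hi.

Definition count_le kv ks (Y : Z -> Z) (lo hi x : Z) : Z :=
  sumz (fun i => Z.b2z (key_ge kv ks x (Y i))) lo hi.

Lemma b2z_le a b : (a = true -> b = true) -> Z.b2z a <= Z.b2z b.
Proof. destruct a, b; cbn; intros H; try lia; discriminate (H eq_refl). Qed.

Lemma b2z_range a : 0 <= Z.b2z a <= 1.
Proof. destruct a; cbn; lia. Qed.

(** An incomplete last block is dropped. The block size doubles while the sample shrinks by four,
    which serves two purposes: the cost, of order [pq * pb], is halved in each round, and so is the
    rank error, because the number of blocks falls by eight while the weight of a sample element
    grows only by four. *)
Definition decimate : cmd :=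
  Asg r_nb ($r_pq / $r_pb) ;; Asg r_blk (#0) ;; Asg r_out (#0) ;;
  While (CLt ($r_blk) ($r_nb))
    (Asg r_lo ($r_blk * $r_pb) ;; Asg r_hi ($r_lo + $r_pb) ;; insort ;;
     Asg r_pi (#3) ;;
     While (CLt ($r_pi) ($r_pb))
       (Sto a_Z ($r_out) (a_Y@[$r_lo + $r_pi]) ;;
        Asg r_out ($r_out + #1) ;; Asg r_pi ($r_pi + #4)) ;;
     Asg r_blk ($r_blk + #1)) ;;
  Asg r_pi (#0) ;;
  While (CLt ($r_pi) ($r_out))
    (Sto a_Y ($r_pi) (a_Z@[$r_pi]) ;; Asg r_pi ($r_pi + #1)) ;;
  Asg r_pq ($r_out) ;; Asg r_pb (#2 * $r_pb).

Lemma decimate_spec B n s kv ks m pq c :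
  rg s r_pq = pq -> rg s r_pb = 4 * c -> ar s a_kV = kv -> ar s a_kS = ks ->
  8 <= c -> 16 * c <= pq -> 8 * pq <= B -> keys_ok B kv ks m ->
  (forall i, 0 <= i < pq -> 0 <= ar s a_Y i < m) ->
  wp B n decimate s (fun s' t =>
    let nb := pq / (4 * c) in let q' := nb * c in
    rg s' r_pq = q' /\ rg s' r_pb = 8 * c
    /\ (forall i, 0 <= i < q' -> exists j, 0 <= j < pq /\ ar s' a_Y i = ar s a_Y j)
    /\ (forall x, 0 <= x < m ->
          4 * count_ge kv ks (ar s' a_Y) 0 q' x <= count_ge kv ks (ar s a_Y) 0 pq x
          /\ 4 * count_le kv ks (ar s' a_Y) 0 q' x
               <= count_le kv ks (ar s a_Y) 0 pq x + 3 * nb)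
    /\ t <= 12 * pq * c).
Proof.
  intros Hpq Hpb Hkv Hks Hc Hq HqB HkB HY. unfold decimate.
  destruct HkB as [HmB Hk] eqn:EHk. clear EHk.
  set (nb := pq / (4 * c)) in *.
  assert (Hnb : 4 * c * nb <= pq < 4 * c * nb + 4 * c).
  { pose proof (Z.div_mod pq (4 * c) ltac:(lia)).
    pose proof (Z.mod_pos_bound pq (4 * c) ltac:(lia)). fold nb in H. lia. }
  assert (Hnb4 : 4 <= nb) by nia. assert (Hnbq : nb * c <= pq /\ nb <= pq) by nia.
  ws; try (rewrite Hpq, Hpb; fold nb; nia).
  rewrite Hpq, Hpb. fold nb. apply wp_seq.
  set (Y0 := ar s a_Y) in *.
  eapply wp_while with
    (I := fun s1 => 0 <= rg s1 r_blk <= nb /\ rg s1 r_out = rg s1 r_blk * c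
      /\ (forall i, 4 * c * rg s1 r_blk <= i -> ar s1 a_Y i = Y0 i)
      /\ (forall i, 0 <= i < rg s1 r_out ->
            exists j, 0 <= j < pq /\ ar s1 a_Z i = Y0 j)
      /\ (forall x, 0 <= x < m ->
          4 * count_ge kv ks (ar s1 a_Z) 0 (rg s1 r_out) x
            <= count_ge kv ks Y0 0 (4 * c * rg s1 r_blk) x
          /\ 4 * count_le kv ks (ar s1 a_Z) 0 (rg s1 r_out) x
               <= count_le kv ks Y0 0 (4 * c * rg s1 r_blk) x + 3 * rg s1 r_blk))
    (* Sorting one block costs at most [(4 c + 1)^2], and copying from it about [c]. *)
    (phi := fun s1 => (nb - rg s1 r_blk) * (20 * c * c + 10 * c)).
  - simp. repeat split; try lia.
    + unfold count_ge. rewrite !sumz_empty; lia.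
    + unfold count_le. rewrite !sumz_empty; lia.
  - intros s1 F (I1 & I2 & I3 & I4 & I5). frs.
    split; [sfty|apply Z.mul_nonneg_nonneg; nia].
  - intros s1 F (I1 & I2 & I3 & I4 & I5) Hb. frs.
    set (b := rg s1 r_blk) in *.
    assert (Hbb : 4 * c * b + 4 * c <= 4 * c * nb) by nia.
    ws; try (rewrite Hpb; fold b; lia).
    rewrite Hpb. fold b. apply wp_seq. eapply wp_conseq.
    { eapply insort_spec with (lo := b * (4 * c)) (hi := b * (4 * c) + 4 * c) (m := m)
        (kv := kv) (ks := ks); frs; auto; try lia.
      intros i Hi. rewrite I3 by lia. apply HY. lia. }
    cbv beta. intros s2 t2 Ht2 F2 (J1 & J2 & J3 & J4). simp.
    replace (b * (4 * c) + 4 * c - b * (4 * c) + 1) with (4 * c + 1) in J4 by lia.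
    set (lo := b * (4 * c)) in *.
    ws. apply wp_seq.
    eapply wp_while with
      (I := fun s3 => b * c <= rg s3 r_out <= b * c + c
        /\ rg s3 r_pi = 4 * (rg s3 r_out - b * c) + 3
        /\ (forall i, i < b * c -> ar s3 a_Z i = ar s1 a_Z i)
        /\ (forall k, 0 <= k < rg s3 r_out - b * c ->
              ar s3 a_Z (b * c + k) = ar s2 a_Y (lo + 4 * k + 3)))
      (phi := fun s3 => c - (rg s3 r_out - b * c)).
    + frs. rewrite I2. fold b. repeat split; auto; lia.
    + intros s3 F3 (K1 & K2 & K3 & K4). frs. split; [sfty|]; lia.
    + intros s3 F3 (K1 & K2 & K3 & K4) Hb3. frs. rewrite Hpb in *.
      assert (b * c + c <= nb * c) by lia. assert (0 <= b * c) by (apply Z.mul_nonneg_nonneg; lia).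
      ws; try (rewrite K2; unfold lo; lia); try lia.
      set (o := rg s3 r_out) in *.
      split; [|lia]. split; [lia|]. split; [lia|]. split.
      * intros i Hi. destruct (Z.eqb_spec i o); [lia|]. auto.
      * intros k Hk'. destruct (Z.eqb_spec (b * c + k) o).
        -- f_equal. lia.
        -- apply K4. lia.
    + intros s3 t3 Ht3 F3 (K1 & K2 & K3 & K4) Hb3 Ht3'. frs. rewrite Hpb in *.
      rewrite I2 in Ht3'. fold b in Ht3'.
      assert (Ho : rg s3 r_out = b * c + c) by lia.
      ws. fold b. rewrite Ho.
      replace (4 * c * (b + 1)) with (4 * c * b + 4 * c) by lia.
      assert (HloE : lo = 4 * c * b) by (unfold lo; lia).
      assert (Hpos : forall i, lo <= i < lo + 4 * c -> 0 <= ar s2 a_Y i < m).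
      { intros i Hi. destruct (same_multiset_in _ _ _ _ i J1) as (j & Hj & <-); auto.
        rewrite I3 by lia. apply HY. lia. }
      split; [|nia].
      split; [lia|]. split; [lia|]. split.
      { intros i Hi. rewrite J2 by lia. apply I3. lia. }
      split.
      { intros i Hi. destruct (Z_lt_le_dec i (b * c)).
        - rewrite K3 by lia. apply I4. lia.
        - replace i with (b * c + (i - b * c)) by lia. rewrite K4 by lia.
          destruct (same_multiset_in _ _ _ _ (lo + 4 * (i - b * c) + 3) J1)
            as (j & Hj & <-); [lia|].
          exists j. rewrite I3 by lia. split; auto; lia. }
      intros x Hx. destruct (I5 x Hx) as [G1 G2].
      rewrite I2 in G1, G2. fold b in G1, G2.
      assert (Hf1 : forall h, sumz (fun i => h (ar s3 a_Z i)) 0 (b * c + c)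
        = sumz (fun i => h (ar s1 a_Z i)) 0 (b * c)
          + sumz (fun i => h (ar s2 a_Y (lo + 4 * i + 3))) 0 c).
      { intros h. rewrite (sumz_split _ 0 (b * c)) by nia. f_equal.
        - apply sumz_ext. intros. rewrite K3; auto; lia.
        - replace (sumz _ (b * c) (b * c + c)) with
            (sumz (fun i => h (ar s3 a_Z i)) (0 + b * c) (c + b * c))
            by (f_equal; lia).
          rewrite sumz_shift. apply sumz_ext. intros. rewrite <- K4 by lia.
          do 2 f_equal. lia. }
      assert (Hf2 : forall h, sumz (fun i => h (Y0 i)) 0 (4 * c * b + 4 * c)
        = sumz (fun i => h (Y0 i)) 0 (4 * c * b)
          + sumz (fun i => h (ar s2 a_Y i)) lo (lo + 4 * c)).
      { intros h. rewrite (sumz_split _ 0 (4 * c * b)) by nia. f_equal.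
        rewrite J1, HloE. apply sumz_ext. intros. rewrite I3; auto; lia. }
      assert (Hkp : forall i, lo <= i < lo + 4 * c -> 0 < ks (ar s2 a_Y i))
        by (intros; apply Hk; auto).
      assert (Hxp : 0 < ks x) by (apply Hk; auto).
      unfold count_ge, count_le.
      rewrite (Hf1 (fun e => Z.b2z (key_ge kv ks e x))),
              (Hf1 (fun e => Z.b2z (key_ge kv ks x e))),
              (Hf2 (fun e => Z.b2z (key_ge kv ks e x))),
              (Hf2 (fun e => Z.b2z (key_ge kv ks x e))).
      pose proof (decimate_nonincreasing
        (fun i => Z.b2z (key_ge kv ks (ar s2 a_Y i) x)) lo c ltac:(lia)) as D1.
      pose proof (decimate_nondecreasing
        (fun i => Z.b2z (key_ge kv ks x (ar s2 a_Y i))) lo c ltac:(lia)) as D2.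
      unfold count_ge in G1. unfold count_le in G2. cbv beta in D1, D2.
      split.
      * enough (4 * sumz (fun i => Z.b2z (key_ge kv ks (ar s2 a_Y (lo + 4 * i + 3)) x)) 0 c
          <= sumz (fun i => Z.b2z (key_ge kv ks (ar s2 a_Y i) x)) lo (lo + 4 * c)) by lia.
        apply D1. intros p q Hp Hq'. destruct (Z.eq_dec p q) as [->|]; [lia|].
        apply b2z_le. intros Hge.
        eapply key_ge_trans; [| | |apply J3|exact Hge]; auto; try apply Hkp; lia.
      * enough (4 * sumz (fun i => Z.b2z (key_ge kv ks x (ar s2 a_Y (lo + 4 * i + 3)))) 0 c
          <= sumz (fun i => Z.b2z (key_ge kv ks x (ar s2 a_Y i))) lo (lo + 4 * c) + 3) by lia.
        apply D2; [|intros; apply b2z_range].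
        intros p q Hp Hq'. destruct (Z.eq_dec p q) as [->|]; [lia|].
        apply b2z_le. intros Hge.
        eapply key_ge_trans; [| | |exact Hge|apply J3]; auto; try apply Hkp; lia.
  - intros s1 t1 Ht1 F (I1 & I2 & I3 & I4 & I5) Hb Ht. frs.
    assert (Hb' : rg s1 r_blk = nb) by lia. rewrite Hb' in *. ws. apply wp_seq.
    eapply wp_while with
      (I := fun s2 => 0 <= rg s2 r_pi <= nb * c
        /\ (forall i, 0 <= i < rg s2 r_pi -> ar s2 a_Y i = ar s1 a_Z i))
      (phi := fun s2 => nb * c - rg s2 r_pi).
    + simp. split; [nia|]. intros; lia.
    + intros s2 F2 (J1 & J2). frs. split; [sfty|lia].
    + intros s2 F2 (J1 & J2) Hb2. frs. rewrite I2 in *.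
      ws. split; [|lia]. split; [lia|]. intros i Hi.
      destruct (Z.eqb_spec i (rg s2 r_pi)) as [->|]; auto. apply J2. lia.
    + intros s2 t2 Ht2 F2 (J1 & J2) Hb2 Ht2'. frs. rewrite I2 in *.
      ws; try (rewrite Hpb; lia).
      assert (Hpi : rg s2 r_pi = nb * c) by lia. rewrite Hpi in *.
      split; [auto|]. split; [lia|]. split.
      { intros i Hi. rewrite J2 by lia. auto. }
      split; [|nia].
      intros x Hx. destruct (I5 x Hx) as [G1 G2]. unfold count_ge, count_le in *.
      rewrite (sumz_ext _ (fun i => Z.b2z (key_ge kv ks (ar s1 a_Z i) x)))
        by (intros; rewrite J2; auto; lia).
      rewrite (sumz_ext (fun i => Z.b2z (key_ge kv ks x (ar s2 a_Y i)))
        (fun i => Z.b2z (key_ge kv ks x (ar s1 a_Z i))))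
        by (intros; rewrite J2; auto; lia).
      rewrite (sumz_split _ 0 (4 * c * nb) pq) by lia.
      rewrite (sumz_split (fun i => Z.b2z (key_ge kv ks x (Y0 i))) 0 (4 * c * nb) pq) by lia.
      assert (N1 : 0 <= sumz (fun i => Z.b2z (key_ge kv ks (Y0 i) x)) (4 * c * nb) pq)
        by (apply sumz_nonneg; intros; apply b2z_range).
      assert (N2 : 0 <= sumz (fun i => Z.b2z (key_ge kv ks x (Y0 i))) (4 * c * nb) pq)
        by (apply sumz_nonneg; intros; apply b2z_range).
      lia.
Qed.

(** Thinning stops when fewer than four blocks are left. The sample then has fewer than [128 b]
    elements, and [b * b] times its size is at most [m], so sorting it outright costs [O(m)]. *)
Definition pivot : cmd :=
  Asg r_pi (#0) ;;
  While (CLt ($r_pi) ($r_m))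
    (Sto a_Y ($r_pi) (a_X@[$r_pi]) ;; Asg r_pi ($r_pi + #1)) ;;
  Asg r_pq ($r_m) ;; Asg r_pb (#32) ;;
  While (CLt (#4 * $r_pb) ($r_pq + #1)) decimate ;;
  Asg r_lo (#0) ;; Asg r_hi ($r_pq) ;; insort ;;
  Asg r_px (a_Y@[$r_pq / #2]).

Lemma key_ge_refl kv ks e : key_ge kv ks e e = true.
Proof. unfold key_ge. apply Z.leb_le. lia. Qed.

(* With blocks of size [32 b] the sample has been thinned by a factor [b^2]; the
   two counts bound how far a rank in the sample can be from the true rank. *)
Definition sample_inv kv ks (X Y : Z -> Z) (m0 m pq b : Z) : Prop :=
  1 <= b /\ 1 <= pq
  /\ (forall i, 0 <= i < pq -> exists j, 0 <= j < m /\ Y i = X j)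
  /\ (forall x, 0 <= x < m0 ->
        b * b * count_ge kv ks Y 0 pq x <= count_ge kv ks X 0 m x
        /\ 32 * b * (b * b * count_le kv ks Y 0 pq x - count_le kv ks X 0 m x)
           <= 6 * m * (b - 1))
  /\ 7 * (m - b * b * pq) <= 32 * (b * b * b)
  /\ (16 * (b * b * b) <= m \/ b = 1 /\ pq = m)
  /\ b * b * pq <= m.

(** A round adds a rank error of at most [3 nb] sample elements of weight [b^2], that is
    [3 m / (32 b)]; over [b = 1, 2, 4, ...] this sums to [(6 m / 32) (1 - 1 / b)]. It drops elements
    of total weight below [32 b^3], and these losses sum to at most [32 b^3 / 7] for the new [b]. *)
Lemma sample_inv_step kv ks X Y Y' m0 m pq b :
  sample_inv kv ks X Y m0 m pq b -> 128 * b <= pq ->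
  let nb := pq / (32 * b) in let q' := nb * (8 * b) in
  (forall i, 0 <= i < q' -> exists j, 0 <= j < pq /\ Y' i = Y j) ->
  (forall x, 0 <= x < m0 ->
     4 * count_ge kv ks Y' 0 q' x <= count_ge kv ks Y 0 pq x
     /\ 4 * count_le kv ks Y' 0 q' x <= count_le kv ks Y 0 pq x + 3 * nb) ->
  sample_inv kv ks X Y' m0 m q' (2 * b) /\ 4 * q' <= pq.
Proof.
  intros (H1 & H2 & H3 & H4 & H5 & H6 & H7) Hq nb q' Hin Hc.
  assert (Hnb : 32 * b * nb <= pq < 32 * b * nb + 32 * b).
  { pose proof (Z.div_mod pq (32 * b) ltac:(lia)).
    pose proof (Z.mod_pos_bound pq (32 * b) ltac:(lia)). fold nb in H. lia. }
  assert (Hnb3 : 3 <= nb) by nia.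
  assert (Hq4 : 4 * q' <= pq < 4 * q' + 32 * b) by (unfold q'; lia).
  set (bb := b * b) in *. assert (Hbb : 1 <= bb) by (unfold bb; nia).
  assert (Hb2 : 2 * b * (2 * b) = 4 * bb) by (unfold bb; ring).
  assert (Hb3 : 4 * bb * (2 * b) = 8 * (bb * b)) by ring.
  assert (A1 : bb * (4 * q') <= bb * pq) by (apply Z.mul_le_mono_nonneg_l; lia).
  assert (A2 : bb * pq <= bb * (4 * q' + 32 * b)) by (apply Z.mul_le_mono_nonneg_l; lia).
  assert (A3 : bb * (128 * b) <= bb * pq) by (apply Z.mul_le_mono_nonneg_l; lia).
  split; [|lia]. unfold sample_inv. rewrite Hb2, Hb3.
  split; [lia|]. split; [unfold q'; nia|]. split.
  { intros i Hi. destruct (Hin i Hi) as (j & Hj & ->). auto. }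
  split.
  { intros x Hx. destruct (H4 x Hx) as [G1 G2], (Hc x Hx) as [G3 G4].
    set (ge' := count_ge kv ks Y' 0 q' x) in *. set (ge := count_ge kv ks Y 0 pq x) in *.
    set (le' := count_le kv ks Y' 0 q' x) in *. set (le := count_le kv ks Y 0 pq x) in *.
    set (geX := count_ge kv ks X 0 m x) in *. set (leX := count_le kv ks X 0 m x) in *.
    split.
    - assert (bb * (4 * ge') <= bb * ge) by (apply Z.mul_le_mono_nonneg_l; lia). lia.
    - assert (E1 : bb * (4 * le') <= bb * (le + 3 * nb))
        by (apply Z.mul_le_mono_nonneg_l; lia).
      assert (E2 : 64 * b * (4 * bb * le' - leX) <= 64 * b * (bb * (le + 3 * nb) - leX))
        by (apply Z.mul_le_mono_nonneg_l; lia).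
      assert (E3 : bb * (32 * b * nb) <= bb * pq) by (apply Z.mul_le_mono_nonneg_l; lia).
      lia. }
  repeat split; try lia.
Qed.

Lemma sample_inv_le kv ks X Y m0 m pq b :
  sample_inv kv ks X Y m0 m pq b -> pq <= m /\ (16 * b <= m \/ b = 1).
Proof.
  intros (H1 & H2 & _ & _ & _ & H6 & H7).
  assert (1 <= b * b) by nia.
  split; [nia|]. destruct H6 as [H6|[H6 _]]; [left; nia|now right].
Qed.

Lemma pivot_spec B n s kv ks m0 m :
  rg s r_m = m -> ar s a_kV = kv -> ar s a_kS = ks ->
  1 <= m -> 8 * m <= B -> 200 <= B -> keys_ok B kv ks m0 ->
  (forall i, 0 <= i < m -> 0 <= ar s a_X i < m0) ->
  wp B n pivot s (fun s' t =>
    (exists j, 0 <= j < m /\ rg s' r_px = ar s a_X j)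
    /\ m <= 6 * count_ge kv ks (ar s a_X) 0 m (rg s' r_px)
    /\ m <= 6 * count_le kv ks (ar s a_X) 0 m (rg s' r_px)
    /\ t <= 643 * m).
Proof.
  intros Hm Hkv Hks Hm1 HmB HB Hk HX. unfold pivot. ws.
  set (X := ar s a_X) in *. apply wp_seq.
  eapply wp_while with
    (I := fun s1 => 0 <= rg s1 r_pi <= m
      /\ (forall i, 0 <= i < rg s1 r_pi -> ar s1 a_Y i = X i))
    (phi := fun s1 => m - rg s1 r_pi).
  { simp. split; [lia|]. intros; lia. }
  { intros s1 F (I1 & I2). frs. split; [sfty|lia]. }
  { intros s1 F (I1 & I2) Hb. frs. ws. split; [|lia]. split; [lia|].
    intros i Hi. destruct (Z.eqb_spec i (rg s1 r_pi)) as [->|]; auto. apply I2. lia. }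
  intros s1 t1 Ht1 F1 (I1 & I2) Hb1 Ht1'. frs. rewrite Hm in *.
  assert (Hpi : rg s1 r_pi = m) by lia. rewrite Hpi in *. ws. rewrite Hm.
  apply wp_seq.
  eapply wp_while with
    (I := fun s2 => exists b, rg s2 r_pb = 32 * b
      /\ sample_inv kv ks X (ar s2 a_Y) m0 m (rg s2 r_pq) b)
    (* Each round at least halves the product of sample size and block size. *)
    (phi := fun s2 => 20 * rg s2 r_pq * rg s2 r_pb).
  { simp. exists 1. split; [lia|]. split; [lia|]. split; [lia|].
    split; [intros i Hi; exists i; auto|]. split; [|repeat split; auto; lia].
    intros x Hx. unfold count_ge, count_le.
    rewrite (sumz_ext _ (fun i => Z.b2z (key_ge kv ks (X i) x)))
      by (intros; rewrite I2; auto; lia).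
    rewrite (sumz_ext (fun i => Z.b2z (key_ge kv ks x (ar s1 a_Y i)))
      (fun i => Z.b2z (key_ge kv ks x (X i))))
      by (intros; rewrite I2; auto; lia).
    lia. }
  { intros s2 F2 (b & E & J). frs. rewrite E. destruct (sample_inv_le _ _ _ _ _ _ _ _ J).
    destruct J as (J1 & J2 & _).
    split; [sfty|nia]. }
  { intros s2 F2 (b & E & J) Hb. frs. rewrite E in *.
    assert (J' := J). destruct J' as (J1 & J2 & J3 & _ & _ & J6 & J7).
    destruct (sample_inv_le _ _ _ _ _ _ _ _ J) as [Hpqm _].
    eapply wp_conseq.
    { eapply decimate_spec with (c := 8 * b) (m := m0) (kv := kv) (ks := ks);
        frs; eauto; try lia.
      intros i Hi. destruct (J3 i Hi) as (j & Hj & ->). auto. }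
    cbv beta zeta. intros s3 t3 Ht3 F3 (K1 & K2 & K3 & K4 & K5).
    replace (4 * (8 * b)) with (32 * b) in * by lia.
    destruct (sample_inv_step kv ks X (ar s2 a_Y) (ar s3 a_Y) m0 m (rg s2 r_pq) b J ltac:(lia) K3 K4)
      as [L1 L2].
    split.
    - exists (2 * b). rewrite K1. split; [lia|auto].
    - rewrite K1, K2. set (q' := rg s2 r_pq / (32 * b) * (8 * b)) in *.
      set (q := rg s2 r_pq) in *.
      assert (q * b >= 4 * (q' * b)) by nia. assert (1 <= q * b) by nia. lia. }
  intros s2 t2 Ht2 F2 (b & E & J) Hb2 Ht2'. frs. rewrite E in *.
  destruct (sample_inv_le _ _ _ _ _ _ _ _ J) as [Hpqm _].
  destruct J as (J1 & J2 & J3 & J4 & J5 & J6 & J7).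
  set (pq := rg s2 r_pq) in *. ws. apply wp_seq. eapply wp_conseq.
  { eapply insort_spec with (lo := 0) (hi := pq) (m := m0) (kv := kv) (ks := ks);
      frs; auto; try lia.
    intros i Hi. destruct (J3 i Hi) as (j & Hj & ->). auto. }
  cbv beta. intros s3 t3 Ht3 F3 (K1 & K2 & K3 & K4). simp.
  pose proof (Z.div_mod pq 2 ltac:(lia)) as Hdm.
  pose proof (Z.mod_pos_bound pq 2 ltac:(lia)) as Hmb.
  ws; fold pq; try lia. set (h := pq / 2) in *.
  destruct (same_multiset_in _ _ _ _ h K1) as (j1 & Hj1 & Ej1); [lia|].
  destruct (J3 j1 Hj1) as (j & Hj & Ej).
  split; [exists j; split; [auto|congruence]|].
  set (px := ar s3 a_Y h) in *.
  assert (Hpx : 0 <= px < m0) by (rewrite <- Ej1, Ej; auto).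
  destruct (J4 px Hpx) as [G1 G2].
  assert (Hge : h + 1 <= count_ge kv ks (ar s2 a_Y) 0 pq px).
  { unfold count_ge. rewrite <- (K1 (fun e => Z.b2z (key_ge kv ks e px))).
    rewrite (sumz_split _ 0 (h + 1)) by lia.
    rewrite (sumz_ext _ (fun _ => 1) 0 (h + 1)).
    - rewrite sumz_const by lia.
      pose proof (sumz_nonneg (fun i => Z.b2z (key_ge kv ks (ar s3 a_Y i) px)) (h + 1) pq
        (fun i _ => proj1 (b2z_range _))). lia.
    - intros i Hi. destruct (Z.eq_dec i h) as [->|]; unfold px.
      + now rewrite key_ge_refl.
      + now rewrite K3 by lia. }
  assert (Hle : pq - h <= count_le kv ks (ar s2 a_Y) 0 pq px).
  { unfold count_le. rewrite <- (K1 (fun e => Z.b2z (key_ge kv ks px e))).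
    rewrite (sumz_split _ 0 h) by lia.
    rewrite (sumz_ext _ (fun _ => 1) h pq).
    - rewrite sumz_const by lia.
      pose proof (sumz_nonneg (fun i => Z.b2z (key_ge kv ks px (ar s3 a_Y i))) 0 h
        (fun i _ => proj1 (b2z_range _))). lia.
    - intros i Hi. destruct (Z.eq_dec i h) as [->|]; unfold px.
      + now rewrite key_ge_refl.
      + now rewrite K3 by lia. }
  set (geX := count_ge kv ks X 0 m px) in *. set (leX := count_le kv ks X 0 m px) in *.
  set (ge := count_ge kv ks (ar s2 a_Y) 0 pq px) in *.
  set (le := count_le kv ks (ar s2 a_Y) 0 pq px) in *.
  set (bb := b * b) in *. assert (Hbb : 1 <= bb) by (unfold bb; nia).
  assert (M1 : bb * (pq + 1) <= bb * (2 * ge)) by (apply Z.mul_le_mono_nonneg_l; lia).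
  assert (M2 : bb * pq <= bb * (2 * le)) by (apply Z.mul_le_mono_nonneg_l; lia).
  (* At most [32 b^3 / 7] elements were dropped, which is at most [2 m / 7] because of
     [16 b^3 <= m]. *)
  assert (M3 : 5 * m <= 7 * (bb * pq)).
  { destruct J6 as [J6|[Eb Epq]]; [lia|]. rewrite Epq in *. unfold bb. rewrite Eb. lia. }
  split; [lia|]. split.
  (* The constant 6 of the specification: half of [5/7] minus the rank error [3/16] is [19/112],
     just above [1/6]. *)
  - assert (M4 : 32 * (bb * le - leX) <= 6 * m)
      by (apply Z.mul_le_mono_pos_l with b; lia). lia.
  - assert (pq <= 128 * b) by lia. assert (pq * (pq + 3) <= pq * (128 * b + 3))
      by (apply Z.mul_le_mono_nonneg_l; lia).
    assert (pq * 1 <= pq * b) by (apply Z.mul_le_mono_nonneg_l; lia). lia.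
Qed.

(** * Weighted selection *)

(** [r_dir] is 1 or -1 and makes one comparison keep the candidates above or below the pivot
    ratio. *)
Definition compact : cmd :=
  Asg r_o (#0) ;; Asg r_i (#0) ;;
  While (CLt ($r_i) ($r_m))
    (If (CLt ($r_dir * ($r_xv * a_kS@[a_X@[$r_i]])) ($r_dir * (a_kV@[a_X@[$r_i]] * $r_xs)))
        (Sto a_X ($r_o) (a_X@[$r_i]) ;; Asg r_o ($r_o + #1)) Skip ;;
     Asg r_i ($r_i + #1)) ;;
  Asg r_m ($r_o).

(** [r_wg] starts from the weight already known to lie above all candidates, so it can be compared
    with the capacity directly. *)
Definition weigh : cmd :=
  Asg r_wg ($r_acc) ;; Asg r_we (#0) ;; Asg r_i (#0) ;;
  While (CLt ($r_i) ($r_m))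
    (If (CLt ($r_xv * a_kS@[a_X@[$r_i]]) (a_kV@[a_X@[$r_i]] * $r_xs))
        (Asg r_wg ($r_wg + a_kW@[a_X@[$r_i]]))
        (If (CLt (a_kV@[a_X@[$r_i]] * $r_xs) ($r_xv * a_kS@[a_X@[$r_i]]))
            Skip (Asg r_we ($r_we + a_kW@[a_X@[$r_i]]))) ;;
     Asg r_i ($r_i + #1)).

Definition select_round : cmd :=
  pivot ;; Asg r_xv (a_kV@[$r_px]) ;; Asg r_xs (a_kS@[$r_px]) ;; weigh ;;
  If (CLt ($r_cap) ($r_wg)) (Asg r_dir (#1) ;; compact)
    (If (CLt ($r_cap) ($r_wg + $r_we)) (Asg r_fnd (#1))
       (Asg r_acc ($r_wg + $r_we) ;; Asg r_dir (#(-1)) ;; compact)).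

(** When everything fits, the threshold is set to [- vm - 1] over 1. It lies below every ratio,
    since values are at least [- vm] and sizes at least 1. *)
Definition select : cmd :=
  Asg r_acc (#0) ;; Asg r_i (#0) ;; Asg r_wg (#0) ;;
  While (CLt ($r_i) ($r_m0))
    (Sto a_X ($r_i) ($r_i) ;; Asg r_wg ($r_wg + a_kW@[$r_i]) ;;
     Asg r_i ($r_i + #1)) ;;
  Asg r_m ($r_m0) ;; Asg r_xv (#0 - $r_vm - #1) ;; Asg r_xs (#1) ;;
  If (CLt ($r_cap) ($r_wg))
    (Asg r_fnd (#0) ;; While (CLt ($r_fnd) (#1)) select_round) Skip.

Lemma compact_spec B n s kv ks m0 m xv xs dir x :
  rg s r_m = m -> ar s a_kV = kv -> ar s a_kS = ks ->
  rg s r_xv = xv -> rg s r_xs = xs -> rg s r_dir = dir ->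
  (dir = 1 \/ dir = -1) -> 0 <= x < m0 -> xv = kv x -> xs = ks x ->
  0 <= m -> m + 1 <= B -> keys_ok B kv ks m0 ->
  (forall i, 0 <= i < m -> 0 <= ar s a_X i < m0) ->
  let keep e := dir * (xv * ks e) <? dir * (kv e * xs) in
  wp B n compact s (fun s' t =>
    0 <= rg s' r_m <= m
    /\ (forall i, 0 <= i < rg s' r_m ->
          exists j, 0 <= j < m /\ ar s' a_X i = ar s a_X j /\ keep (ar s a_X j) = true)
    /\ (forall f, sumz (fun i => f (ar s' a_X i)) 0 (rg s' r_m)
          = sumz (fun i => if keep (ar s a_X i) then f (ar s a_X i) else 0) 0 m)
    /\ t <= m + 1).
Proof.
  intros Hm Hkv Hks Hxv Hxs Hdir Hd Hx Exv Exs Hm1 HmB [Hk1 Hk2] HX keep.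
  unfold compact. ws. apply wp_seq. set (X := ar s a_X) in *.
  (* Compaction is in place: writing stays at or behind reading, so the unread entries are still the
     original ones. *)
  eapply wp_while with
    (I := fun s1 => 0 <= rg s1 r_o <= rg s1 r_i /\ rg s1 r_i <= m
      /\ (forall i, rg s1 r_i <= i -> ar s1 a_X i = X i)
      /\ (forall i, 0 <= i < rg s1 r_o ->
          exists j, 0 <= j < m /\ ar s1 a_X i = X j /\ keep (X j) = true)
      /\ (forall f, sumz (fun i => f (ar s1 a_X i)) 0 (rg s1 r_o)
          = sumz (fun i => if keep (X i) then f (X i) else 0) 0 (rg s1 r_i)))
    (phi := fun s1 => m - rg s1 r_i).
  - simp. repeat split; auto; try lia.
  - intros s1 F (I1 & I2 & I3 & I4 & I5). frs. split; [sfty|lia].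
  - intros s1 F (I1 & I2 & I3 & I4 & I5) Hb. frs. rewrite Hm in Hb.
    set (i := rg s1 r_i) in *. set (o := rg s1 r_o) in *.
    assert (Hi : 0 <= X i < m0) by (apply HX; lia).
    assert (Hi' := I3 i ltac:(lia)).
    destruct (Hk2 _ Hi) as [P1 P2]. destruct (Hk2 _ Hx) as [P3 P4].
    specialize (P2 _ Hx). specialize (P4 _ Hi).
    assert (Hkeep : keep (X i) = true \/ keep (X i) = false)
      by (destruct (keep (X i)); auto).
    ws; fold_all i; fold_all o; rewrite ?Hi', ?Hkv, ?Hks, ?Hxv, ?Hxs, ?Hdir, ?Exv, ?Exs in *;
      try lia;
      try (destruct Hd as [-> | ->]; rewrite ?Z.mul_1_l; lia).
    + assert (Hk : keep (X i) = true) by (unfold keep; rewrite Exv, Exs; apply Z.ltb_lt; auto).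
      split; [|lia]. split; [lia|]. split; [lia|]. split; [|split].
      * intros j Hj. destruct (Z.eqb_spec j o); [lia|]. apply I3. lia.
      * intros j Hj. destruct (Z.eqb_spec j o).
        -- exists i. split; [lia|auto].
        -- apply I4. lia.
      * intros f. rewrite !sumz_last by lia. rewrite Z.eqb_refl, Hk.
        rewrite <- I5. f_equal. apply sumz_ext. intros j Hj.
        now destruct (Z.eqb_spec j o); [lia|].
    + assert (Hk : keep (X i) = false) by (unfold keep; rewrite Exv, Exs; apply Z.ltb_ge; lia).
      split; [|lia]. split; [lia|]. split; [lia|]. split; [|split]; auto.
      * intros j Hj. apply I3. lia.
      * intros f. rewrite !sumz_last by lia. rewrite Hk, I5. lia.
  - intros s1 t Ht F (I1 & I2 & I3 & I4 & I5) Hb Ht'. frs. rewrite Hm in *.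
    assert (Ei : rg s1 r_i = m) by lia. rewrite Ei in *. ws.
    repeat split; auto; lia.
Qed.

Lemma weigh_spec B n s kv ks kw m0 m xv xs x acc :
  rg s r_m = m -> ar s a_kV = kv -> ar s a_kS = ks -> ar s a_kW = kw ->
  rg s r_xv = xv -> rg s r_xs = xs -> rg s r_acc = acc ->
  0 <= x < m0 -> xv = kv x -> xs = ks x ->
  0 <= m -> m + 1 <= B -> keys_ok B kv ks m0 ->
  (forall i, 0 <= i < m -> 0 <= ar s a_X i < m0) ->
  (forall e, 0 <= e < m0 -> 0 <= kw e) -> 0 <= acc ->
  acc + sumz (fun i => kw (ar s a_X i)) 0 m <= B ->
  wp B n weigh s (fun s' t =>
    rg s' r_wg = acc + sumz (fun i => if xv * ks (ar s a_X i) <? kv (ar s a_X i) * xs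
                                then kw (ar s a_X i) else 0) 0 m
    /\ rg s' r_we = sumz (fun i => if xv * ks (ar s a_X i) =? kv (ar s a_X i) * xs
                                then kw (ar s a_X i) else 0) 0 m
    /\ t <= m + 1).
Proof.
  intros Hm Hkv Hks Hkw Hxv Hxs Hacc Hx Exv Exs Hm1 HmB [Hk1 Hk2] HX Hw0 Ha0 HaB.
  set (X := ar s a_X) in *.
  set (gw i := if xv * ks (X i) <? kv (X i) * xs then kw (X i) else 0).
  set (ew i := if xv * ks (X i) =? kv (X i) * xs then kw (X i) else 0).
  assert (Hsum : forall i, 0 <= i <= m ->
    0 <= sumz gw 0 i /\ 0 <= sumz ew 0 i /\ acc + (sumz gw 0 i + sumz ew 0 i) <= B).
  { intros i Hi. rewrite <- sumz_add.
    assert (sumz (fun i => gw i + ew i) 0 i <= sumz (fun i => kw (X i)) 0 m).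
    { rewrite (sumz_split (fun i => kw (X i)) 0 i) by lia.
      assert (0 <= sumz (fun i => kw (X i)) i m)
        by (apply sumz_nonneg; intros; apply Hw0, HX; lia).
      enough (sumz (fun i => gw i + ew i) 0 i <= sumz (fun i => kw (X i)) 0 i) by lia.
      apply sumz_le. intros j Hj. assert (0 <= kw (X j)) by (apply Hw0, HX; lia).
      unfold gw, ew. destruct (Z.ltb_spec (xv * ks (X j)) (kv (X j) * xs)),
        (Z.eqb_spec (xv * ks (X j)) (kv (X j) * xs)); lia. }
    repeat split; try lia; apply sumz_nonneg; intros j Hj;
      assert (0 <= kw (X j)) by (apply Hw0, HX; lia); unfold gw, ew.
    - destruct (_ <? _); lia.
    - destruct (_ =? _); lia. }
  unfold weigh. ws.
  eapply wp_while with
    (I := fun s1 => 0 <= rg s1 r_i <= m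
      /\ rg s1 r_wg = acc + sumz gw 0 (rg s1 r_i)
      /\ rg s1 r_we = sumz ew 0 (rg s1 r_i))
    (phi := fun s1 => m - rg s1 r_i).
  - simp. rewrite !sumz_empty by lia. lia.
  - intros s1 F (I1 & I2 & I3). frs. split; [sfty|lia].
  - intros s1 F (I1 & I2 & I3) Hb. frs. rewrite Hm in Hb.
    set (i := rg s1 r_i) in *.
    assert (Hi : 0 <= X i < m0) by (apply HX; lia).
    destruct (Hk2 _ Hi) as [P1 P2]. destruct (Hk2 _ Hx) as [P3 P4].
    specialize (P2 _ Hx). specialize (P4 _ Hi).
    pose proof (Hsum i ltac:(lia)) as S1. pose proof (Hsum (i + 1) ltac:(lia)) as S2.
    rewrite !sumz_last in S2 by lia.
    assert (Hgw : gw i = if xv * ks (X i) <? kv (X i) * xs then kw (X i) else 0) by reflexivity.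
    assert (Hew : ew i = if xv * ks (X i) =? kv (X i) * xs then kw (X i) else 0) by reflexivity.
    pose proof (Hw0 _ Hi) as Hw.
    ws; fold_all X; fold_all i; rewrite ?Hkv, ?Hks, ?Hkw, ?Hxv, ?Hxs in *;
      rewrite ?sumz_last by lia;
      destruct (Z.ltb_spec (xv * ks (X i)) (kv (X i) * xs)),
        (Z.eqb_spec (xv * ks (X i)) (kv (X i) * xs)); rewrite ?Exv, ?Exs in *; try lia.
  - intros s1 t Ht F (I1 & I2 & I3) Hb Ht'. frs. rewrite Hm in *.
    assert (Ei : rg s1 r_i = m) by lia. rewrite Ei in *. simp. repeat split; auto; lia.
Qed.

(* [c e] tells whether [e] is still a candidate (0), was found to lie above the
   threshold (1), or below it. *)
Definition select_inv kv ks kw m0 cap (X : Z -> Z) m acc (c : Z -> Z) : Prop :=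
  0 <= m <= m0
  /\ (forall i, 0 <= i < m -> 0 <= X i < m0 /\ c (X i) = 0)
  /\ (forall f, sumz (fun i => f (X i)) 0 m = sumz (fun e => if c e =? 0 then f e else 0) 0 m0)
  /\ acc = sumz (fun e => if c e =? 1 then kw e else 0) 0 m0
  /\ (forall e i, 0 <= e < m0 -> 0 <= i < m -> c e = 1 -> key_ge kv ks (X i) e = false)
  /\ (forall e i, 0 <= e < m0 -> 0 <= i < m -> c e <> 0 -> c e <> 1 ->
        key_ge kv ks e (X i) = false)
  /\ 0 <= acc <= cap /\ cap < acc + sumz (fun i => kw (X i)) 0 m.

(** [xv / xs] is the critical ratio of fractional greedy filling: what lies strictly above it fits,
    and the ties overflow the capacity unless there is nothing at or below the ratio. *)
Definition select_post (kv ks kw : Z -> Z) m0 cap xv xs : Prop :=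
  0 < xs
  /\ sumz (fun e => if xv * ks e <? kv e * xs then kw e else 0) 0 m0 <= cap
  /\ (cap < sumz (fun e => if xv * ks e <=? kv e * xs then kw e else 0) 0 m0
      \/ forall e, 0 <= e < m0 -> xv * ks e < kv e * xs).

Lemma select_round_spec B n s kv ks kw m0 m cap c :
  rg s r_m = m -> ar s a_kV = kv -> ar s a_kS = ks -> ar s a_kW = kw ->
  rg s r_cap = cap -> rg s r_fnd = 0 ->
  select_inv kv ks kw m0 cap (ar s a_X) m (rg s r_acc) c ->
  8 * m0 <= B -> 200 <= B -> keys_ok B kv ks m0 ->
  (forall e, 0 <= e < m0 -> 0 <= kw e) -> sumz kw 0 m0 <= B ->
  wp B n select_round s (fun s' t => t <= 645 * m + 2 /\
    ((rg s' r_fnd = 0 /\ 6 * rg s' r_m <= 5 * m /\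
      exists c', select_inv kv ks kw m0 cap (ar s' a_X) (rg s' r_m) (rg s' r_acc) c')
     \/ (rg s' r_fnd = 1
         /\ (exists x, 0 <= x < m0 /\ rg s' r_xv = kv x /\ rg s' r_xs = ks x)
         /\ select_post kv ks kw m0 cap (rg s' r_xv) (rg s' r_xs)))).
Proof.
  intros Hm Hkv Hks Hkw Hcap Hfnd Hinv HmB HB Hk Hw0 HwB.
  destruct Hinv as (V1 & V2 & V3 & V4 & V5 & V6 & V7 & V8).
  set (X := ar s a_X) in *. set (acc := rg s r_acc) in *.
  assert (Hm1 : 1 <= m).
  { destruct (Z.eq_dec m 0) as [E|]; [|lia]. rewrite E, sumz_empty in V8 by lia. lia. }
  assert (HX : forall i, 0 <= i < m -> 0 <= X i < m0) by (intros; apply V2; auto).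
  assert (Hk' := Hk). destruct Hk' as [_ Hk2].
  assert (HaccB : acc + sumz (fun i => kw (X i)) 0 m <= B).
  { rewrite V4, (V3 kw), <- sumz_add. etransitivity; [|exact HwB].
    apply sumz_le. intros e He. specialize (Hw0 e He).
    destruct (Z.eqb_spec (c e) 1), (Z.eqb_spec (c e) 0); lia. }
  unfold select_round. apply wp_seq. eapply wp_conseq.
  { eapply pivot_spec with (m := m) (m0 := m0) (kv := kv) (ks := ks); auto; lia. }
  cbv beta. intros s1 t1 Ht1 F1 ((jp & Hjp & Epx) & G1 & G2 & T1).
  assert (Hpx : 0 <= rg s1 r_px < m0) by (rewrite Epx; auto).
  set (px := rg s1 r_px) in *. fold X in G1, G2, Epx.
  ws. fold px. rewrite Hkv, Hks. apply wp_seq. eapply wp_conseq.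
  { eapply weigh_spec with (m := m) (m0 := m0) (kv := kv) (ks := ks) (kw := kw)
      (xv := kv px) (xs := ks px) (x := px) (acc := acc); frs; auto; try lia. }
  cbv beta. intros s2 t2 Ht2 F2 (W1 & W2 & T2). frs. fold X acc in W1, W2.
  assert (Hc1 : forall e, 0 <= e < m0 -> c e = 1 -> kv px * ks e < kv e * ks px).
  { intros e He Hc. specialize (V5 e jp He Hjp Hc). rewrite <- Epx in V5.
    unfold key_ge in V5. apply Z.leb_gt in V5. auto. }
  assert (Hc2 : forall e, 0 <= e < m0 -> c e <> 0 -> c e <> 1 ->
    kv e * ks px < kv px * ks e).
  { intros e He Hc Hc'. specialize (V6 e jp He Hjp Hc Hc'). rewrite <- Epx in V6.
    unfold key_ge in V6. apply Z.leb_gt in V6. auto. }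
  assert (WG : rg s2 r_wg
    = sumz (fun e => if kv px * ks e <? kv e * ks px then kw e else 0) 0 m0).
  { rewrite W1, V4, (V3 (fun e => if kv px * ks e <? kv e * ks px then kw e else 0)),
      <- sumz_add. apply sumz_ext. intros e He.
    specialize (Hc1 e He). specialize (Hc2 e He).
    destruct (Z.eqb_spec (c e) 1), (Z.eqb_spec (c e) 0),
      (Z.ltb_spec (kv px * ks e) (kv e * ks px)); lia. }
  assert (WE : rg s2 r_we
    = sumz (fun e => if kv px * ks e =? kv e * ks px then kw e else 0) 0 m0).
  { rewrite W2, (V3 (fun e => if kv px * ks e =? kv e * ks px then kw e else 0)).
    apply sumz_ext. intros e He.
    specialize (Hc1 e He). specialize (Hc2 e He).
    destruct (Z.eqb_spec (c e) 0), (Z.eqb_spec (kv px * ks e) (kv e * ks px)); lia. }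
  assert (WGE : rg s2 r_wg + rg s2 r_we
    = sumz (fun e => if kv px * ks e <=? kv e * ks px then kw e else 0) 0 m0).
  { rewrite WG, WE, <- sumz_add. apply sumz_ext. intros e He.
    destruct (Z.leb_spec (kv px * ks e) (kv e * ks px)),
      (Z.eqb_spec (kv px * ks e) (kv e * ks px)),
      (Z.ltb_spec (kv px * ks e) (kv e * ks px)); lia. }
  assert (HWG0 : 0 <= rg s2 r_wg).
  { rewrite WG. apply sumz_nonneg. intros e He. specialize (Hw0 e He).
    destruct (_ <? _); lia. }
  assert (HWE0 : 0 <= rg s2 r_we).
  { rewrite WE. apply sumz_nonneg. intros e He. specialize (Hw0 e He).
    destruct (_ =? _); lia. }
  assert (HWB : rg s2 r_wg + rg s2 r_we <= B).
  { rewrite WGE. etransitivity; [|exact HwB]. apply sumz_le. intros e He.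
    specialize (Hw0 e He). destruct (_ <=? _); lia. }
  ws; fold_all acc; rewrite ?Hcap in *.
  - eapply wp_conseq.
    { eapply compact_spec with (m := m) (m0 := m0) (kv := kv) (ks := ks)
        (xv := kv px) (xs := ks px) (x := px) (dir := 1); frs; auto; lia. }
    cbv beta. intros s3 t3 Ht3 F3 (K1 & K2 & K3 & K4). frs. fold X in K2, K3. fold_all acc.
    split; [lia|]. left. split; [auto|]. split.
    (* Counting with the constant 1: the candidates at or below the pivot are dropped, and they are
       at least a sixth of all. *)
    { specialize (K3 (fun _ => 1)). cbv beta in K3.
      rewrite sumz_const in K3 by lia.
      enough (rg s3 r_m + count_le kv ks X 0 m px = m) by lia.
      replace (rg s3 r_m) with (1 * (rg s3 r_m - 0)) by lia. rewrite K3.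
      unfold count_le. rewrite <- sumz_add.
      rewrite (sumz_ext _ (fun _ => 1)); [rewrite sumz_const; lia|].
      intros i Hi. unfold key_ge.
      destruct (Z.leb_spec (kv (X i) * ks px) (kv px * ks (X i))),
        (Z.ltb_spec (1 * (kv px * ks (X i))) (1 * (kv (X i) * ks px))); cbn [Z.b2z]; lia. }
    (* The dropped candidates get label 2, which stands for below the threshold. *)
    exists (fun e => if (c e =? 0) && negb (kv px * ks e <? kv e * ks px) then 2 else c e).
    assert (Hk3 : forall i, 0 <= i < rg s3 r_m -> exists j, 0 <= j < m
      /\ ar s3 a_X i = X j /\ kv px * ks (X j) < kv (X j) * ks px).
    { intros i Hi. destruct (K2 i Hi) as (j & Hj & E & Hkp). exists j.
      repeat split; auto; try lia. }
    split; [lia|]. split; [|split; [|split; [|split; [|split; [|split]]]]].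
    + intros i Hi. destruct (Hk3 i Hi) as (j & Hj & -> & Hlt).
      split; auto. rewrite (proj2 (V2 j Hj)), (proj2 (Z.ltb_lt _ _) Hlt). auto.
    + intros f. rewrite K3.
      rewrite (V3 (fun e => if 1 * (kv px * ks e) <? 1 * (kv e * ks px) then f e else 0)).
      apply sumz_ext. intros e He. rewrite !Z.mul_1_l.
      destruct (Z.eqb_spec (c e) 0) as [E|E]; cbn [andb].
      * destruct (_ <? _); cbn; auto. now rewrite E.
      * now rewrite (proj2 (Z.eqb_neq _ _) E).
    + rewrite V4. apply sumz_ext. intros e He.
      destruct (Z.eqb_spec (c e) 0) as [E|E]; cbn [andb]; auto.
      rewrite E. destruct (_ <? _); auto.
    + intros e i He Hi Hc. destruct (Hk3 i Hi) as (j & Hj & -> & _).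
      apply V5; auto. destruct (_ && _); [discriminate|auto].
    + intros e i He Hi Hc Hc'. destruct (Hk3 i Hi) as (j & Hj & -> & Hlt).
      destruct (Z.eqb_spec (c e) 0) as [E|E]; cbn [andb] in Hc, Hc'; [|auto].
      destruct (Z.ltb_spec (kv px * ks e) (kv e * ks px)) as [L|L]; cbn [negb] in Hc; [tauto|].
      destruct (key_ge kv ks e (X j)) eqn:Ege; auto.
      assert (key_ge kv ks px (X j) = true).
      { eapply key_ge_trans; [| | |apply Z.leb_le; exact L|exact Ege]; apply Hk2; auto. }
      unfold key_ge in H0. lia.
    + lia.
    + rewrite K3. rewrite W1 in H.
      rewrite (sumz_ext _ (fun i => if kv px * ks (X i) <? kv (X i) * ks px
        then kw (X i) else 0)) by (intros; now rewrite !Z.mul_1_l). lia.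
  - split; [lia|]. right. split; [auto|]. split; [exists px; auto|].
    split; [apply Hk2; auto|]. split; [rewrite <- WG; lia|]. left. rewrite <- WGE. lia.
  - eapply wp_conseq.
    { eapply compact_spec with (m := m) (m0 := m0) (kv := kv) (ks := ks)
        (xv := kv px) (xs := ks px) (x := px) (dir := -1); frs; auto; lia. }
    cbv beta. intros s3 t3 Ht3 F3 (K1 & K2 & K3 & K4). frs. fold X in K2, K3. fold_all acc.
    split; [lia|]. left. split; [auto|]. split.
    { specialize (K3 (fun _ => 1)). cbv beta in K3.
      rewrite sumz_const in K3 by lia.
      enough (rg s3 r_m + count_ge kv ks X 0 m px = m) by lia.
      replace (rg s3 r_m) with (1 * (rg s3 r_m - 0)) by lia. rewrite K3.
      unfold count_ge. rewrite <- sumz_add.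
      rewrite (sumz_ext _ (fun _ => 1)); [rewrite sumz_const; lia|].
      intros i Hi. unfold key_ge.
      destruct (Z.leb_spec (kv px * ks (X i)) (kv (X i) * ks px)),
        (Z.ltb_spec (-1 * (kv px * ks (X i))) (-1 * (kv (X i) * ks px))); cbn [Z.b2z]; lia. }
    exists (fun e => if (c e =? 0) && (kv px * ks e <=? kv e * ks px) then 1 else c e).
    assert (Hk3 : forall i, 0 <= i < rg s3 r_m -> exists j, 0 <= j < m
      /\ ar s3 a_X i = X j /\ kv (X j) * ks px < kv px * ks (X j)).
    { intros i Hi. destruct (K2 i Hi) as (j & Hj & E & Hkp). exists j.
      repeat split; auto; try lia. }
    split; [lia|]. split; [|split; [|split; [|split; [|split; [|split]]]]].
    + intros i Hi. destruct (Hk3 i Hi) as (j & Hj & -> & Hlt).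
      split; auto. rewrite (proj2 (V2 j Hj)), (proj2 (Z.leb_gt _ _) Hlt). auto.
    + intros f. rewrite K3.
      rewrite (V3 (fun e => if -1 * (kv px * ks e) <? -1 * (kv e * ks px) then f e else 0)).
      apply sumz_ext. intros e He.
      destruct (Z.eqb_spec (c e) 0) as [E|E]; cbn [andb].
      * destruct (Z.ltb_spec (-1 * (kv px * ks e)) (-1 * (kv e * ks px))),
          (Z.leb_spec (kv px * ks e) (kv e * ks px)); cbn; auto; try lia. now rewrite E.
      * now rewrite (proj2 (Z.eqb_neq _ _) E).
    + rewrite WGE. apply sumz_ext. intros e He.
      specialize (Hc1 e He). specialize (Hc2 e He).
      destruct (Z.eqb_spec (c e) 0) as [E|E], (Z.eqb_spec (c e) 1) as [E1|E1],
        (Z.leb_spec (kv px * ks e) (kv e * ks px)); cbn [andb]; try lia;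
        try (rewrite E1; reflexivity); try (rewrite E; reflexivity); auto.
      now rewrite (proj2 (Z.eqb_neq _ _) E1).
    + intros e i He Hi Hc. destruct (Hk3 i Hi) as (j & Hj & -> & Hlt).
      destruct (Z.eqb_spec (c e) 0) as [E|E]; cbn [andb] in Hc; [|auto].
      destruct (Z.leb_spec (kv px * ks e) (kv e * ks px)) as [L|L]; [|lia].
      destruct (key_ge kv ks (X j) e) eqn:Ege; auto.
      assert (key_ge kv ks (X j) px = true).
      { eapply key_ge_trans; [| | |exact Ege|apply Z.leb_le; exact L]; apply Hk2; auto. }
      unfold key_ge in H1. lia.
    + intros e i He Hi Hc Hc'. destruct (Hk3 i Hi) as (j & Hj & -> & Hlt).
      destruct (Z.eqb_spec (c e) 0) as [E|E]; cbn [andb] in Hc, Hc'; [|auto].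
      destruct (Z.leb_spec (kv px * ks e) (kv e * ks px)) as [L|L]; tauto.
    + lia.
    + rewrite K3. rewrite W1, W2.
      rewrite <- !Z.add_assoc, <- sumz_add.
      rewrite <- sumz_add.
      rewrite (sumz_ext _ (fun i => kw (X i))); [lia|].
      intros i Hi.
      destruct (Z.ltb_spec (-1 * (kv px * ks (X i))) (-1 * (kv (X i) * ks px))),
        (Z.eqb_spec (kv px * ks (X i)) (kv (X i) * ks px)),
        (Z.ltb_spec (kv px * ks (X i)) (kv (X i) * ks px)); lia.
Qed.

Lemma select_spec B n s kv ks kw m0 cap vm :
  rg s r_m0 = m0 -> ar s a_kV = kv -> ar s a_kS = ks -> ar s a_kW = kw ->
  rg s r_cap = cap -> rg s r_vm = vm -> 0 <= cap ->
  0 <= m0 -> 8 * m0 <= B -> 200 <= B -> keys_ok B kv ks m0 ->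
  (forall e, 0 <= e < m0 -> Z.abs (kv e) <= vm) -> 0 <= vm -> vm + 1 <= B ->
  (forall e, 0 <= e < m0 -> 0 <= kw e) -> sumz kw 0 m0 <= B ->
  wp B n select s (fun s' t =>
    select_post kv ks kw m0 cap (rg s' r_xv) (rg s' r_xs)
    /\ ((exists x, 0 <= x < m0 /\ rg s' r_xv = kv x /\ rg s' r_xs = ks x)
        \/ rg s' r_xv = - vm - 1 /\ rg s' r_xs = 1)
    /\ t <= 4001 * m0 + 3).
Proof.
  intros Hm0 Hkv Hks Hkw Hcap Hvm Hcap0 Hm00 HmB HB Hk Hvb Hv0 HvB Hw0 HwB.
  assert (Hk' := Hk). destruct Hk' as [_ Hk2].
  assert (Hsum : forall i, 0 <= i <= m0 -> 0 <= sumz kw 0 i <= B).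
  { intros i Hi. split; [apply sumz_nonneg; intros; apply Hw0; lia|].
    rewrite (sumz_split kw 0 i m0) in HwB by lia.
    assert (0 <= sumz kw i m0) by (apply sumz_nonneg; intros; apply Hw0; lia). lia. }
  unfold select. ws. apply wp_seq.
  eapply wp_while with
    (I := fun s1 => 0 <= rg s1 r_i <= m0 /\ rg s1 r_wg = sumz kw 0 (rg s1 r_i)
      /\ forall i, 0 <= i < rg s1 r_i -> ar s1 a_X i = i)
    (phi := fun s1 => m0 - rg s1 r_i).
  - simp. rewrite sumz_empty by lia. repeat split; intros; lia.
  - intros s1 F (I1 & I2 & I3). frs. split; [sfty|lia].
  - intros s1 F (I1 & I2 & I3) Hb. frs. rewrite ?Hm0, ?Hkw in *.
    set (i := rg s1 r_i) in *. pose proof (Hsum (i + 1) ltac:(lia)) as S.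
    rewrite sumz_last in S by lia.
    ws; fold i; rewrite ?Hkw, ?I2; try lia.
    rewrite sumz_last by lia. split; [|lia]. repeat split; try lia.
    intros j Hj. destruct (Z.eqb_spec j i); auto. apply I3. lia.
  - intros s1 t1 Ht1 F1 (I1 & I2 & I3) Hb Ht1'. frs. rewrite Hm0 in *.
    assert (Ei : rg s1 r_i = m0) by lia. rewrite Ei in *.
    pose proof (Hsum m0 ltac:(lia)) as S.
    ws; rewrite ?Hvm, ?Hm0, ?Hcap in *; try lia.
    + eapply wp_while with
        (I := fun s2 => (rg s2 r_fnd = 0 /\ 0 <= rg s2 r_m <= m0 /\
            exists c, select_inv kv ks kw m0 cap (ar s2 a_X) (rg s2 r_m) (rg s2 r_acc) c)
          \/ (rg s2 r_fnd = 1
             /\ (exists x, 0 <= x < m0 /\ rg s2 r_xv = kv x /\ rg s2 r_xs = ks x)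
             /\ select_post kv ks kw m0 cap (rg s2 r_xv) (rg s2 r_xs)))
        (* A round with its test costs at most [645 m + 3], and one that finds nothing removes a
           sixth of the candidates; [4000 / 6] exceeds 648. *)
        (phi := fun s2 => if rg s2 r_fnd =? 0 then 4000 * rg s2 r_m + 1 else 0).
      * frs. left. split; [auto|]. split; [lia|]. exists (fun _ => 0).
        split; [lia|]. split; [|split; [|split; [|split; [|split; [|split]]]]].
        -- intros i Hi. rewrite I3 by lia. auto.
        -- intros f. cbn [Z.eqb]. apply sumz_ext. intros i Hi. now rewrite I3 by lia.
        -- cbn [Z.eqb]. now rewrite sumz_zero.
        -- intros; lia.
        -- intros; lia.
        -- lia.
        -- rewrite (sumz_ext _ kw) by (intros; now rewrite I3 by lia). lia.
      * intros s2 F2 J. frs. split; [sfty|].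
        destruct J as [(-> & J & _)|(-> & _)]; cbn [Z.eqb]; lia.
      * intros s2 F2 J Hb2. frs. destruct J as [(J1 & J2 & c & J3)|(J1 & _)]; [|lia].
        assert (1 <= rg s2 r_m).
        { destruct J3 as (_ & _ & _ & _ & _ & _ & A & A').
          destruct (Z.eq_dec (rg s2 r_m) 0) as [E|]; [|lia].
          rewrite E, sumz_empty in A' by lia. lia. }
        eapply wp_conseq.
        { eapply select_round_spec with (m := rg s2 r_m) (m0 := m0) (kv := kv) (ks := ks)
            (kw := kw) (cap := cap) (c := c); frs; auto. }
        cbv beta. intros s3 t3 Ht3 F3 (T3 & K). rewrite J1. cbn [Z.eqb].
        destruct K as [(K1 & K2 & c' & K3)|(K1 & K2)].
        -- split.
           ++ left. split; auto. split; [|eauto]. apply K3.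
           ++ rewrite K1. cbn [Z.eqb]. lia.
        -- split; [right; auto|]. rewrite K1. cbn [Z.eqb]. lia.
      * intros s2 t2 Ht2 F2 J Hb2 Ht2'. frs. cbn [Z.eqb] in Ht2'.
        destruct J as [(J1 & J2)|(J1 & J2 & J3)]; [lia|].
        rewrite J1 in *. cbn [Z.eqb] in *. split; [auto|]. split; [auto|lia].
    + assert (Hall : forall e, 0 <= e < m0 -> (0 - vm - 1) * ks e < kv e * 1).
      { intros e He. specialize (Hvb e He). destruct (Hk2 e He) as [P _]. nia. }
      split; [|lia]. split; [lia|]. split; [|now right].
      rewrite (sumz_ext _ kw); [lia|]. intros e He. specialize (Hall e He).
      destruct (Z.ltb_spec ((0 - vm - 1) * ks e) (kv e * 1)); lia.
Qed.

(** * Row maxima of inverse Monge matrices *)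

Notation r_k := 35%nat.    Notation r_r := 36%nat.    Notation r_R := 37%nat.
Notation r_lv := 38%nat.   Notation r_stp := 39%nat.  Notation r_src := 40%nat.
Notation r_dst := 41%nat.  Notation r_h := 42%nat.    Notation r_ci := 43%nat.
Notation r_len := 44%nat.  Notation r_c := 45%nat.    Notation r_p := 46%nat.
Notation r_a := 47%nat.    Notation r_lim := 48%nat.  Notation r_best := 49%nat.
Notation r_bv := 50%nat.   Notation r_en := 51%nat.

Notation a_hd := 12%nat.   Notation a_nx := 13%nat.   Notation a_F := 14%nat.
Notation a_g := 15%nat.    Notation a_H := 16%nat.    Notation a_ARG := 17%nat.
Notation a_LI := 18%nat.   Notation a_col := 19%nat.  Notation a_len := 20%nat.
Notation a_row := 21%nat.  Notation a_TK := 22%nat.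

(** Within residue class [r] modulo [k], position [r + k a] is reached from [r + k b] by changing
    [a - b] copies. [F] is stored with offset [NN] because the change may be negative. *)
Definition entry (a b : expr) : expr :=
  (a_g@[$r_r + $r_k * b] + a_F@[$r_NN + (a - b)])%ex.

(** The surviving columns form a stack in which column number [i] is at least as good as the next
    one at row [stp * i]. A new column pops the top while strictly better at the row of the top. It
    is discarded if there are already as many survivors as rows. *)
Definition reduce : cmd :=
  Asg r_src ($r_lv * $r_NN) ;; Asg r_dst ($r_src + $r_NN) ;;
  Asg r_h (#0) ;; Asg r_ci (#0) ;; Asg r_len (a_len@[$r_lv]) ;;
  While (CLt ($r_ci) ($r_len))
    (Asg r_c (a_col@[$r_src + $r_ci]) ;;
     While (CAnd (CLt (#0) ($r_h))
              (CLt (entry ($r_stp * ($r_h - #1)) (a_col@[$r_dst + ($r_h - #1)]))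
                   (entry ($r_stp * ($r_h - #1)) ($r_c))))
       (Asg r_h ($r_h - #1)) ;;
     If (CLt ($r_h * $r_stp) ($r_R))
        (Sto a_col ($r_dst + $r_h) ($r_c) ;; Asg r_h ($r_h + #1)) Skip ;;
     Asg r_ci ($r_ci + #1)).

(** Row maxima move to the right, so the odd rows are searched between the maxima of their even
    neighbours by a pointer [r_p] that never moves back. Ties go to the later column, which keeps
    the maxima monotone. *)
Definition interpolate : cmd :=
  Asg r_p ($r_lv * $r_NN) ;; Asg r_en ($r_p + a_len@[$r_lv]) ;; Asg r_a ($r_stp) ;;
  While (CLt ($r_a) ($r_R))
    (If (CLt ($r_a + $r_stp) ($r_R)) (Asg r_lim (a_row@[$r_a + $r_stp]))
        (Asg r_lim (a_col@[$r_en - #1])) ;;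
     Asg r_best (a_col@[$r_p]) ;; Asg r_bv (entry ($r_a) ($r_best)) ;;
     While (CLt (a_col@[$r_p]) ($r_lim))
       (Asg r_p ($r_p + #1) ;; Asg r_c (a_col@[$r_p]) ;;
        If (CLt (entry ($r_a) ($r_c)) ($r_bv)) Skip
           (Asg r_best ($r_c) ;; Asg r_bv (entry ($r_a) ($r_c)))) ;;
     Sto a_row ($r_a) ($r_best) ;; Asg r_a ($r_a + #2 * $r_stp)).

(* SMAWK with its recursion unrolled: level [lv] keeps the rows divisible by
   [2 ^ lv] and stores its surviving columns from index [lv * NN] on. *)
Definition smawk : cmd :=
  Asg r_lv (#0) ;; Asg r_stp (#1) ;; Asg r_ci (#0) ;;
  While (CLt ($r_ci) ($r_R))
    (Sto a_col ($r_ci) ($r_ci) ;; Asg r_ci ($r_ci + #1)) ;;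
  Sto a_len (#0) ($r_R) ;;
  While (CLt ($r_stp) ($r_R))
    (Asg r_stp (#2 * $r_stp) ;; reduce ;;
     Asg r_lv ($r_lv + #1) ;; Sto a_len ($r_lv) ($r_h)) ;;
  Sto a_row (#0) (a_col@[$r_lv * $r_NN]) ;;
  While (CLt (#0) ($r_lv))
    (Asg r_lv ($r_lv - #1) ;; Asg r_stp ($r_stp / #2) ;; interpolate).

(** * Correctness and linear cost of SMAWK *)

Section Smawk.

Variables (B n : Z) (g F : Z -> Z) (r k R NN : Z).
Hypothesis HR : 1 <= R <= NN.
Hypothesis HrB : forall b, 0 <= b < R -> 0 <= r + k * b <= B /\ Z.abs (k * b) <= B.
Hypothesis HNB : (NN + 3) * (NN + 3) <= B.

Definition entry_val (a b : Z) : Z := g (r + k * b) + F (NN + (a - b)).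
Notation M := entry_val.

Hypothesis HM : forall a b, 0 <= a < R -> 0 <= b < R -> Z.abs (M a b) <= B.
(** Inverse Monge: the advantage of a later column over an earlier one does not shrink as the row
    grows. *)
Hypothesis Hquad : forall a a' b b', 0 <= a <= a' -> a' < R -> 0 <= b <= b' -> b' < R ->
  M a b' + M a' b <= M a b + M a' b'.

Definition mat_env (s : st) : Prop :=
  rg s r_r = r /\ rg s r_k = k /\ rg s r_R = R /\ rg s r_NN = NN
  /\ ar s a_g = g /\ ar s a_F = F.

Lemma entry_safe s a b :
  mat_env s -> safe B n s a -> safe B n s b -> 0 <= ev s a < R -> 0 <= ev s b < R ->
  safe B n s (entry a b).
Proof.
  intros (E1 & E2 & E3 & E4 & E5 & E6) Sa Sb Ha Hb.
  destruct (HrB _ Hb). specialize (HM _ _ Ha Hb). unfold entry_val in HM.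
  assert (3 * NN <= B) by nia.
  cbn [entry safe ev op_val op_ok idx_ok]. rewrite E1, E2, E4, E5, E6.
  repeat split; auto; lia.
Qed.

Lemma entry_ev s a b : mat_env s -> ev s (entry a b) = M (ev s a) (ev s b).
Proof.
  intros (E1 & E2 & E3 & E4 & E5 & E6). cbn [entry ev op_val].
  now rewrite E1, E2, E4, E5, E6.
Qed.

Definition cols_ok (c : Z -> Z) (len st : Z) : Prop :=
  1 <= len /\ (len - 1) * st < R
  /\ (forall i, 0 <= i < len -> 0 <= c i < R)
  /\ (forall i j, 0 <= i < j -> j < len -> c i < c j).

Definition dominating (c : Z -> Z) (len st : Z) : Prop :=
  forall i b, 0 <= i -> st * i < R -> 0 <= b < R ->
    exists p, 0 <= p < len /\ M (st * i) b <= M (st * i) (c p).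

Ltac mulb :=
  repeat split; try (apply Z.mul_nonneg_nonneg; lia);
  try (apply Z.mul_le_mono_nonneg_l; lia); try lia.

Lemma reduce_spec s lv st stp' :
  mat_env s -> rg s r_lv = lv -> 0 <= lv <= NN -> rg s r_stp = st -> 1 <= st <= 2 * R ->
  let len := ar s a_len lv in let cs i := ar s a_col (lv * NN + i) in
  cols_ok cs len stp' -> 1 <= stp' -> dominating cs len st ->
  wp B n reduce s (fun s' t =>
    let h := rg s' r_h in let cd i := ar s' a_col ((lv + 1) * NN + i) in
    cols_ok cd h st /\ dominating cd h st
    /\ (forall i, 0 <= i < h -> exists j, 0 <= j < len /\ cd i = cs j)
    /\ (forall x, x < (lv + 1) * NN -> ar s' a_col x = ar s a_col x)
    /\ t <= 3 * len + 1).
Proof.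
  intros Henv Hlv HlvN Hst Hst1 len cs (L1 & L2 & L3 & L4) Hst' Hdom.
  assert (Henv' := Henv). destruct Henv' as (E1 & E2 & E3 & E4 & E5 & E6).
  assert (HlenR : len <= R) by nia.
  assert (HlvB : 0 <= lv * NN <= NN * NN) by nia.
  assert (HB3 : NN * NN + 6 * NN + 9 <= B) by lia.
  unfold reduce.
  apply wp_asg_seq; [sfty; rewrite Hlv, E4; lia|]. frs. rewrite Hlv, E4.
  apply wp_asg_seq; [sfty; rewrite E4; lia|]. frs. rewrite E4.
  ws; rewrite ?Hlv; try lia. fold len.
  set (dst := lv * NN + NN) in *.
  eapply wp_while with
    (I := fun s1 => let h := rg s1 r_h in let ci := rg s1 r_ci in
      let cd i := ar s1 a_col (dst + i) in
      0 <= ci <= len /\ 0 <= h <= R /\ (h - 1) * st < R /\ (0 < ci -> 0 < h)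
      /\ (forall x, x < dst -> ar s1 a_col x = ar s a_col x)
      /\ (forall i, 0 <= i < h -> exists j, 0 <= j < ci /\ cd i = cs j)
      /\ (forall i j, 0 <= i < j -> j < h -> cd i < cd j)
      /\ (forall p, 0 <= p -> p + 1 < h -> M (st * p) (cd (p + 1)) <= M (st * p) (cd p))
      /\ (forall i j, 0 <= i -> st * i < R -> 0 <= j < ci ->
            exists p, 0 <= p < h /\ M (st * i) (cs j) <= M (st * i) (cd p)))
    (* A column pays 3 in advance: the outer test, the failing inner test, and its own later removal
       from the stack. *)
    (phi := fun s1 => 3 * (len - rg s1 r_ci) + rg s1 r_h).
  - simp. repeat split; intros; auto; lia.
  - intros s1 F1 (I1 & I2 & I3 & I4 & I5 & I6 & I7 & I8 & I9). frs. split; [sfty|lia].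
  - intros s1 F1 (I1 & I2 & I3 & I4 & I5 & I6 & I7 & I8 & I9) Hb. frs.
    set (ci := rg s1 r_ci) in *.
    apply wp_asg_seq; [sfty; fold ci; lia|]. frs. fold ci.
    rewrite (I5 (lv * NN + ci)) by lia. change (ar s a_col (lv * NN + ci)) with (cs ci).
    set (c := cs ci) in *.
    assert (Hc : 0 <= c < R) by (apply L3; lia).
    apply wp_seq.
    set (cd := fun i => ar s1 a_col (dst + i)) in *.
    assert (Hcd : forall i, 0 <= i < rg s1 r_h -> 0 <= cd i < c).
    { intros i Hi. destruct (I6 i Hi) as (j & Hj & E). fold (cd i) in E. rewrite E.
      split; [apply L3; lia|]. apply L4; lia. }
    eapply wp_while with
      (I := fun s2 => let h := rg s2 r_h in
        0 <= h <= rg s1 r_h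
        /\ (forall i j, 0 <= i -> st * i < R -> 0 <= j < ci ->
              (exists p, 0 <= p < h /\ M (st * i) (cs j) <= M (st * i) (cd p))
              \/ M (st * i) (cs j) <= M (st * i) c))
      (phi := fun s2 => rg s2 r_h).
    + simp. split; [lia|]. intros. left. auto.
    + intros s2 F2 (J1 & J2).
      assert (Env2 : mat_env s2) by (repeat split; frs; auto).
      set (h := rg s2 r_h) in *.
      split; [|lia]. split; [sfty|]. intros Hh. cbn [tvp ev] in Hh. fold h in Hh.
      assert (Hr : 0 <= st * (h - 1) < R) by nia.
      assert (Hcd1 := Hcd (h - 1) ltac:(lia)). unfold cd in Hcd1.
      split; apply entry_safe; auto; sfty; fold h; try rewrite Hst; try fold dst; lia.
    + intros s2 F2 (J1 & J2) Hb2.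
      assert (Env2 : mat_env s2) by (repeat split; frs; auto).
      cbn [tvp] in Hb2. rewrite !entry_ev in Hb2 by auto. frs. fold dst in Hb2.
      set (h := rg s2 r_h) in *. rewrite Hst in Hb2. fold (cd (h - 1)) in Hb2.
      destruct Hb2 as [Hh Hlt].
      assert ((h - 2) * st <= (rg s1 r_h - 1) * st)
        by (apply Z.mul_le_mono_nonneg_r; lia).
      ws. fold h. split; [|lia]. split; [lia|].
      intros i j Hi HiR Hj. destruct (J2 i j Hi HiR Hj) as [(p & Hp & Hle)|Hle]; [|auto].
      destruct (Z.eq_dec p (h - 1)) as [->|]; [|left; exists p; split; auto; lia].
      (* Column [h - 1] is popped because the new column beats it at row [h - 1], hence at all later
         rows. At the earlier rows column [h - 2] replaces it, being at least as good at row [h - 2]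
         and therefore before. *)
      destruct (Z_le_gt_dec (h - 1) i) as [Hge|Hgt].
      * right. pose proof (Hcd (h - 1) ltac:(lia)).
        pose proof (Hquad (st * (h - 1)) (st * i) (cd (h - 1)) c ltac:(mulb) HiR ltac:(lia) ltac:(lia)).
        lia.
      * left. exists (h - 2). split; [lia|].
        pose proof (I8 (h - 2) ltac:(lia) ltac:(lia)) as Hl.
        fold (cd (h - 2 + 1)) (cd (h - 2)) in Hl. replace (h - 2 + 1) with (h - 1) in Hl by lia.
        pose proof (Hcd (h - 2) ltac:(lia)). pose proof (Hcd (h - 1) ltac:(lia)).
        pose proof (I7 (h - 2) (h - 1) ltac:(lia) ltac:(lia)) as Hs.
        fold (cd (h - 2)) (cd (h - 1)) in Hs.
        pose proof (Hquad (st * i) (st * (h - 2)) (cd (h - 2)) (cd (h - 1))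
          ltac:(mulb) ltac:(lia) ltac:(lia) ltac:(lia)). lia.
    + intros s2 t2 Ht2 F2 (J1 & J2) Hb2 Ht2'.
      assert (Env2 : mat_env s2) by (repeat split; frs; auto).
      cbn [tvp] in Hb2. rewrite !entry_ev in Hb2 by auto. frs. fold dst in Hb2.
      set (h := rg s2 r_h) in *. rewrite Hst in Hb2. fold (cd (h - 1)) in Hb2.
      assert (Hh1 : (h - 1) * st < R) by nia.
      assert (Htop : 0 < h -> M (st * (h - 1)) c <= M (st * (h - 1)) (cd (h - 1))) by lia.
      assert (HhB : 0 <= h * st <= 3 * NN) by nia.
      apply wp_if_seq; [sfty; fold h; rewrite Hst; lia| |]; intros Hcnd;
        cbn [tvp ev op_val] in Hcnd; frs; fold h in Hcnd; rewrite Hst, E3 in Hcnd.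
      * ws; fold h; fold dst; try lia. fold ci.
        assert (h * 1 <= h * st) by mulb.
        split; [|lia]. split; [lia|]. split; [lia|]. split; [nia|]. split; [lia|].
        split; [|split; [|split; [|split]]].
        -- intros x Hx. destruct (Z.eqb_spec x (dst + h)); [lia|]. auto.
        -- intros i Hi. destruct (Z.eqb_spec (dst + i) (dst + h)).
           ++ exists ci. split; [lia|auto].
           ++ destruct (I6 i ltac:(lia)) as (j & Hj & E). exists j. split; [lia|auto].
        -- intros i j Hi Hj.
           destruct (Z.eqb_spec (dst + i) (dst + h)); [lia|].
           destruct (Z.eqb_spec (dst + j) (dst + h)).
           ++ apply Hcd. lia.
           ++ apply I7; lia.
        -- intros p Hp Hp1.
           destruct (Z.eqb_spec (dst + p) (dst + h)); [lia|].
           destruct (Z.eqb_spec (dst + (p + 1)) (dst + h)).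
           ++ replace p with (h - 1) by lia. apply Htop. lia.
           ++ apply I8; lia.
        -- intros i j Hi HiR Hj.
           destruct (Z.eq_dec j ci) as [->|].
           { exists h. rewrite Z.eqb_refl. split; [lia|]. unfold c. lia. }
           destruct (J2 i j Hi HiR ltac:(lia)) as [(p & Hp & Hle)|Hle].
           ++ exists p. destruct (Z.eqb_spec (dst + p) (dst + h)); [lia|].
              split; [lia|auto].
           ++ exists h. rewrite Z.eqb_refl. split; [lia|auto].
      * ws; fold h; try lia. fold ci.
        assert (Hh0 : 0 < h) by nia.
        split; [|lia]. split; [lia|]. split; [lia|]. split; [lia|]. split; [lia|].
        split; [auto|]. split; [|split; [|split]].
        -- intros i Hi. destruct (I6 i ltac:(lia)) as (j & Hj & E). exists j. split; [lia|auto].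
        -- intros i j Hi Hj. apply I7; lia.
        -- intros p Hp Hp1. apply I8; lia.
        -- intros i j Hi HiR Hj.
           (* The stack is full, so every row lies at or before that of the top, where the new
              column loses; hence it loses in all rows. *)
           assert (Hct : M (st * i) c <= M (st * i) (cd (h - 1))).
           { specialize (Htop Hh0). pose proof (Hcd (h - 1) ltac:(lia)).
             assert (i < h) by (apply Z.mul_lt_mono_pos_l with st; lia).
             pose proof (Hquad (st * i) (st * (h - 1)) (cd (h - 1)) c
               ltac:(mulb) ltac:(lia) ltac:(lia) ltac:(lia)). lia. }
           destruct (Z.eq_dec j ci) as [->|]; [exists (h - 1); split; [lia|exact Hct]|].
           destruct (J2 i j Hi HiR ltac:(lia)) as [(p & Hp & Hle)|Hle].
           ++ exists p. split; [lia|auto].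
           ++ exists (h - 1). split; [lia|]. fold (cd (h - 1)). lia.
  - intros s1 t1 Ht1 F1 (I1 & I2 & I3 & I4 & I5 & I6 & I7 & I8 & I9) Hb Ht1'. frs.
    replace (rg s1 r_ci) with len in * by lia.
    replace ((lv + 1) * NN) with dst by (unfold dst; lia).
    split; [|split; [|split; [|split]]]; auto; try lia.
    + split; [lia|]. split; [lia|]. split; [|auto].
      intros i Hi. destruct (I6 i Hi) as (j & Hj & ->). auto.
    + intros i b Hi HiR Hb'. destruct (Hdom i b Hi HiR Hb') as (p & Hp & Hle).
      destruct (I9 i p Hi HiR Hp) as (p' & Hp' & Hle'). exists p'. split; auto. lia.
Qed.

Definition row_opt (row c : Z -> Z) (len a : Z) : Prop :=
  (exists p, 0 <= p < len /\ row a = c p) /\ forall b, 0 <= b < R -> M a b <= M a (row a).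

Lemma interpolate_spec s lv st :
  mat_env s -> rg s r_lv = lv -> 0 <= lv <= NN -> rg s r_stp = st -> 1 <= st < R ->
  let len := ar s a_len lv in let c i := ar s a_col (lv * NN + i) in
  let row := ar s a_row in
  cols_ok c len st -> dominating c len st ->
  (forall i, 0 <= i -> 2 * st * i < R -> row_opt row c len (2 * st * i)) ->
  (forall i, 0 <= i -> 2 * st * (i + 1) < R -> row (2 * st * i) <= row (2 * st * (i + 1))) ->
  wp B n interpolate s (fun s' t =>
    let row' := ar s' a_row in
    (forall i, 0 <= i -> st * i < R -> row_opt row' c len (st * i))
    /\ (forall i, 0 <= i -> st * (i + 1) < R -> row' (st * i) <= row' (st * (i + 1)))
    /\ t <= (R - 1) / st + len + 3).
Proof.
  intros Henv Hlv HlvN Hst Hst1 len c row (L1 & L2 & L3 & L4) Hdom Hopt Hmono.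
  assert (Henv' := Henv). destruct Henv' as (E1 & E2 & E3 & E4 & E5 & E6).
  assert (HlenR : len <= R) by nia.
  assert (HlvB : 0 <= lv * NN <= NN * NN) by nia.
  assert (HB3 : NN * NN + 6 * NN + 9 <= B) by lia.
  unfold interpolate.
  apply wp_asg_seq; [sfty; rewrite Hlv, E4; lia|]. frs. rewrite Hlv, E4.
  ws; rewrite ?Hlv; fold len; try lia. rewrite Hst.
  set (base := lv * NN) in *.
  assert (Hinj : forall i j, 0 <= i < len -> 0 <= j < len -> c i <= c j -> i <= j).
  { intros i j Hi Hj Hle. destruct (Z_le_gt_dec i j); auto.
    specialize (L4 j i ltac:(lia) ltac:(lia)). lia. }
  assert (Hdiv : forall x, (x - 2 * st) / st = x / st - 2).
  { intros x. replace (x - 2 * st) with (x + (-2) * st) by lia.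
    rewrite Z.div_add by lia. lia. }
  eapply wp_while with
    (I := fun s1 => exists j p, let row1 := ar s1 a_row in
      0 <= j /\ rg s1 r_a = st * (2 * j + 1) /\ rg s1 r_a < R + 2 * st
      /\ rg s1 r_p = base + p /\ 0 <= p < len
      /\ (st * (2 * j) < R -> c p <= row (st * (2 * j)))
      /\ (forall i, row1 (st * (2 * i)) = row (st * (2 * i)))
      /\ (forall i, 0 <= i < j -> st * (2 * i + 1) < R ->
            row_opt row1 c len (st * (2 * i + 1))
            /\ row (st * (2 * i)) <= row1 (st * (2 * i + 1))
            /\ (st * (2 * i + 2) < R -> row1 (st * (2 * i + 1)) <= row (st * (2 * i + 2)))))
    (* [r_a] overshoots [R] by less than [2 st], so the quotient is at least -2. *)
    (phi := fun s1 => (R - 1 - rg s1 r_a) / st + 3 + (base + len - rg s1 r_p)).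
  - simp. exists 0, 0. split; [lia|]. split; [lia|]. split; [lia|]. split; [lia|].
    split; [lia|]. split; [|split; [auto|intros; lia]].
    intros _. destruct (Hopt 0 ltac:(lia) ltac:(lia)) as [(p & Hp & E) _].
    replace (st * (2 * 0)) with (2 * st * 0) by lia. rewrite E.
    destruct (Z.eq_dec p 0) as [->|]; [lia|]. specialize (L4 0 p ltac:(lia) ltac:(lia)). lia.
  - intros s1 F1 (j & p & I1 & I2 & I3 & I4 & I5 & I6 & I7 & I8). frs. split; [sfty|].
    assert (-2 <= (R - 1 - rg s1 r_a) / st) by (apply Z.div_le_lower_bound; lia). lia.
  - intros s1 F1 (j & p0 & I1 & I2 & I3 & I4 & I5 & I6 & I7 & I8) Hb. frs.
    rewrite E3 in Hb. set (a := rg s1 r_a) in *.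
    assert (Hst0 : 0 <= st * (2 * j)) by (apply Z.mul_nonneg_nonneg; lia).
    destruct (Hopt j I1 ltac:(nia)) as [(x0 & Hx0 & Eb0) Hb0].
    replace (2 * st * j) with (st * (2 * j)) in * by lia.
    set (b0 := row (st * (2 * j))) in *. specialize (I6 ltac:(nia)). fold b0 in I6.
    assert (Hp0x0 : p0 <= x0) by (apply Hinj; auto; lia).
    (* The right limit is either the maximum of the next even row or the last column; the rest of
       the iteration is proved once for both. *)
    assert (Hlim : forall lim pl, 0 <= pl < len -> lim = c pl -> b0 <= lim ->
      (st * (2 * j + 2) < R -> lim = row (st * (2 * j + 2))) ->
      (forall x, pl < x < len -> M a (c x) <= M a lim) ->
      wp B n (Asg r_best (a_col@[$r_p]) ;; Asg r_bv (entry ($r_a) ($r_best)) ;;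
       While (CLt (a_col@[$r_p]) ($r_lim))
       (Asg r_p ($r_p + #1) ;; Asg r_c (a_col@[$r_p]) ;;
        If (CLt (entry ($r_a) ($r_c)) ($r_bv)) Skip
           (Asg r_best ($r_c) ;; Asg r_bv (entry ($r_a) ($r_c)))) ;;
       Sto a_row ($r_a) ($r_best) ;; Asg r_a ($r_a + #2 * $r_stp)) (setr s1 r_lim lim)
       (fun s2 t => (exists j p, let row1 := ar s2 a_row in
      0 <= j /\ rg s2 r_a = st * (2 * j + 1) /\ rg s2 r_a < R + 2 * st
      /\ rg s2 r_p = base + p /\ 0 <= p < len
      /\ (st * (2 * j) < R -> c p <= row (st * (2 * j)))
      /\ (forall i, row1 (st * (2 * i)) = row (st * (2 * i)))
      /\ (forall i, 0 <= i < j -> st * (2 * i + 1) < R ->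
            row_opt row1 c len (st * (2 * i + 1))
            /\ row (st * (2 * i)) <= row1 (st * (2 * i + 1))
            /\ (st * (2 * i + 2) < R -> row1 (st * (2 * i + 1)) <= row (st * (2 * i + 2)))))
        /\ t + 1 + ((R - 1 - rg s2 r_a) / st + 3 + (base + len - rg s2 r_p))
           <= (R - 1 - a) / st + 3 + (base + len - rg s1 r_p))).
    { intros lim pl Hpl Elim Hb0lim Hlimrow Hlast.
      assert (Hx0pl : x0 <= pl) by (apply Hinj; auto; lia).
      assert (Hca : forall x, ar s a_col (base + x) = c x) by reflexivity.
      apply wp_asg_seq; [sfty; fold a; rewrite I4; lia|]. frs. rewrite I4, Hca.
      apply wp_asg_seq.
      { apply entry_safe; sfty; auto; try (repeat split; frs; auto; fail); try (fold a; lia); apply L3; lia. }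
      rewrite entry_ev by (repeat split; frs; auto). frs. fold a.
      apply wp_seq.
      eapply wp_while with
        (I := fun s2 => exists p pb, rg s2 r_p = base + p /\ p0 <= p <= pl
          /\ p0 <= pb <= p /\ rg s2 r_best = c pb /\ rg s2 r_bv = M a (c pb)
          /\ (forall x, p0 <= x <= p -> M a (c x) <= M a (c pb))
          /\ (forall x, pb < x <= p -> M a (c x) < M a (c pb)))
        (phi := fun s2 => base + pl - rg s2 r_p).
      - simp. exists p0, p0. repeat split; auto; try lia;
          intros x Hx; try (replace x with p0 by lia); lia.
      - intros s2 F2 (p & pb & J1 & J2 & J3 & J4 & J5 & J6 & J7). frs.
        split; [sfty|lia].
      - intros s2 F2 (p & pb & J1 & J2 & J3 & J4 & J5 & J6 & J7) Hb2. frs.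
        rewrite J1, Hca in Hb2.
        assert (p < pl). { destruct (Z_lt_le_dec p pl); auto.
          replace p with pl in Hb2 by lia. lia. }
        apply wp_asg_seq; [sfty; rewrite J1; lia|]. frs.
        apply wp_asg_seq; [sfty; rewrite J1; lia|]. frs.
        rewrite J1, <- Z.add_assoc, Hca.
        assert (Env2 : mat_env (setr (setr s2 r_p (base + (p + 1))) r_c (c (p + 1))))
          by (repeat split; frs; auto).
        apply wp_if.
        { split; [|sfty]. apply entry_safe; frs; auto; [fold a; lia|apply L3; lia]. }
        + intros Hc. cbn [tvp] in Hc. rewrite entry_ev in Hc by auto. frs. fold a in Hc.
          rewrite J5 in Hc. ws. split; [|lia]. exists (p + 1), pb.
          repeat split; auto; try lia.
          * intros x Hx. destruct (Z.eq_dec x (p + 1)) as [->|]; [lia|apply J6; lia].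
          * intros x Hx. destruct (Z.eq_dec x (p + 1)) as [->|]; [lia|apply J7; lia].
        + intros Hc. cbn [tvp] in Hc. rewrite entry_ev in Hc by auto. frs. fold a in Hc.
          rewrite J5 in Hc. ws.
          { apply entry_safe; frs; auto; [fold a; lia|apply L3; lia]. }
          rewrite entry_ev by auto. frs. fold a. split; [|lia]. exists (p + 1), (p + 1).
          repeat split; auto; try lia.
          intros x Hx. destruct (Z.eq_dec x (p + 1)) as [->|]; [lia|].
          specialize (J6 x ltac:(lia)). lia.
      - intros s2 t2 Ht2 F2 (p & pb & J1 & J2 & J3 & J4 & J5 & J6 & J7) Hb2 Ht2'. frs.
        rewrite J1, Hca in Hb2.
        assert (p = pl).
        { specialize (Hinj pl p ltac:(lia) ltac:(lia) ltac:(lia)). lia. }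
        subst p. rewrite J1, I4 in *.
        ws; fold a; rewrite ?Hst; try lia.
        (* A column left of the starting point loses to [b0] in the previous even row, hence also in
           this later row. A column right of the limit loses by [Hlast]. *)
        assert (Hx0b : forall b, 0 <= b < R -> M a b <= M a (c pb)).
        { intros b Hbr. destruct (Hdom (2 * j + 1) b ltac:(lia) ltac:(lia) Hbr) as (x & Hx & Hle).
          rewrite <- I2 in Hle.
          destruct (Z_lt_le_dec x p0) as [Hxp|Hxp].
          - pose proof (Hb0 (c x) (L3 x Hx)). specialize (J6 x0 ltac:(lia)).
            rewrite <- Eb0 in J6. fold b0 in J6.
            pose proof (Hquad (st * (2 * j)) a (c x) b0 ltac:(lia) Hb
              ltac:(split; [apply L3; lia | rewrite Eb0; apply Z.lt_le_incl, L4; lia])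
              ltac:(rewrite Eb0; apply L3; lia)). lia.
          - destruct (Z_le_gt_dec x pl).
            + specialize (J6 x ltac:(lia)). lia.
            + specialize (Hlast x ltac:(lia)). specialize (J6 pl ltac:(lia)).
              rewrite Elim in Hlast. lia. }
        (* A best column before [x0] would be strictly better than [b0] here, as ties go to the
           later column. By the Monge inequality it would then also be strictly better in the
           previous even row, where [b0] is a maximum. *)
        assert (Hpb0 : x0 <= pb).
        { destruct (Z_le_gt_dec x0 pb); auto. specialize (J7 x0 ltac:(lia)).
          pose proof (Hb0 (c pb) (L3 pb ltac:(lia))).
          rewrite <- Eb0 in J7. fold b0 in J7.
          pose proof (Hquad (st * (2 * j)) a (c pb) b0 ltac:(lia) Hb
            ltac:(split; [apply L3; lia | rewrite Eb0; apply Z.lt_le_incl, L4; lia])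
            ltac:(rewrite Eb0; apply L3; lia)). lia. }
        assert (Hcle : forall x y, 0 <= x <= y -> y < len -> c x <= c y).
        { intros x y Hxy Hy. destruct (Z.eq_dec x y) as [->|]; [lia|].
          apply Z.lt_le_incl, L4; lia. }
        split.
        + exists (j + 1), pl.
          split; [lia|]. split; [lia|]. split; [lia|]. split; [auto|]. split; [lia|].
          split; [|split].
          * intros Hlt. replace (2 * (j + 1)) with (2 * j + 2) in * by lia.
            rewrite <- Hlimrow by auto. lia.
          * intros i. destruct (Z.eqb_spec (st * (2 * i)) a) as [E|]; [|apply I7].
            exfalso. rewrite I2 in E. apply Z.mul_reg_l in E; lia.
          * intros i Hi HiR. unfold row_opt.
            destruct (Z.eqb_spec (st * (2 * i + 1)) a) as [E|E].
            -- assert (i = j) by (rewrite I2 in E; apply Z.mul_reg_l in E; lia). subst i.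
               rewrite J4, E. split; [split; auto|]. { exists pb. split; [lia|auto]. }
               split.
               { fold b0. rewrite Eb0. apply Hcle; lia. }
               intros Hlt. rewrite <- Hlimrow by auto. rewrite Elim. apply Hcle; lia.
            -- apply I8; auto. assert (i <> j) by (intros ->; lia). lia.
        + replace (R - 1 - (a + 2 * st)) with (R - 1 - a - 2 * st) by lia.
          rewrite Hdiv. lia. }
    apply wp_if_seq; [sfty; fold a; rewrite Hst; lia| |]; intros Hc; cbn [tvp ev op_val] in Hc;
      frs; fold a in Hc; rewrite Hst, E3 in Hc.
    + apply wp_asg_seq; [sfty; fold a; rewrite Hst; lia|]. frs. fold a. rewrite Hst.
      replace (a + st) with (st * (2 * (j + 1))) by lia. rewrite I7.
      destruct (Hopt (j + 1) ltac:(lia) ltac:(lia)) as [(pl & Hpl & El) Hol].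
      replace (2 * st * (j + 1)) with (st * (2 * (j + 1))) in * by lia.
      apply Hlim with pl; auto.
      * unfold b0. pose proof (Hmono j I1 ltac:(lia)) as Hmn.
        replace (2 * st * (j + 1)) with (st * (2 * (j + 1))) in Hmn by lia.
        replace (2 * st * j) with (st * (2 * j)) in Hmn by lia. auto.
      * intros _. do 2 f_equal. lia.
      * intros x Hx. pose proof (Hol (c x) (L3 x ltac:(lia))).
        rewrite El in *.
        pose proof (Hquad a (st * (2 * (j + 1))) (c pl) (c x) ltac:(lia) ltac:(lia)
          ltac:(split; [apply L3; lia | apply Z.lt_le_incl, L4; lia])
          ltac:(apply L3; lia)). lia.
    + apply wp_asg_seq; [sfty; lia|]. frs.
      replace (base + len - 1) with (base + (len - 1)) by lia.
      change (ar s a_col (base + (len - 1))) with (c (len - 1)).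
      apply Hlim with (len - 1); auto; try lia.
      rewrite Eb0. destruct (Z.eq_dec x0 (len - 1)) as [->|]; [lia|].
      apply Z.lt_le_incl, L4; lia.
  - intros s1 t1 Ht1 F1 (j & p & I1 & I2 & I3 & I4 & I5 & I6 & I7 & I8) Hb Ht1'. frs.
    rewrite E3 in Hb.
    assert (Hrow : forall i, 0 <= i -> st * i < R ->
      row_opt (ar s1 a_row) c len (st * i)
      /\ (st * (i + 1) < R -> ar s1 a_row (st * i) <= ar s1 a_row (st * (i + 1)))).
    { intros i Hi HiR. destruct (Z.Even_or_Odd i) as [(i' & ->)|(i' & ->)].
      - split.
        + unfold row_opt. rewrite I7. replace (st * (2 * i')) with (2 * st * i') by lia.
          apply Hopt; lia.
        + intros Hlt. rewrite I7. apply I8; try lia. split; [lia|].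
          rewrite I2 in Hb. nia.
      - assert (0 <= i' < j) by nia.
        destruct (I8 i' ltac:(lia) HiR) as (A1 & A2 & A3). split; auto.
        intros Hlt. replace (2 * i' + 1 + 1) with (2 * (i' + 1)) in * by lia.
        rewrite I7. replace (2 * (i' + 1)) with (2 * i' + 2) in * by lia. auto. }
    split; [|split].
    + intros i Hi HiR. apply Hrow; auto.
    + intros i Hi HiR. apply Hrow; auto. nia.
    + replace (R - 1 - st) with (R - 1 + (-1) * st) in Ht1' by lia.
      rewrite Z.div_add in Ht1' by lia.
      assert (-2 <= (R - 1 - rg s1 r_a) / st) by (apply Z.div_le_lower_bound; lia). lia.
Qed.

Definition levels (col len : Z -> Z) (lv : Z) : Prop :=
  (forall l, 0 <= l <= lv ->
     cols_ok (fun i => col (l * NN + i)) (len l) (2 ^ l)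
     /\ dominating (fun i => col (l * NN + i)) (len l) (2 ^ l))
  /\ (forall l, 0 <= l < lv -> 2 ^ l < R
     /\ forall i, 0 <= i < len (l + 1) ->
          exists j, 0 <= j < len l /\ col ((l + 1) * NN + i) = col (l * NN + j)).

Lemma smawk_spec s :
  mat_env s ->
  wp B n smawk s (fun s' t =>
    (forall a, 0 <= a < R -> 0 <= ar s' a_row a < R
       /\ forall b, 0 <= b < R -> M a b <= M a (ar s' a_row a))
    /\ t <= 40 * R).
Proof.
  intros Henv. assert (Henv' := Henv). destruct Henv' as (E1 & E2 & E3 & E4 & E5 & E6).
  assert (HB3 : NN * NN + 6 * NN + 9 <= B) by lia.
  assert (0 <= NN * NN) by nia.
  assert (Hpow : forall l, 0 <= l -> 1 <= 2 ^ l /\ l < 2 ^ l).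
  { intros l Hl. pose proof (Z.pow_gt_lin_r 2 l ltac:(lia) Hl). lia. }
  assert (Hhalf : forall l, 0 <= l -> (R - 1) / 2 ^ (l + 1) = (R - 1) / 2 ^ l / 2).
  { intros l Hl. rewrite Z.pow_add_r, Z.pow_1_r by lia.
    now rewrite <- Z.div_div by (destruct (Hpow l Hl); lia). }
  assert (Hy1 : forall l, 0 <= l -> 2 ^ l < R -> 1 <= (R - 1) / 2 ^ l).
  { intros l Hl Hlt. destruct (Hpow l Hl). apply Z.div_le_lower_bound; lia. }
  assert (Hy2 : forall y, 2 * (y / 2) <= y < 2 * (y / 2) + 2).
  { intros y. pose proof (Z.div_mod y 2 ltac:(lia)).
    pose proof (Z.mod_pos_bound y 2 ltac:(lia)). lia. }
  assert (Hlen : forall c len l, 0 <= l -> cols_ok c len (2 ^ l) ->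
    len <= (R - 1) / 2 ^ l + 1 /\ 1 <= len <= NN).
  { intros c len l Hl (L1 & L2 & _). destruct (Hpow l Hl).
    assert (len - 1 <= (R - 1) / 2 ^ l) by (apply Z.div_le_lower_bound; lia).
    assert ((R - 1) / 2 ^ l <= R - 1) by (apply Z.div_le_upper_bound; nia). lia. }
  unfold smawk. ws. apply wp_seq.
  eapply wp_while with
    (I := fun s1 => 0 <= rg s1 r_ci <= R
      /\ forall i, 0 <= i < rg s1 r_ci -> ar s1 a_col i = i)
    (phi := fun s1 => R - rg s1 r_ci).
  { simp. split; intros; lia. }
  { intros s1 F1 (I1 & I2). frs. split; [sfty|lia]. }
  { intros s1 F1 (I1 & I2) Hb. frs. rewrite E3 in Hb. ws. split; [|lia]. split; [lia|].
    intros i Hi. destruct (Z.eqb_spec i (rg s1 r_ci)); auto. apply I2. lia. }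
  intros s1 t1 Ht1 F1 (I1 & I2) Hb1 Ht1'. frs. rewrite E3 in *.
  assert (Eci : rg s1 r_ci = R) by lia. rewrite Eci in *.
  ws. rewrite E3. apply wp_seq.
  eapply wp_while with
    (I := fun s2 => 0 <= rg s2 r_lv /\ rg s2 r_stp = 2 ^ rg s2 r_lv
      /\ levels (ar s2 a_col) (ar s2 a_len) (rg s2 r_lv))
    (* Put [y = (R - 1) / 2 ^ lv], which is at least 1. A reduction with its test costs at most
       [3 (y + 1) + 2 <= 8 y], and [y] is then halved. *)
    (phi := fun s2 => 16 * ((R - 1) / rg s2 r_stp)).
  { frs. split; [lia|]. split; [reflexivity|]. split; [|intros; lia].
    intros l Hl. replace l with 0 by lia. cbn [Z.eqb].
    assert (Hid : forall i, 0 <= i < R -> ar s1 a_col (0 * NN + i) = i).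
    { intros i Hi. rewrite I2; lia. }
    split.
    - split; [lia|]. split; [cbn; lia|]. split.
      + intros i Hi. rewrite Hid; lia.
      + intros i j Hi Hj. rewrite !Hid; lia.
    - intros i b Hi HiR Hb. exists b. rewrite Hid by lia. split; lia. }
  { intros s2 F2 (J1 & J2 & J3). frs. split; [sfty|].
    destruct (Hpow _ J1). assert (0 <= (R - 1) / rg s2 r_stp) by (apply Z.div_pos; lia). lia. }
  { intros s2 F2 (J1 & J2 & J3) Hb2. frs. rewrite E3 in Hb2.
    set (lv := rg s2 r_lv) in *. rewrite J2 in Hb2.
    destruct (Hpow lv J1) as [Hp1 Hp2].
    assert (Hpow1 : 2 ^ (lv + 1) = 2 * 2 ^ lv) by (rewrite Z.pow_add_r; lia).
    apply wp_asg_seq; [sfty; rewrite J2; lia|]. frs. rewrite J2, <- Hpow1.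
    destruct (proj1 J3 lv ltac:(lia)) as [C1 C2].
    destruct (Hlen _ _ _ J1 C1) as [Hlen1 Hlen2].
    apply wp_seq. eapply wp_conseq.
    { eapply reduce_spec with (lv := lv) (st := 2 ^ (lv + 1)) (stp' := 2 ^ lv); frs; auto; try lia.
      - repeat split; frs; auto.
      - intros i b Hi HiR Hbr.
        destruct (C2 (2 * i) b ltac:(lia) ltac:(lia) Hbr) as (p & Hp & Hle).
        exists p. replace (2 ^ (lv + 1) * i) with (2 ^ lv * (2 * i)) by lia. auto. }
    cbv beta zeta. intros s3 t3 Ht3 F3 (K1 & K2 & K3 & K4 & K5). frs.
    ws; fold lv; try lia. fold lv. split.
    - split; [lia|]. split; [auto|]. split.
      + intros l Hl. destruct (Z.eqb_spec l (lv + 1)) as [->|].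
        * split; auto.
        * destruct (proj1 J3 l ltac:(lia)) as [D1 D2].
          destruct (Hlen _ _ l ltac:(lia) D1) as [_ Hl2].
          assert (Heq : forall i, 0 <= i < ar s2 a_len l ->
            ar s3 a_col (l * NN + i) = ar s2 a_col (l * NN + i)).
          { intros i Hi. apply K4. assert (l * NN <= lv * NN) by
              (apply Z.mul_le_mono_nonneg_r; lia). lia. }
          destruct D1 as (D3 & D4 & D5 & D6). split.
          -- split; [auto|]. split; [auto|]. split.
             ++ intros i Hi. rewrite Heq by lia. auto.
             ++ intros i j Hi Hj. rewrite !Heq by lia. auto.
          -- intros i b Hi HiR Hbr. destruct (D2 i b Hi HiR Hbr) as (p & Hp & Hle).
             exists p. rewrite Heq by lia. auto.
      + intros l Hl. destruct (Z.eq_dec l lv) as [->|].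
        * split; [auto|]. rewrite Z.eqb_refl.
          destruct (Z.eqb_spec lv (lv + 1)); [lia|].
          intros i Hi. destruct (K3 i Hi) as (j & Hj & E). exists j. split; auto.
          rewrite E. symmetry. apply K4. lia.
        * destruct (proj2 J3 l ltac:(lia)) as [D1 D2]. split; [auto|].
          destruct (Z.eqb_spec l (lv + 1)), (Z.eqb_spec (l + 1) (lv + 1)); try lia.
          intros i Hi. destruct (D2 i Hi) as (j & Hj & E). exists j. split; auto.
          destruct (Hlen _ _ l ltac:(lia) (proj1 (proj1 J3 l ltac:(lia)))) as [_ Hl1].
          destruct (Hlen _ _ (l + 1) ltac:(lia) (proj1 (proj1 J3 (l + 1) ltac:(lia)))) as [_ Hl2].
          assert ((l + 1) * NN <= lv * NN) by (apply Z.mul_le_mono_nonneg_r; lia).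
          rewrite !K4 by lia. auto.
    - rewrite ?J2. rewrite Hhalf by auto.
      specialize (Hy1 lv J1 Hb2). specialize (Hy2 ((R - 1) / 2 ^ lv)).
      cbv beta in K5. lia. }
  intros s2 t2 Ht2 F2 (J1 & J2 & J3) Hb2 Ht2'. frs. rewrite E3, J2 in *.
  set (lv0 := rg s2 r_lv) in *.
  assert (Hlv0 : lv0 <= NN).
  { destruct (Z.eq_dec lv0 0) as [->|]; [lia|].
    destruct (proj2 J3 (lv0 - 1) ltac:(lia)) as [D _].
    destruct (Hpow (lv0 - 1) ltac:(lia)). lia. }
  assert (HlvN : forall l, 0 <= l <= lv0 -> 0 <= l * NN <= NN * NN) by (intros; nia).
  destruct (proj1 J3 lv0 ltac:(lia)) as [C1 C2].
  (* At the top level row 0 is alone, so one column is left and it contains the maximum. *)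
  assert (Hlen1 : ar s2 a_len lv0 = 1).
  { destruct C1 as (D1 & D2 & _). destruct (Z.eq_dec (ar s2 a_len lv0) 1); auto.
    assert (1 * 2 ^ lv0 <= (ar s2 a_len lv0 - 1) * 2 ^ lv0)
      by (apply Z.mul_le_mono_nonneg_r; lia). lia. }
  pose proof (HlvN lv0 ltac:(lia)) as HlvN0.
  apply wp_sto_seq; [sfty; fold lv0; rewrite E4; lia|]. frs. fold lv0. rewrite E4.
  eapply wp_while with
    (I := fun s3 => let lv := rg s3 r_lv in
      0 <= lv <= lv0 /\ rg s3 r_stp = 2 ^ lv
      /\ (forall i, 0 <= i -> 2 ^ lv * i < R ->
            row_opt (ar s3 a_row) (fun i => ar s2 a_col (lv * NN + i)) (ar s2 a_len lv) (2 ^ lv * i))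
      /\ (forall i, 0 <= i -> 2 ^ lv * (i + 1) < R ->
            ar s3 a_row (2 ^ lv * i) <= ar s3 a_row (2 ^ lv * (i + 1))))
    (* The geometric sum run backwards: [(R - 1) / stp] grows back to [R - 1]. *)
    (phi := fun s3 => 20 * (R - 1 - (R - 1) / rg s3 r_stp)).
  { frs. fold lv0. split; [lia|]. split; [auto|].
    assert (Hi0 : forall i, 0 <= i -> 2 ^ lv0 * i < R -> i = 0).
    { intros i Hi HiR. destruct (Z.eq_dec i 0); auto.
      assert (2 ^ lv0 * 1 <= 2 ^ lv0 * i) by mulb. lia. }
    split.
    - intros i Hi HiR. rewrite (Hi0 i Hi HiR). unfold row_opt.
      replace (2 ^ lv0 * 0) with 0 by lia. rewrite Z.eqb_refl, Hlen1. split.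
      + exists 0. split; [lia|]. f_equal. lia.
      + intros b Hb. destruct (C2 0 b ltac:(lia) ltac:(lia) Hb) as (p & Hp & Hle).
        replace (2 ^ lv0 * 0) with 0 in Hle by lia. rewrite Hlen1 in Hp.
        replace (lv0 * NN) with (lv0 * NN + p) by lia. auto.
    - intros i Hi HiR. specialize (Hi0 (i + 1) ltac:(lia) HiR). lia. }
  { intros s3 F3 (K1 & K2 & K3 & K4). frs. split; [sfty|]. rewrite K2.
    destruct (Hpow _ (proj1 K1)).
    assert ((R - 1) / 2 ^ rg s3 r_lv <= R - 1) by (apply Z.div_le_upper_bound; nia). lia. }
  { intros s3 F3 (K1 & K2 & K3 & K4) Hb3. frs. set (lv := rg s3 r_lv) in *.
    destruct (proj1 J3 (lv - 1) ltac:(lia)) as [D1 D2].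
    destruct (proj2 J3 (lv - 1) ltac:(lia)) as [D3 D4].
    assert (Hpow1 : 2 ^ lv = 2 * 2 ^ (lv - 1)).
    { replace lv with (lv - 1 + 1) at 1 by lia. rewrite Z.pow_add_r; lia. }
    assert (Hdv : 2 ^ lv / 2 = 2 ^ (lv - 1)) by (symmetry; apply Z.div_unique_exact; lia).
    destruct (Hpow (lv - 1) ltac:(lia)) as [Hp1 Hp2].
    destruct (Hlen _ _ (lv - 1) ltac:(lia) D1) as [Hlen2 Hlen3].
    apply wp_asg_seq; [sfty; fold lv; lia|]. frs. fold lv.
    apply wp_asg_seq; [sfty; rewrite K2, Hdv; lia|]. frs. rewrite K2, Hdv.
    eapply wp_conseq.
    { eapply interpolate_spec with (lv := lv - 1) (st := 2 ^ (lv - 1)); frs; auto; try lia.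
      - repeat split; frs; auto.
      - intros i Hi HiR. rewrite <- Hpow1 in *.
        destruct (K3 i Hi HiR) as [(p & Hp & E) Ho]. split; [|auto].
        replace (lv - 1 + 1) with lv in D4 by lia.
        destruct (D4 p Hp) as (j & Hj & E'). exists j. split; auto. congruence.
      - intros i Hi HiR. rewrite <- Hpow1 in *. auto. }
    cbv beta zeta. intros s4 t4 Ht4 F4 (L1 & L2 & L3). frs. rewrite ?K2. split.
    - split; [lia|]. split; [auto|]. auto.
    - specialize (Hhalf (lv - 1) ltac:(lia)). replace (lv - 1 + 1) with lv in Hhalf by lia.
      rewrite Hhalf. specialize (Hy1 (lv - 1) ltac:(lia) D3).
      specialize (Hy2 ((R - 1) / 2 ^ (lv - 1))). cbv beta in L3. lia. }
  intros s3 t3 Ht3 F3 (K1 & K2 & K3 & K4) Hb3 Ht3'. frs. fold lv0 in Ht3'.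
  assert (Elv : rg s3 r_lv = 0) by lia. rewrite Elv in *.
  change (2 ^ 0) with 1 in *. split.
  - intros a Ha. destruct (K3 a ltac:(lia) ltac:(lia)) as [(p & Hp & E) Ho].
    replace (1 * a) with a in * by lia. split; auto.
    rewrite E. apply (proj1 J3 0 ltac:(lia)). auto.
  - rewrite K2 in Ht3'. rewrite Z.div_1_r in *.
    assert (0 <= (R - 1) / 2 ^ lv0) by (apply Z.div_pos; lia).
    replace (rg s2 r_stp) with (2 ^ lv0) in * by auto. lia.
Qed.

End Smawk.

(** * Proximity of optimal solutions to the greedy solution *)

Lemma pigeonhole (f : nat -> Z) (lo hi : Z) (N : nat) :
  (forall j, (j <= N)%nat -> lo < f j <= hi) -> hi - lo <= Z.of_nat N ->
  exists j j', (j < j' <= N)%nat /\ f j = f j'.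
Proof.
  intros Hf HN.
  assert (H : (exists j j', (j < j' <= N)%nat /\ f j = f j')
              \/ NoDup (map f (seq 0 (S N)))).
  { clear Hf HN. induction N as [|N IH].
    - right. cbn. constructor; [easy|constructor].
    - destruct IH as [(j & j' & Hj & E)|IH]; [left; exists j, j'; split; auto; lia|].
      rewrite seq_S, map_app. cbn [map plus].
      destruct (in_dec Z.eq_dec (f (S N)) (map f (seq 0 (S N)))) as [Hin|Hin].
      + left. apply in_map_iff in Hin as (j & E & Hj). apply in_seq in Hj.
        exists j, (S N). split; [lia|auto].
      + right. apply NoDup_app; auto.
        * constructor; [easy|constructor].
        * intros x Hx [<-|[]]. auto. }
  destruct H as [H|H]; auto. exfalso.
  apply NoDup_incl_length with
    (l' := map (fun k => lo + 1 + Z.of_nat k) (seq 0 (Z.to_nat (hi - lo)))) in H.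
  - rewrite !length_map, !length_seq in H. specialize (Hf O ltac:(lia)). lia.
  - intros x Hx. apply in_map_iff in Hx as (j & <- & Hj). apply in_seq in Hj.
    specialize (Hf j ltac:(lia)). apply in_map_iff.
    exists (Z.to_nat (f j - lo - 1)). split; [lia|]. apply in_seq. lia.
Qed.

Lemma sumz_change (f f' : Z -> Z) lo hi e :
  lo <= e < hi -> (forall i, lo <= i < hi -> i <> e -> f' i = f i) ->
  sumz f' lo hi = sumz f lo hi + (f' e - f e).
Proof.
  intros He H. rewrite !(sumz_split _ lo e hi), !(sumz_first _ e) by lia.
  rewrite (sumz_ext f' f lo e), (sumz_ext f' f (e + 1) hi) by (intros; apply H; lia).
  lia.
Qed.

(** [a] is a part of the change [b]: same direction and no larger. *)
Definition btw (a b : Z) : Prop := 0 <= a <= b \/ b <= a <= 0.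

Section Walk.

Variables (n s : Z) (S d : Z -> Z).
Hypothesis HS : forall i, 0 <= i < n -> 1 <= S i <= s.

(** If the partial sum is at most 0, take a unit that raises it, otherwise one that lowers it; this
    stays in the window. If no such unit is left, all remaining ones move the sum monotonically
    towards its final value, which lies in the window as well. *)
Lemma walk_step (e : Z -> Z) :
  (forall i, 0 <= i < n -> btw (e i) (d i)) ->
  - s < sumz (fun i => S i * d i) 0 n < s ->
  - s < sumz (fun i => S i * e i) 0 n <= s ->
  0 < sumz (fun i => Z.abs (d i - e i)) 0 n ->
  exists e', (forall i, 0 <= i < n -> btw (e i) (e' i) /\ btw (e' i) (d i))
    /\ - s < sumz (fun i => S i * e' i) 0 n <= s
    /\ sumz (fun i => Z.abs (d i - e' i)) 0 n = sumz (fun i => Z.abs (d i - e i)) 0 n - 1.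
Proof.
  intros Hb Hd He Hpos.
  assert (Hset : forall j u, 0 <= j < n ->
    sumz (fun i => S i * (if i =? j then e i + u else e i)) 0 n
      = sumz (fun i => S i * e i) 0 n + S j * u
    /\ sumz (fun i => Z.abs (d i - (if i =? j then e i + u else e i))) 0 n
      = sumz (fun i => Z.abs (d i - e i)) 0 n
        + (Z.abs (d j - (e j + u)) - Z.abs (d j - e j))).
  { intros j u Hj. split.
    - rewrite (sumz_change (fun i => S i * e i) _ 0 n j); auto.
      + rewrite Z.eqb_refl. lia.
      + intros i Hi Hne. now rewrite (proj2 (Z.eqb_neq _ _) Hne).
    - rewrite (sumz_change (fun i => Z.abs (d i - e i)) _ 0 n j); auto.
      + rewrite Z.eqb_refl. lia.
      + intros i Hi Hne. now rewrite (proj2 (Z.eqb_neq _ _) Hne). }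
  assert (Hup : forall j, 0 <= j < n -> e j < d j ->
    sumz (fun i => S i * e i) 0 n + S j <= s ->
    - s < sumz (fun i => S i * e i) 0 n + S j ->
    exists e', (forall i, 0 <= i < n -> btw (e i) (e' i) /\ btw (e' i) (d i))
    /\ - s < sumz (fun i => S i * e' i) 0 n <= s
    /\ sumz (fun i => Z.abs (d i - e' i)) 0 n = sumz (fun i => Z.abs (d i - e i)) 0 n - 1).
  { intros j Hj Hlt H1 H2. destruct (Hset j 1 Hj) as [E1 E2].
    exists (fun i => if i =? j then e i + 1 else e i). rewrite E1, E2.
    specialize (Hb j Hj) as Hbj. unfold btw in *. split; [|lia].
    intros i Hi. specialize (Hb i Hi). destruct (Z.eqb_spec i j); subst; lia. }
  assert (Hdn : forall j, 0 <= j < n -> d j < e j ->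
    sumz (fun i => S i * e i) 0 n - S j <= s ->
    - s < sumz (fun i => S i * e i) 0 n - S j ->
    exists e', (forall i, 0 <= i < n -> btw (e i) (e' i) /\ btw (e' i) (d i))
    /\ - s < sumz (fun i => S i * e' i) 0 n <= s
    /\ sumz (fun i => Z.abs (d i - e' i)) 0 n = sumz (fun i => Z.abs (d i - e i)) 0 n - 1).
  { intros j Hj Hlt H1 H2. destruct (Hset j (-1) Hj) as [E1 E2].
    exists (fun i => if i =? j then e i + -1 else e i). rewrite E1, E2.
    specialize (Hb j Hj) as Hbj. unfold btw in *. split; [|lia].
    intros i Hi. specialize (Hb i Hi). destruct (Z.eqb_spec i j); subst; lia. }
  assert (Hcase : forall f : Z -> Z, (exists j, 0 <= j < n /\ 0 < f j)
    \/ forall j, 0 <= j < n -> f j <= 0).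
  { intros f. destruct (Z_lt_le_dec 0 (sumz (fun i => Z.max 0 (f i)) 0 n)) as [H|H].
    - left. destruct (sumz_pos_ex _ _ _ H) as (j & Hj & Hp). exists j. split; auto; lia.
    - right. intros j Hj.
      pose proof (sumz_term (fun i => Z.max 0 (f i)) 0 n j ltac:(intros; lia) Hj). cbn in H0.
      lia. }
  destruct (Z_le_gt_dec (sumz (fun i => S i * e i) 0 n) 0) as [Hle|Hgt].
  - destruct (Hcase (fun i => d i - e i)) as [(j & Hj & Hlt)|Hall].
    + specialize (HS j Hj) as HSj. apply (Hup j); lia.
    + destruct (sumz_pos_ex _ _ _ Hpos) as (j & Hj & Hp).
      specialize (HS j Hj) as HSj. specialize (Hall j Hj) as Hallj.
      enough (-1 * sumz (fun i => S i * d i) 0 n >= -1 * (sumz (fun i => S i * e i) 0 n + S j * -1))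
        by (apply (Hdn j); lia).
      rewrite <- (proj1 (Hset j (-1) Hj)), <- !sumz_scal.
      apply Z.le_ge, sumz_le. intros i Hi. specialize (Hall i Hi). specialize (HS i Hi).
      destruct (Z.eqb_spec i j); subst; nia.
  - destruct (Hcase (fun i => e i - d i)) as [(j & Hj & Hlt)|Hall].
    + specialize (HS j Hj) as HSj. apply (Hdn j); lia.
    + destruct (sumz_pos_ex _ _ _ Hpos) as (j & Hj & Hp).
      specialize (HS j Hj) as HSj. specialize (Hall j Hj) as Hallj.
      enough (sumz (fun i => S i * e i) 0 n + S j * 1 <= sumz (fun i => S i * d i) 0 n)
        by (apply (Hup j); lia).
      rewrite <- (proj1 (Hset j 1 Hj)).
      apply sumz_le. intros i Hi. specialize (Hall i Hi). specialize (HS i Hi).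
      destruct (Z.eqb_spec i j); subst; nia.
Qed.

(** The walk is monotone in each coordinate, so that the difference of two of its points will again
    be a part of [d]. *)
Lemma walk (r : nat) : forall e : Z -> Z,
  (forall i, 0 <= i < n -> btw (e i) (d i)) ->
  - s < sumz (fun i => S i * d i) 0 n < s ->
  - s < sumz (fun i => S i * e i) 0 n <= s ->
  sumz (fun i => Z.abs (d i - e i)) 0 n = Z.of_nat r ->
  exists E : nat -> Z -> Z, E O = e
    /\ (forall j, (j <= r)%nat -> (forall i, 0 <= i < n -> btw (E j i) (d i))
          /\ - s < sumz (fun i => S i * E j i) 0 n <= s
          /\ sumz (fun i => Z.abs (d i - E j i)) 0 n = Z.of_nat (r - j))
    /\ (forall j j' i, (j <= j' <= r)%nat -> 0 <= i < n -> btw (E j i) (E j' i)).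
Proof.
  induction r as [|r IH]; intros e Hb Hd He Hr.
  - exists (fun _ => e). split; [auto|]. split.
    + intros j Hj. replace j with O by lia. auto.
    + intros j j' i _ Hi. specialize (Hb i Hi). unfold btw in *; lia.
  - destruct (walk_step e Hb Hd He ltac:(lia)) as (e' & B1 & B2 & B3).
    destruct (IH e') as (E & E0 & E1 & E2); auto; [intros; apply B1; auto|lia|].
    exists (fun j => match j with O => e | Datatypes.S j => E j end).
    split; [auto|]. split.
    + intros [|j] Hj; [auto|]. apply E1. lia.
    + intros [|j] [|j'] i Hj Hi; try lia.
      * specialize (Hb i Hi). unfold btw in *; lia.
      * destruct (B1 i Hi) as [B4 _]. pose proof (E2 O j' i ltac:(lia) Hi) as B5.
        rewrite E0 in B5. unfold btw in *; lia.
      * apply E2; auto; lia.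
Qed.

(* Partial sums of a walk from 0 to [d] stay in a window of [2s] values, so two of
   them coincide once the walk is long enough. *)
Lemma zero_sum_part :
  1 <= s -> - s < sumz (fun i => S i * d i) 0 n < s ->
  2 * s <= sumz (fun i => Z.abs (d i)) 0 n ->
  exists e, (forall i, 0 <= i < n -> btw (e i) (d i))
    /\ sumz (fun i => S i * e i) 0 n = 0
    /\ sumz (fun i => Z.abs (d i - e i)) 0 n < sumz (fun i => Z.abs (d i)) 0 n.
Proof.
  intros Hs Hd Hl.
  set (l := sumz (fun i => Z.abs (d i)) 0 n) in *.
  destruct (walk (Z.to_nat l) (fun _ => 0)) as (E & E0 & E1 & E2); auto.
  - intros i Hi. unfold btw. lia.
  - rewrite sumz_zero; intros; lia.
  - rewrite (sumz_ext _ (fun i => Z.abs (d i))) by (intros; f_equal; lia). fold l. lia.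
  - destruct (pigeonhole (fun j => sumz (fun i => S i * E j i) 0 n) (- s) s (Z.to_nat l))
      as (j & j' & Hj & Heq); [intros; apply E1; auto|lia|].
    exists (fun i => E j' i - E j i).
    destruct (E1 j ltac:(lia)) as (A1 & _ & A3), (E1 j' ltac:(lia)) as (B1 & _ & B3).
    split; [|split].
    + intros i Hi. specialize (A1 i Hi). specialize (B1 i Hi).
      specialize (E2 j j' i ltac:(lia) Hi). unfold btw in *. lia.
    + rewrite (sumz_ext _ (fun i => S i * E j' i + -1 * (S i * E j i)))
        by (intros; lia). rewrite sumz_add, sumz_scal. lia.
    + assert (H : sumz (fun i => Z.abs (d i - (E j' i - E j i))) 0 n
        = l + -1 * (sumz (fun i => Z.abs (d i - E j i)) 0 n
                    + -1 * sumz (fun i => Z.abs (d i - E j' i)) 0 n)).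
      { unfold l. rewrite <- !sumz_scal, <- sumz_add, <- !sumz_scal, <- sumz_add.
        apply sumz_ext. intros i Hi. specialize (A1 i Hi). specialize (B1 i Hi).
        specialize (E2 j j' i ltac:(lia) Hi). unfold btw in *. lia. }
      rewrite H, A3, B3. lia.
Qed.

End Walk.

(** Induction on the distance to the greedy solution [P]. The walk argument needs a total size
    change strictly between [- s] and [s]. It is below [s] because [P] leaves less than [s] of the
    capacity free. If it is at most [- s], some removed copy fits again and is put back. *)
Lemma proximity n s t xv xs (S V U P : Z -> Z) :
  1 <= s -> (forall i, 0 <= i < n -> 1 <= S i <= s /\ 0 <= V i /\ 0 <= P i <= U i) ->
  0 < xs ->
  (forall i, 0 <= i < n -> 0 < P i -> xv * S i <= V i * xs) ->
  (forall i, 0 <= i < n -> P i < U i -> V i * xs <= xv * S i) ->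
  sumz (fun i => S i * P i) 0 n <= t ->
  (t - sumz (fun i => S i * P i) 0 n < s \/ forall i, 0 <= i < n -> P i = U i) ->
  forall x, (forall i, 0 <= i < n -> 0 <= x i <= U i) ->
  sumz (fun i => S i * x i) 0 n <= t ->
  exists x', (forall i, 0 <= i < n -> 0 <= x' i <= U i)
    /\ sumz (fun i => S i * x' i) 0 n <= t
    /\ sumz (fun i => V i * x i) 0 n <= sumz (fun i => V i * x' i) 0 n
    /\ sumz (fun i => Z.abs (x' i - P i)) 0 n <= 2 * s.
Proof.
  intros Hs Hok Hxs Hth1 Hth2 HPt [Hrem|Hall].
  (* Values are nonnegative, so taking everything is optimal when it fits. *)
  2:{ intros x Hx Hxt. exists P. split; [apply Hok|]. split; [auto|]. split.
      - apply sumz_le. intros i Hi. specialize (Hx i Hi).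
        rewrite <- (Hall i Hi) in Hx. destruct (Hok i Hi) as (? & ? & ?). nia.
      - rewrite sumz_zero; intros; lia. }
  assert (Hind : forall (k : nat) x, sumz (fun i => Z.abs (x i - P i)) 0 n <= Z.of_nat k ->
    (forall i, 0 <= i < n -> 0 <= x i <= U i) -> sumz (fun i => S i * x i) 0 n <= t ->
    exists x', (forall i, 0 <= i < n -> 0 <= x' i <= U i)
    /\ sumz (fun i => S i * x' i) 0 n <= t
    /\ sumz (fun i => V i * x i) 0 n <= sumz (fun i => V i * x' i) 0 n
    /\ sumz (fun i => Z.abs (x' i - P i)) 0 n <= 2 * s).
  2:{ intros x Hx Hxt. apply (Hind (Z.to_nat (sumz (fun i => Z.abs (x i - P i)) 0 n))); auto.
      pose proof (sumz_nonneg (fun i => Z.abs (x i - P i)) 0 n ltac:(intros; lia)). lia. }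
  induction k as [|k IH]; intros x Hk Hx Hxt.
  { exists x. repeat split; auto; try apply Hx; auto; lia. }
  destruct (Z_le_gt_dec (sumz (fun i => Z.abs (x i - P i)) 0 n) (2 * s)) as [Hle|Hgt].
  { exists x. repeat split; auto; try apply Hx; auto; lia. }
  assert (HD : sumz (fun i => S i * (x i - P i)) 0 n
    = sumz (fun i => S i * x i) 0 n - sumz (fun i => S i * P i) 0 n).
  { rewrite (sumz_ext _ (fun i => S i * x i + -1 * (S i * P i))) by (intros; lia).
    rewrite sumz_add, sumz_scal. lia. }
  destruct (Z_le_gt_dec (sumz (fun i => S i * (x i - P i)) 0 n) (- s)) as [Hlow|Hlow].
  - (* There is room for one of the removed copies. *)
    assert (Hex : exists j, 0 <= j < n /\ x j < P j).
    { destruct (sumz_pos_ex (fun i => -1 * (S i * (x i - P i))) 0 n) as (j & Hj & Hp).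
      - rewrite sumz_scal. lia.
      - exists j. split; auto. destruct (Hok j Hj). nia. }
    destruct Hex as (j & Hj & Hlt). destruct (Hok j Hj) as (O1 & O2 & O3).
    set (x1 := fun i => if i =? j then x i + 1 else x i).
    assert (Hx1 : forall f : Z -> Z, sumz (fun i => f i * x1 i) 0 n
      = sumz (fun i => f i * x i) 0 n + f j).
    { intros f. rewrite (sumz_change (fun i => f i * x i) _ 0 n j); auto.
      - unfold x1. rewrite Z.eqb_refl. lia.
      - intros i Hi Hne. unfold x1. now rewrite (proj2 (Z.eqb_neq _ _) Hne). }
    destruct (IH x1) as (x' & X1 & X2 & X3 & X4).
    + rewrite (sumz_change (fun i => Z.abs (x i - P i)) _ 0 n j); auto.
      * unfold x1. rewrite Z.eqb_refl. lia.
      * intros i Hi Hne. unfold x1. now rewrite (proj2 (Z.eqb_neq _ _) Hne).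
    + intros i Hi. unfold x1. specialize (Hx i Hi).
      destruct (Z.eqb_spec i j); subst; lia.
    + rewrite Hx1. lia.
    + exists x'. repeat split; auto; try apply X1; auto. rewrite Hx1 in X3. lia.
  - destruct (zero_sum_part n s S (fun i => x i - P i)) as (e & B1 & B2 & B3); auto; try lia.
    { intros i Hi. apply Hok; auto. }
    destruct (IH (fun i => x i - e i)) as (x' & X1 & X2 & X3 & X4).
    + rewrite (sumz_ext _ (fun i => Z.abs (x i - P i - e i))) by (intros; f_equal; lia). lia.
    + intros i Hi. specialize (B1 i Hi). specialize (Hx i Hi).
      destruct (Hok i Hi) as (? & ? & ?). unfold btw in B1. lia.
    + rewrite (sumz_ext _ (fun i => S i * x i + -1 * (S i * e i))) by (intros; lia).
      rewrite sumz_add, sumz_scal. lia.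
    + exists x'. repeat split; auto; try apply X1; auto. etransitivity; [|exact X3].
      rewrite (sumz_ext (fun i => V i * (x i - e i)) (fun i => V i * x i + -1 * (V i * e i)))
        by (intros; lia).
      rewrite sumz_add, sumz_scal.
      (* Removed copies have ratio at least [xv / xs] and added ones at most that. So [xs] times the
         value of [e] is at most [xv] times its size, which is 0. *)
      enough (xs * sumz (fun i => V i * e i) 0 n <= 0) by nia.
      transitivity (xv * sumz (fun i => S i * e i) 0 n); [|rewrite B2; lia].
      rewrite <- !sumz_scal. apply sumz_le. intros i Hi.
      specialize (B1 i Hi). specialize (Hx i Hi). specialize (Hth1 i Hi). specialize (Hth2 i Hi).
      destruct (Hok i Hi) as (? & ? & ?). unfold btw in B1.
      destruct (Z.lt_trichotomy (e i) 0) as [He|[He|He]].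
      * specialize (Hth1 ltac:(lia)). nia.
      * rewrite He. lia.
      * specialize (Hth2 ltac:(lia)). nia.
Qed.

(** * The dynamic program *)

(* Step [2 (k - 1)] adds copies of items of size [k], step [2 (k - 1) + 1]
   removes such copies. *)
Definition q_size (q : Z) : Z := q / 2 + 1.
Definition q_par (q : Z) : Z := q - 2 * (q / 2).
Definition q_sign (q : Z) : Z := 1 - 2 * q_par q.

Lemma q_par_range q : 0 <= q_par q <= 1.
Proof.
  unfold q_par. pose proof (Z.div_mod q 2 ltac:(lia)).
  pose proof (Z.mod_pos_bound q 2 ltac:(lia)). lia.
Qed.

Lemma q_even c : q_size (2 * c) = c + 1 /\ q_par (2 * c) = 0.
Proof.
  unfold q_size, q_par. rewrite (Z.mul_comm 2 c), Z.div_mul by lia. lia.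
Qed.

Lemma q_odd c : q_size (2 * c + 1) = c + 1 /\ q_par (2 * c + 1) = 1.
Proof.
  unfold q_size, q_par. replace (2 * c + 1) with (1 + c * 2) by lia.
  rewrite Z.div_add by lia. change (1 / 2) with 0. lia.
Qed.

(** The share of step [q] in a solution that adds [A i] and removes [R i] copies of item [i]. *)
Definition pick (q : Z) (S : Z -> Z) (A R : Z -> Z) (i : Z) : Z :=
  if S i =? q_size q then (if q_par q =? 0 then A i else R i) else 0.

Lemma sumz_pairs f c : 0 <= c ->
  sumz f 0 (2 * c) = sumz (fun j => f (2 * j) + f (2 * j + 1)) 0 c.
Proof.
  revert c. apply (interval_ind 0 (fun c => _)).
  - now rewrite !sumz_empty by lia.
  - intros c Hc IH. replace (2 * (c + 1)) with (2 * c + 1 + 1) by lia.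
    rewrite !sumz_last by lia. lia.
Qed.

(** Item [i] is served by exactly two steps, [2 (S i - 1)] and its successor. *)
Lemma sum_steps n s (S A R : Z -> Z) :
  (forall i, 0 <= i < n -> 1 <= S i <= s) -> 0 <= s ->
  sumz (fun q => sumz (pick q S A R) 0 n) 0 (2 * s) = sumz (fun i => A i + R i) 0 n.
Proof.
  intros HS Hs.
  transitivity (sumz (fun q => sumz (fun i => pick q S A R i) 0 n) 0 (2 * s)); [auto|].
  rewrite sumz_exchange. apply sumz_ext. intros i Hi. specialize (HS i Hi).
  rewrite sumz_pairs by lia.
  rewrite (sumz_single _ 0 s (S i - 1)) by
    (lia || (intros j Hj Hne; unfold pick; destruct (q_even j) as [-> ->], (q_odd j) as [-> ->];
       destruct (Z.eqb_spec (S i) (j + 1)); lia)).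
  unfold pick. destruct (q_even (S i - 1)) as [-> ->], (q_odd (S i - 1)) as [-> ->].
  replace (S i - 1 + 1) with (S i) by lia. rewrite Z.eqb_refl. auto.
Qed.

Definition step_w (U P : Z -> Z) (q i : Z) : Z :=
  if q_par q =? 0 then U i - P i else P i.

(* [Fq d] is the best gain of step [q] when it changes the number of copies by
   [d]; [li] lists the items whose copies are changed, the best ones first.
   Changes that are impossible are penalized by [BIG]. *)
Definition step_ok (n D NN vm BIG : Z) (S V U P : Z -> Z) (q : Z) (Fq li : Z -> Z) : Prop :=
  Fq 0 = 0
  /\ (forall d, - NN < d < NN -> Fq d <= D * vm)
  /\ (forall d, - NN < d < NN -> D * vm - BIG < Fq d ->
        let c := q_sign q * d in
        0 <= c <= D
        /\ Fq d = sumz (fun x => q_sign q * V (li x)) 0 c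
        /\ (forall x, 0 <= x < c -> 0 <= li x < n /\ S (li x) = q_size q)
        /\ (forall i, 0 <= i < n ->
              sumz (fun x => if li x =? i then 1 else 0) 0 c <= step_w U P q i))
  /\ (forall y, (forall i, 0 <= i < n ->
          0 <= y i <= (if S i =? q_size q then step_w U P q i else 0)) ->
        sumz y 0 n <= D ->
        sumz (fun i => q_sign q * V i * y i) 0 n <= Fq (q_sign q * sumz y 0 n)).

(** A max-plus convolution along shifts by multiples of [k]; [arg] records a maximizer for
    backtracking. *)
Definition dp_ok (NN k : Z) (Fq ga gb arg : Z -> Z) : Prop :=
  forall i, 0 <= i < NN ->
    0 <= i - k * arg i < NN
    /\ gb i = ga (i - k * arg i) + Fq (arg i)
    /\ forall d, 0 <= i - k * d < NN -> ga (i - k * d) + Fq d <= gb i.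

(** [gs q] is the table before step [q]; position [L + d] stands for a size change by [d]. [Fs] and
    [gs] are ghosts: memory keeps only the current table, and per step the list of copies (stride
    [D]) and the maximizers (stride [NN]). *)
Definition dp_inv (n D L NN vm BIG : Z) (S V U P : Z -> Z) (Q : Z)
    (Fs gs : Z -> Z -> Z) (LI ARG g : Z -> Z) : Prop :=
  (forall i, 0 <= i < NN -> gs 0 i = if i =? L then 0 else - BIG)
  /\ (forall i, 0 <= i < NN -> gs Q i = g i)
  /\ (forall q, 0 <= q < Q ->
        step_ok n D NN vm BIG S V U P q (Fs q) (fun j => LI (q * D + j))
        /\ dp_ok NN (q_size q) (Fs q) (gs q) (gs (q + 1)) (fun i => ARG (q * NN + i))).

Lemma q_size_pos q : 0 <= q -> 1 <= q_size q.
Proof. intros. unfold q_size. pose proof (Z.div_pos q 2). lia. Qed.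

Lemma q_sign_cases q : q_sign q = 1 /\ q_par q = 0 \/ q_sign q = -1 /\ q_par q = 1.
Proof. unfold q_sign. pose proof (q_par_range q). lia. Qed.

Lemma shift_range NN k i d :
  1 <= k -> 0 <= i < NN -> 0 <= i - k * d < NN -> - NN < d < NN.
Proof. nia. Qed.

(** Changing nothing is always possible at gain 0, so values never fall below the initial [- BIG]; a
    step gains at most [D * vm]. *)
Lemma dp_bounds n D L NN vm BIG S V U P Q Fs gs LI ARG g :
  dp_inv n D L NN vm BIG S V U P Q Fs gs LI ARG g -> 0 <= BIG -> 0 <= D * vm ->
  forall q, 0 <= q <= Q -> forall i, 0 <= i < NN -> - BIG <= gs q i <= q * (D * vm).
Proof.
  intros (H0 & HQ & Hst) HBIG HDv q Hq.
  destruct Hq as [Hq1 Hq2]. revert q Hq1 Hq2.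
  apply (interval_ind 0 (fun q => q <= Q ->
    forall i, 0 <= i < NN -> - BIG <= gs q i <= q * (D * vm))).
  - intros _ i Hi. rewrite H0 by auto. destruct (i =? L); lia.
  - intros q Hq IH HqQ i Hi.
    destruct (Hst q ltac:(lia)) as [(F0 & F1 & _) Hdp].
    destruct (Hdp i Hi) as (D1 & D2 & D3).
    pose proof (q_size_pos q Hq) as Hk.
    split.
    + specialize (D3 0 ltac:(lia)). rewrite F0 in D3.
      replace (i - q_size q * 0) with i in D3 by lia.
      specialize (IH ltac:(lia) i Hi). lia.
    + rewrite D2. specialize (IH ltac:(lia) _ D1).
      specialize (F1 _ (shift_range _ _ _ _ Hk Hi D1)). lia.
Qed.

(** Follow [x] through the tables. No intermediate size change leaves the window, because even the
    sum of the absolute size changes is at most [s] times [2 s], which is [L]. *)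
Lemma dp_complete n s vm BIG (S V U P : Z -> Z) Fs gs LI ARG g x :
  let D := 2 * s in let L := 2 * s * s in let NN := 2 * L + 1 in
  0 <= s ->
  (forall i, 0 <= i < n -> 1 <= S i <= s) ->
  (forall i, 0 <= i < n -> 0 <= P i <= U i) ->
  (forall i, 0 <= i < n -> 0 <= x i <= U i) ->
  sumz (fun i => Z.abs (x i - P i)) 0 n <= 2 * s ->
  dp_inv n D L NN vm BIG S V U P (2 * s) Fs gs LI ARG g ->
  let d := sumz (fun i => S i * (x i - P i)) 0 n in
  0 <= L + d < NN /\ sumz (fun i => V i * (x i - P i)) 0 n <= g (L + d).
Proof.
  intros D L NN Hs HS HP Hx Hl1 (H0 & HQ & Hst) d.
  set (A := fun i => Z.max 0 (x i - P i)). set (R := fun i => Z.max 0 (P i - x i)).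
  set (j := fun q => sumz (pick q S A R) 0 n).
  set (idx := fun Q => L + sumz (fun q => q_sign q * q_size q * j q) 0 Q).
  set (val := fun Q => sumz (fun q => sumz (fun i => q_sign q * V i * pick q S A R i) 0 n) 0 Q).
  assert (Hj0 : forall q, 0 <= j q <= 2 * s).
  { intros q. unfold j. split.
    - apply sumz_nonneg. intros i Hi. unfold pick, A, R.
      destruct (S i =? q_size q); [|lia]. destruct (q_par q =? 0); lia.
    - etransitivity; [|exact Hl1]. apply sumz_le. intros i Hi. unfold pick, A, R.
      destruct (S i =? q_size q); [|lia]. destruct (q_par q =? 0); lia. }
  assert (Hsj : forall q, q_size q * j q
    = sumz (pick q S (fun i => S i * A i) (fun i => S i * R i)) 0 n).
  { intros q. unfold j. rewrite <- sumz_scal. apply sumz_ext. intros i Hi. unfold pick.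
    destruct (Z.eqb_spec (S i) (q_size q)) as [<-|]; [|lia]. destruct (q_par q =? 0); lia. }
  assert (Htot : sumz (fun q => q_size q * j q) 0 (2 * s) <= L).
  { rewrite (sumz_ext _ _ _ _ (fun q _ => Hsj q)), sum_steps by auto.
    transitivity (s * sumz (fun i => Z.abs (x i - P i)) 0 n); [|unfold L; nia].
    rewrite <- sumz_scal. apply sumz_le. intros i Hi. specialize (HS i Hi).
    unfold A, R. nia. }
  assert (Hidx : forall Q, 0 <= Q <= 2 * s -> 0 <= idx Q < NN).
  { intros Q HQ'. unfold idx.
    rewrite (sumz_split _ 0 Q) in Htot by lia.
    assert (0 <= sumz (fun q => q_size q * j q) Q (2 * s)).
    { apply sumz_nonneg. intros q Hq. pose proof (q_size_pos q). pose proof (Hj0 q). nia. }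
    assert (sumz (fun q => q_sign q * q_size q * j q) 0 Q
      <= sumz (fun q => q_size q * j q) 0 Q).
    { apply sumz_le. intros q Hq. pose proof (q_size_pos q). pose proof (Hj0 q).
      destruct (q_sign_cases q) as [[-> _]|[-> _]]; nia. }
    assert (-1 * sumz (fun q => q_size q * j q) 0 Q
      <= sumz (fun q => q_sign q * q_size q * j q) 0 Q).
    { rewrite <- sumz_scal. apply sumz_le. intros q Hq.
      pose proof (q_size_pos q). pose proof (Hj0 q).
      destruct (q_sign_cases q) as [[-> _]|[-> _]]; nia. }
    unfold NN. lia. }
  assert (Hmain : forall Q, 0 <= Q -> Q <= 2 * s -> val Q <= gs Q (idx Q)).
  { apply (interval_ind 0 (fun Q => Q <= 2 * s -> val Q <= gs Q (idx Q))).
    - intros _. unfold val, idx. rewrite !sumz_empty by lia.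
      assert (0 <= L) by (unfold L; nia).
      rewrite H0 by (unfold NN; lia). replace (L + 0) with L by lia.
      rewrite Z.eqb_refl. lia.
    - intros Q HQ0 IH HQ1. specialize (IH ltac:(lia)).
      pose proof (Hidx Q ltac:(lia)) as I1. pose proof (Hidx (Q + 1) ltac:(lia)) as I2.
      destruct (Hst Q ltac:(lia)) as [(_ & _ & _ & Hc) Hdp].
      destruct (Hdp (idx (Q + 1)) I2) as (_ & _ & Hopt).
      assert (E : idx (Q + 1) - q_size Q * (q_sign Q * j Q) = idx Q).
      { unfold idx. rewrite sumz_last by lia. lia. }
      specialize (Hopt (q_sign Q * j Q)). rewrite E in Hopt. specialize (Hopt I1).
      unfold val. rewrite sumz_last by lia. fold (val Q).
      specialize (Hc (pick Q S A R)). fold (j Q) in Hc.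
      enough (sumz (fun i => q_sign Q * V i * pick Q S A R i) 0 n <= Fs Q (q_sign Q * j Q))
        by lia.
      apply Hc; [|apply Hj0]. intros i Hi. unfold pick, step_w, A, R.
      specialize (HP i Hi). specialize (Hx i Hi).
      destruct (S i =? q_size Q); [|lia]. destruct (q_par Q =? 0); lia. }
  specialize (Hmain (2 * s) ltac:(lia) ltac:(lia)).
  assert (Ed : idx (2 * s) = L + d).
  { unfold idx, d. f_equal.
    rewrite (sumz_ext _ (fun q => sumz (pick q S (fun i => S i * A i)
      (fun i => - (S i * R i))) 0 n)).
    - rewrite sum_steps by auto. apply sumz_ext. intros i Hi.
      replace (x i - P i) with (A i - R i) by (unfold A, R; lia). lia.
    - intros q Hq. rewrite <- Z.mul_assoc, Hsj, <- sumz_scal. apply sumz_ext. intros i Hi.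
      unfold pick. destruct (S i =? q_size q); [|lia].
      destruct (q_sign_cases q) as [[-> ->]|[-> ->]]; cbn [Z.eqb]; lia. }
  assert (Ev : val (2 * s) = sumz (fun i => V i * (x i - P i)) 0 n).
  { unfold val.
    rewrite (sumz_ext _ (fun q => sumz (pick q S (fun i => V i * A i)
      (fun i => - (V i * R i))) 0 n)).
    - rewrite sum_steps by auto. apply sumz_ext. intros i Hi.
      replace (x i - P i) with (A i - R i) by (unfold A, R; lia). lia.
    - intros q Hq. apply sumz_ext. intros i Hi.
      unfold pick. destruct (S i =? q_size q); [|lia].
      destruct (q_sign_cases q) as [[-> ->]|[-> ->]]; cbn [Z.eqb]; lia. }
  specialize (Hidx (2 * s) ltac:(lia)). rewrite Ed in *. split; auto.
  rewrite <- Ev, <- HQ; auto.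
Qed.

(* The [j] best copies: compare with the gain of the last one of them. *)
Lemma best_copies (kv kw Y y : Z -> Z) (occ : Z -> Z) m cnt D :
  (forall f, sumz (fun i => f (Y i)) 0 cnt = sumz (fun e => occ e * f e) 0 m) ->
  (forall e, 0 <= e < m -> 0 <= occ e <= kw e) ->
  (forall i j, 0 <= i < j -> j < cnt -> kv (Y j) <= kv (Y i)) ->
  0 <= cnt ->
  ((forall e, 0 <= e < m -> occ e = kw e)
   \/ (cnt = D /\ forall e i, 0 <= e < m -> 0 <= i < cnt -> occ e < kw e -> kv e <= kv (Y i))) ->
  (forall e, 0 <= e < m -> 0 <= y e <= kw e) -> 0 <= m ->
  sumz y 0 m <= D ->
  sumz y 0 m <= cnt
  /\ sumz (fun e => kv e * y e) 0 m <= sumz (fun i => kv (Y i)) 0 (sumz y 0 m).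
Proof.
  intros Hocc Hokw Hsort Hcnt0 Htop Hy Hm HD.
  set (j := sumz y 0 m) in *.
  assert (Hj0 : 0 <= j) by (apply sumz_nonneg; intros; apply Hy; auto).
  assert (Hjc : j <= cnt).
  { destruct Htop as [Hall|[-> _]]; auto.
    specialize (Hocc (fun _ => 1)). cbv beta in Hocc. rewrite sumz_const in Hocc by auto.
    replace cnt with (1 * (cnt - 0)) by lia. rewrite Hocc. apply sumz_le. intros e He.
    rewrite Hall by auto. specialize (Hy e He). lia. }
  split; auto.
  destruct (Z.eq_dec j 0) as [Ej|Ej].
  - rewrite Ej, (sumz_empty (fun i => kv (Y i)) 0 0) by lia.
    rewrite sumz_zero; [lia|]. intros e He.
    pose proof (sumz_term y 0 m e ltac:(intros; apply Hy; auto) He) as Ht. fold j in Ht.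
    specialize (Hy e He). replace (y e) with 0 by lia. lia.
  - set (l := kv (Y (j - 1))).
    assert (Hocc' : forall e, 0 <= e < m -> l < kv e -> occ e = kw e).
    { intros e He Hlt. destruct Htop as [Hall|[_ Hle]]; auto.
      specialize (Hokw e He). destruct (Z.eq_dec (occ e) (kw e)); auto.
      specialize (Hle e (j - 1) He ltac:(lia) ltac:(lia)). fold l in Hle. lia. }
    (* Each copy gains at most [l] plus its excess over [l], and elements with positive excess are
       listed with all their copies. *)
    transitivity (l * j + sumz (fun e => occ e * Z.max 0 (kv e - l)) 0 m).
    + unfold j. rewrite <- sumz_scal, <- sumz_add. apply sumz_le. intros e He.
      specialize (Hy e He). specialize (Hokw e He).
      destruct (Z_lt_le_dec l (kv e)) as [Hlt|Hge].
      * rewrite Hocc' by auto. rewrite Z.max_r by lia. nia.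
      * rewrite Z.max_l by lia. nia.
    + rewrite <- (Hocc (fun e => Z.max 0 (kv e - l))).
      rewrite (sumz_split _ 0 j cnt) by lia.
      (* By the sorting, entries from position [j] on have no excess over [l]. *)
      rewrite (sumz_zero _ j cnt).
      * replace (l * j) with (sumz (fun _ => l) 0 j) by (rewrite sumz_const; lia).
        rewrite Z.add_0_r, <- sumz_add. apply sumz_le. intros i Hi.
        destruct (Z.eq_dec i (j - 1)) as [->|]; [fold l; lia|].
        specialize (Hsort i (j - 1) ltac:(lia) ltac:(lia)). fold l in Hsort. lia.
      * intros i Hi. specialize (Hsort (j - 1) i ltac:(lia) ltac:(lia)). fold l in Hsort. lia.
Qed.

(** * Reading the input and the greedy solution *)

Notation r_q := 52%nat.   Notation r_par := 53%nat.  Notation r_sg := 54%nat.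
Notation r_j := 55%nat.   Notation r_e := 56%nat.    Notation r_cnt := 57%nat.
Notation r_cc := 58%nat.  Notation r_d := 59%nat.    Notation r_ge := 60%nat.
Notation r_b := 61%nat.   Notation r_bi := 62%nat.   Notation r_gb := 63%nat.
Notation r_dl := 64%nat.

(* Items of size [k] form a linked list with head [hd k]; entries are shifted by
   one since 0 ends the list. *)
Definition load : cmd :=
  Asg r_i (#0) ;;
  While (CLt ($r_i) ($r_n))
    (Asg r_e (a_in@[#3 * $r_i]) ;; Asg r_x1 (a_in@[#3 * $r_i + #1]) ;;
     Asg r_x2 (a_in@[#3 * $r_i + #2]) ;;
     If (CLt ($r_x1) (#1)) (Asg r_x1 (#0) ;; Asg r_x2 (#0)) Skip ;;
     Sto a_S ($r_i) ($r_e) ;; Sto a_V ($r_i) ($r_x1) ;; Sto a_U ($r_i) ($r_x2) ;;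
     Sto a_kV ($r_i) ($r_x1) ;; Sto a_kS ($r_i) ($r_e) ;;
     Sto a_kW ($r_i) ($r_e * $r_x2) ;;
     Sto a_nx ($r_i) (a_hd@[$r_e]) ;; Sto a_hd ($r_e) ($r_i + #1) ;;
     Asg r_i ($r_i + #1)) ;;
  Asg r_i (#0) ;; Asg r_s (#1) ;; Asg r_vm (#0) ;;
  While (CLt ($r_i) ($r_n))
    (If (CLt ($r_s) (a_S@[$r_i])) (Asg r_s (a_S@[$r_i])) Skip ;;
     If (CLt ($r_vm) (a_V@[$r_i])) (Asg r_vm (a_V@[$r_i])) Skip ;;
     Asg r_i ($r_i + #1)).

Fixpoint chain (nx : Z -> Z) (h : Z) (l : list Z) : Prop :=
  match l with
  | [] => h = 0
  | x :: l => 0 <= x /\ h = x + 1 /\ chain nx (nx x) l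
  end.

Definition lsum (f : Z -> Z) (l : list Z) : Z := fold_right (fun x a => f x + a) 0 l.

Lemma chain_ext nx nx' l : forall h,
  (forall x, In x l -> nx' x = nx x) -> chain nx h l -> chain nx' h l.
Proof.
  induction l as [|x l IH]; cbn; intros h He Hc; auto.
  destruct Hc as (H1 & H2 & H3). repeat split; auto. rewrite He by auto.
  apply IH; auto.
Qed.

(** The equation for all [f] says that the list runs through the items of size [k], each exactly
    once. *)
Definition bucket (n : Z) (S nx hd : Z -> Z) (k : Z) : Prop :=
  exists l, chain nx (hd k) l /\ (forall x, In x l -> 0 <= x < n /\ S x = k)
    /\ forall f, lsum f l = sumz (fun i => if S i =? k then f i else 0) 0 n.

(** Items of value below 1 become items of value 0 and multiplicity 0, since the proximity argument
    needs nonnegative values. [r_s] starts at 1, which keeps the tables nonempty when there are no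
    items. *)
Lemma load_spec B n s X sz vl mu :
  rg s r_n = n -> 0 <= n <= X ->
  (forall i, 0 <= i < n -> ar s a_in (3 * i) = sz i /\ ar s a_in (3 * i + 1) = vl i
     /\ ar s a_in (3 * i + 2) = mu i /\ 1 <= sz i <= X /\ Z.abs (vl i) <= X /\ 1 <= mu i <= X) ->
  (forall k, ar s a_hd k = 0) -> 3 * X + X * X + 10 <= B ->
  let V i := if vl i <? 1 then 0 else vl i in
  let U i := if vl i <? 1 then 0 else mu i in
  wp B n load s (fun s' t =>
    (forall i, 0 <= i < n -> ar s' a_S i = sz i /\ ar s' a_V i = V i /\ ar s' a_U i = U i
       /\ ar s' a_kV i = V i /\ ar s' a_kS i = sz i /\ ar s' a_kW i = sz i * U i)
    /\ (1 <= rg s' r_s /\ (rg s' r_s = 1 \/ exists i, 0 <= i < n /\ rg s' r_s = sz i))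
    /\ (0 <= rg s' r_vm /\ (rg s' r_vm = 0 \/ exists i, 0 <= i < n /\ rg s' r_vm = V i))
    /\ (forall i, 0 <= i < n -> sz i <= rg s' r_s /\ V i <= rg s' r_vm)
    /\ (forall k, bucket n sz (ar s' a_nx) (ar s' a_hd) k)
    /\ t <= 2 * n + 2).
Proof.
  intros Hn HnX Hin Hhd HB V U.
  assert (HV : forall i, 0 <= i < n -> 0 <= V i <= X /\ 0 <= U i <= X).
  { intros i Hi. destruct (Hin i Hi) as (_ & _ & _ & ? & ? & ?). unfold V, U.
    destruct (Z.ltb_spec (vl i) 1); lia. }
  assert (HXX : 0 <= X * X) by nia.
  unfold load. ws. apply wp_seq.
  eapply wp_while with
    (I := fun s1 => 0 <= rg s1 r_i <= n
      /\ (forall i, 0 <= i < rg s1 r_i -> ar s1 a_S i = sz i /\ ar s1 a_V i = V i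
           /\ ar s1 a_U i = U i /\ ar s1 a_kV i = V i /\ ar s1 a_kS i = sz i
           /\ ar s1 a_kW i = sz i * U i)
      /\ (forall k, bucket (rg s1 r_i) sz (ar s1 a_nx) (ar s1 a_hd) k))
    (phi := fun s1 => n - rg s1 r_i).
  - simp. split; [lia|]. split; [intros; lia|]. intros k. exists []. cbn [chain lsum fold_right].
    split; [auto|]. split; [easy|]. intros f. now rewrite sumz_empty by lia.
  - intros s1 F1 (I1 & I2 & I3). frs. split; [sfty|lia].
  - intros s1 F1 (I1 & I2 & I3) Hb. frs. rewrite Hn in Hb.
    set (i := rg s1 r_i) in *.
    destruct (Hin i ltac:(lia)) as (R1 & R2 & R3 & R4 & R5 & R6).
    destruct (HV i ltac:(lia)) as [V1 V2].
    assert (Hbk : forall k, bucket (i + 1) sz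
      (fun j => if j =? i then ar s1 a_hd (sz i) else ar s1 a_nx j)
      (fun j => if j =? sz i then i + 1 else ar s1 a_hd j) k).
    { intros k. destruct (Z.eqb_spec k (sz i)) as [->|Hne].
      - destruct (I3 (sz i)) as (l & L1 & L2 & L3). exists (i :: l).
        rewrite Z.eqb_refl. split; [|split].
        + cbn [chain]. rewrite Z.eqb_refl. split; [lia|]. split; [auto|].
          apply chain_ext with (ar s1 a_nx); auto. intros x Hx. specialize (L2 x Hx).
          destruct (Z.eqb_spec x i); [lia|auto].
        + intros x [<-|Hx]; [split; [lia|auto]|]. specialize (L2 x Hx). lia.
        + intros f. rewrite sumz_last by lia. rewrite Z.eqb_refl. cbn [lsum fold_right].
          fold (lsum f l). rewrite L3. lia.
      - destruct (I3 k) as (l & L1 & L2 & L3). exists l.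
        rewrite (proj2 (Z.eqb_neq _ _) Hne). split; [|split].
        + apply chain_ext with (ar s1 a_nx); auto. intros x Hx. specialize (L2 x Hx).
          destruct (Z.eqb_spec x i); [lia|auto].
        + intros x Hx. specialize (L2 x Hx). lia.
        + intros f. rewrite sumz_last by lia.
          destruct (Z.eqb_spec (sz i) k); [lia|]. rewrite L3. lia. }
    assert (Hfin : forall vv uu nn hh, vv = V i -> uu = U i ->
      nn = ar s1 a_hd (sz i) -> hh = sz i ->
      (0 <= i + 1 <= n
       /\ (forall i0, 0 <= i0 < i + 1 ->
           (if i0 =? i then hh else ar s1 a_S i0) = sz i0
           /\ (if i0 =? i then vv else ar s1 a_V i0) = V i0
           /\ (if i0 =? i then uu else ar s1 a_U i0) = U i0
           /\ (if i0 =? i then vv else ar s1 a_kV i0) = V i0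
           /\ (if i0 =? i then hh else ar s1 a_kS i0) = sz i0
           /\ (if i0 =? i then hh * uu else ar s1 a_kW i0) = sz i0 * U i0))).
    { intros vv uu nn hh -> -> -> ->. split; [lia|]. intros j Hj.
      destruct (Z.eqb_spec j i) as [->|]; [repeat split; auto|]. apply I2. lia. }
    assert (Hsu : 0 <= sz i * U i <= X * X) by nia.
    ws; fold_all i; rewrite ?R1, ?R2, ?R3 in *; try lia; try nia.
    + assert (HVi : V i = 0) by (unfold V; destruct (Z.ltb_spec (vl i) 1); lia).
      assert (HUi : U i = 0) by (unfold U; destruct (Z.ltb_spec (vl i) 1); lia).
      split; [|lia].
      destruct (Hfin 0 0 _ _ (eq_sym HVi) (eq_sym HUi) eq_refl eq_refl).
      split; [auto|split; auto].
    + assert (HVi : V i = vl i) by (unfold V; destruct (Z.ltb_spec (vl i) 1); lia).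
      assert (HUi : U i = mu i) by (unfold U; destruct (Z.ltb_spec (vl i) 1); lia).
      split; [|lia].
      destruct (Hfin _ _ _ _ (eq_sym HVi) (eq_sym HUi) eq_refl eq_refl).
      split; [auto|split; auto].
  - intros s1 t1 Ht1 F1 (I1 & I2 & I3) Hb1 Ht1'. frs. rewrite Hn in *.
    assert (Ei : rg s1 r_i = n) by lia. rewrite Ei in *. ws.
    eapply wp_while with
      (I := fun s2 => 0 <= rg s2 r_i <= n
        /\ (1 <= rg s2 r_s /\ (rg s2 r_s = 1 \/ exists i, 0 <= i < n /\ rg s2 r_s = sz i))
        /\ (0 <= rg s2 r_vm /\ (rg s2 r_vm = 0 \/ exists i, 0 <= i < n /\ rg s2 r_vm = V i))
        /\ (forall i, 0 <= i < rg s2 r_i -> sz i <= rg s2 r_s /\ V i <= rg s2 r_vm))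
      (phi := fun s2 => n - rg s2 r_i).
    + simp. repeat split; auto; try lia.
    + intros s2 F2 (J1 & J2 & J3 & J4). frs. split; [sfty|lia].
    + intros s2 F2 (J1 & J2 & J3 & J4) Hb2. frs. rewrite Hn in Hb2.
      set (i := rg s2 r_i) in *. destruct (I2 i ltac:(lia)) as (A1 & A2 & _).
      destruct (Hin i ltac:(lia)) as (_ & _ & _ & R4 & _).
      destruct (HV i ltac:(lia)) as [V1 V2].
      assert (HJ : forall a b, rg s2 r_s <= a -> sz i <= a -> rg s2 r_vm <= b -> V i <= b ->
        forall j, 0 <= j < i + 1 -> sz j <= a /\ V j <= b).
      { intros a b H1 H2 H3 H4 j Hj. destruct (Z.eq_dec j i) as [->|]; auto.
        specialize (J4 j ltac:(lia)). lia. }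
      ws; fold_all i; rewrite ?A1, ?A2 in *; try lia;
        (split; [|lia]); (split; [lia|]);
        (split; [split; [lia|]|]); try (right; exists i; split; [lia|auto]; fail); try tauto;
        (split; [split; [lia|]|]); try (right; exists i; split; [lia|auto]; fail); try tauto;
        apply HJ; lia.
    + intros s2 t2 Ht2 F2 (J1 & J2 & J3 & J4) Hb2 Ht2'. frs. rewrite Hn in *.
      assert (Ei2 : rg s2 r_i = n) by lia. rewrite Ei2 in *.
      split; [auto|]. split; [auto|]. split; [auto|]. split; [auto|]. split; [auto|lia].
Qed.

(** Items strictly above the threshold are taken completely. A tie receives as many copies as fit,
    so if it stays incomplete, less than its size is left of the capacity. *)
Definition greedy : cmd :=
  Asg r_m0 ($r_n) ;; Asg r_cap ($r_t) ;; select ;;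
  Asg r_rem ($r_t) ;; Asg r_i (#0) ;;
  While (CLt ($r_i) ($r_n))
    (Asg r_x1 (a_V@[$r_i] * $r_xs) ;; Asg r_x2 ($r_xv * a_S@[$r_i]) ;;
     If (CLt ($r_x2) ($r_x1))
        (Sto a_P ($r_i) (a_U@[$r_i]) ;; Asg r_rem ($r_rem - a_S@[$r_i] * a_U@[$r_i]))
        (Sto a_P ($r_i) (#0)) ;;
     Asg r_i ($r_i + #1)) ;;
  Asg r_i (#0) ;;
  While (CLt ($r_i) ($r_n))
    (Asg r_x1 (a_V@[$r_i] * $r_xs) ;; Asg r_x2 ($r_xv * a_S@[$r_i]) ;;
     If (CAnd (CLt ($r_x1) ($r_x2 + #1)) (CLt ($r_x2) ($r_x1 + #1)))
        (Asg r_j ($r_rem / a_S@[$r_i]) ;;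
         If (CLt (a_U@[$r_i]) ($r_j)) (Asg r_j (a_U@[$r_i])) Skip ;;
         Sto a_P ($r_i) ($r_j) ;; Asg r_rem ($r_rem - a_S@[$r_i] * $r_j)) Skip ;;
     Asg r_i ($r_i + #1)).

Definition greedy_post (n t sm : Z) (S V U P : Z -> Z) (rem : Z) : Prop :=
  (forall i, 0 <= i < n -> 0 <= P i <= U i)
  /\ rem = t - sumz (fun i => S i * P i) 0 n /\ 0 <= rem
  /\ (exists xv xs, 0 < xs
       /\ (forall i, 0 <= i < n -> 0 < P i -> xv * S i <= V i * xs)
       /\ (forall i, 0 <= i < n -> P i < U i -> V i * xs <= xv * S i))
  /\ (rem < sm \/ forall i, 0 <= i < n -> P i = U i).

Lemma greedy_spec B n s t vm sm (S V U : Z -> Z) :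
  rg s r_n = n -> rg s r_t = t -> rg s r_vm = vm -> 0 <= n -> 0 <= t ->
  ar s a_S = S -> ar s a_V = V -> ar s a_U = U ->
  (forall i, 0 <= i < n -> 1 <= S i <= sm /\ 0 <= V i <= vm /\ 0 <= U i
     /\ ar s a_kV i = V i /\ ar s a_kS i = S i /\ ar s a_kW i = S i * U i) ->
  8 * n <= B -> 200 <= B -> t <= B -> 1 <= sm -> 0 <= vm -> (vm + 1) * sm + 1 <= B ->
  sumz (fun i => S i * U i) 0 n <= B -> (forall i, 0 <= i < n -> U i <= B) ->
  wp B n greedy s (fun s' tm =>
    greedy_post n t sm S V U (ar s' a_P) (rg s' r_rem) /\ tm <= 4003 * n + 5).
Proof.
  intros Hn Ht Hvm Hn0 Ht0 HS HV HU Hin HnB HB HtB Hsm Hvm0 HvB HwB HUB.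
  set (kv := ar s a_kV) in *. set (ks := ar s a_kS) in *. set (kw := ar s a_kW) in *.
  assert (HSU : forall i, 0 <= i < n -> 0 <= S i * U i <= B).
  { intros i Hi. split; [destruct (Hin i Hi) as (? & ? & ? & _); nia|].
    etransitivity; [|exact HwB]. apply (sumz_term (fun i => S i * U i)); auto.
    intros j Hj. destruct (Hin j Hj) as (? & ? & ? & _). nia. }
  assert (HmulB : forall v x, Z.abs v <= vm + 1 -> 0 <= x <= sm -> Z.abs (v * x) + 1 <= B).
  { intros v x Hv Hx. rewrite Z.abs_mul, (Z.abs_eq x) by lia.
    assert (Z.abs v * x <= (vm + 1) * sm) by (apply Z.mul_le_mono_nonneg; lia). lia. }
  assert (Hk : keys_ok B kv ks n).
  { split; [lia|]. intros e He. destruct (Hin e He) as (I1 & I2 & I3 & I4 & I5 & I6).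
    rewrite I5. split; [lia|]. intros f Hf. destruct (Hin f Hf) as (J1 & J2 & J3 & J4 & J5 & J6).
    rewrite I4, J5. pose proof (HmulB (V e) (S f)). lia. }
  unfold greedy. ws. rewrite Hn, Ht. apply wp_seq. eapply wp_conseq.
  { eapply select_spec with (m0 := n) (cap := t) (kv := kv) (ks := ks) (kw := kw) (vm := vm);
      frs; auto; try lia.
    - intros e He. destruct (Hin e He) as (I1 & I2 & I3 & I4 & I5 & I6). rewrite I4. lia.
    - nia.
    - intros e He. destruct (Hin e He) as (I1 & I2 & I3 & I4 & I5 & I6). rewrite I6.
      apply HSU; auto.
    - rewrite (sumz_ext _ (fun i => S i * U i)); auto. intros e He. apply Hin; auto. }
  cbv beta. intros s1 t1 Ht1 F1 (P1 & P2 & P3).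
  set (xv := rg s1 r_xv) in *. set (xs := rg s1 r_xs) in *.
  set (gt e := xv * S e <? V e * xs).
  assert (Hxv : Z.abs xv <= vm + 1 /\ 1 <= xs <= sm).
  { destruct P2 as [(x & Hx & -> & ->)|[-> ->]]; [|lia].
    destruct (Hin x Hx) as (I1 & I2 & I3 & I4 & I5 & I6). rewrite I4, I5. lia. }
  destruct P1 as (Q1 & Q2 & Q3).
  assert (HWG : sumz (fun e => if gt e then S e * U e else 0) 0 n <= t).
  { rewrite (sumz_ext _ (fun e => if xv * ks e <? kv e * xs then kw e else 0)); auto.
    intros e He. destruct (Hin e He) as (_ & _ & _ & -> & -> & ->). auto. }
  assert (Hpart : forall i, 0 <= i <= n ->
    0 <= sumz (fun e => if gt e then S e * U e else 0) 0 i <= t).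
  { intros i Hi. assert (Hnn : forall e, 0 <= e < n -> 0 <= if gt e then S e * U e else 0).
    { intros e He. specialize (HSU e He). destruct (gt e); lia. }
    split; [apply sumz_nonneg; intros; apply Hnn; lia|].
    rewrite (sumz_split _ 0 i) in HWG by lia.
    assert (0 <= sumz (fun e => if gt e then S e * U e else 0) i n)
      by (apply sumz_nonneg; intros; apply Hnn; lia). lia. }
  ws. rewrite Ht. apply wp_seq.
  eapply wp_while with
    (I := fun s2 => 0 <= rg s2 r_i <= n
      /\ rg s2 r_rem = t - sumz (fun e => if gt e then S e * U e else 0) 0 (rg s2 r_i)
      /\ (forall e, 0 <= e < rg s2 r_i -> ar s2 a_P e = if gt e then U e else 0))
    (phi := fun s2 => n - rg s2 r_i).
  - simp. rewrite sumz_empty by lia. repeat split; intros; lia.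
  - intros s2 F2 (I1 & I2 & I3). frs. split; [sfty|lia].
  - intros s2 F2 (I1 & I2 & I3) Hb. frs. rewrite Hn in Hb. set (i := rg s2 r_i) in *.
    destruct (Hin i ltac:(lia)) as (A1 & A2 & A3 & _).
    pose proof (HmulB xv (S i)) as M1. pose proof (HmulB (V i) xs) as M2.
    pose proof (HSU i ltac:(lia)) as M3.
    pose proof (Hpart i ltac:(lia)) as M4. pose proof (Hpart (i + 1) ltac:(lia)) as M5.
    rewrite sumz_last in M5 by lia.
    assert (Hg : gt i = (xv * S i <? V i * xs)) by reflexivity.
    ws; fold_all i; fold_all xv; fold_all xs; rewrite ?HS, ?HV, ?HU in *; try lia.
    + rewrite (proj2 (Z.ltb_lt _ _) H) in Hg. rewrite Hg in M5.
      rewrite sumz_last, Hg by lia. split; [|lia]. split; [lia|]. split; [lia|].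
      intros e He. destruct (Z.eqb_spec e i) as [->|]; [now rewrite Hg|]. apply I3. lia.
    + rewrite (proj2 (Z.ltb_ge _ _)) in Hg by lia.
      rewrite sumz_last, Hg by lia. split; [|lia]. split; [lia|]. split; [lia|].
      intros e He. destruct (Z.eqb_spec e i) as [->|]; [now rewrite Hg|]. apply I3. lia.
  - intros s2 t2 Ht2 F2 (I1 & I2 & I3) Hb Ht2'. frs. rewrite Hn in *.
    assert (Ei : rg s2 r_i = n) by lia. rewrite Ei in *. ws.
    eapply wp_while with
      (I := fun s3 => let i := rg s3 r_i in let P := ar s3 a_P in
        0 <= i <= n
        /\ (forall e, i <= e < n -> P e = if gt e then U e else 0)
        /\ (forall e, 0 <= e < n -> 0 <= P e <= U e)
        /\ (forall e, 0 <= e < n -> xv * S e < V e * xs -> P e = U e)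
        /\ (forall e, 0 <= e < n -> V e * xs < xv * S e -> P e = 0)
        /\ rg s3 r_rem = t - sumz (fun e => S e * P e) 0 n /\ 0 <= rg s3 r_rem
        /\ (rg s3 r_rem < sm \/ forall e, 0 <= e < i -> xv * S e = V e * xs -> P e = U e))
      (phi := fun s3 => n - rg s3 r_i).
    + frs. split; [lia|]. split; [intros; apply I3; lia|].
      assert (HU0 : forall e, 0 <= e < n -> 0 <= U e) by (intros e He; apply Hin; auto).
      split; [intros e He; rewrite I3 by lia; specialize (HU0 e He); destruct (gt e); lia|].
      split; [intros e He Hlt; rewrite I3 by lia; unfold gt;
              now rewrite (proj2 (Z.ltb_lt _ _) Hlt)|].
      split; [intros e He Hlt; rewrite I3 by lia; unfold gt;
              now rewrite (proj2 (Z.ltb_ge _ _)) by lia|].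
      split; [|split; [specialize (Hpart n); lia|right; intros; lia]].
      rewrite I2. f_equal. apply sumz_ext. intros e He. rewrite I3 by lia.
      destruct (gt e); lia.
    + intros s3 F3 (J1 & J). frs. split; [sfty|lia].
    + intros s3 F3 (J1 & J2 & J3 & J4 & J5 & J6 & J7 & J8) Hb3. frs. rewrite Hn in Hb3.
      set (i := rg s3 r_i) in *. set (P := ar s3 a_P) in *. set (rem := rg s3 r_rem) in *.
      destruct (Hin i ltac:(lia)) as (A1 & A2 & A3 & _).
      pose proof (HmulB xv (S i)) as M1. pose proof (HmulB (V i) xs) as M2.
      pose proof (HUB i ltac:(lia)) as M3. pose proof (HSU i ltac:(lia)) as M4.
      pose proof (Z.div_mod rem (S i) ltac:(lia)) as Dm.
      pose proof (Z.mod_pos_bound rem (S i) ltac:(lia)) as Mb.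
      assert (Hdq : 0 <= rem / S i) by (apply Z.div_pos; lia).
      assert (HremB : rem <= t).
      { rewrite J6. assert (0 <= sumz (fun e => S e * P e) 0 n); [|lia].
        apply sumz_nonneg. intros e He. specialize (J3 e He).
        destruct (Hin e He) as (? & _). nia. }
      assert (Mj : forall j, 0 <= j <= rem / S i -> 0 <= S i * j <= rem).
      { intros j Hj. assert (S i * j <= S i * (rem / S i))
          by (apply Z.mul_le_mono_nonneg_l; lia).
        assert (0 <= S i * j) by (apply Z.mul_nonneg_nonneg; lia). lia. }
      assert (Hdr : rem / S i <= rem).
      { assert (1 * (rem / S i) <= S i * (rem / S i))
          by (apply Z.mul_le_mono_nonneg_r; lia). lia. }
      pose proof (Mj (U i)) as Mu. pose proof (Mj (rem / S i)) as Mr.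
      assert (Hfin : forall j, 0 <= j <= U i -> 0 <= S i * j <= rem -> xv * S i = V i * xs ->
        (j = U i \/ rem - S i * j < sm) ->
        0 <= i + 1 <= n
        /\ (forall e, i + 1 <= e < n -> (if e =? i then j else P e) = if gt e then U e else 0)
        /\ (forall e, 0 <= e < n -> 0 <= (if e =? i then j else P e) <= U e)
        /\ (forall e, 0 <= e < n -> xv * S e < V e * xs -> (if e =? i then j else P e) = U e)
        /\ (forall e, 0 <= e < n -> V e * xs < xv * S e -> (if e =? i then j else P e) = 0)
        /\ rem - S i * j = t - sumz (fun e => S e * (if e =? i then j else P e)) 0 n
        /\ 0 <= rem - S i * j
        /\ (rem - S i * j < sm \/
            forall e, 0 <= e < i + 1 -> xv * S e = V e * xs -> (if e =? i then j else P e) = U e)).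
      { intros j Hj Hr Heq Hor.
        assert (HPi : P i = 0).
        { rewrite J2 by lia. unfold gt. now rewrite (proj2 (Z.ltb_ge _ _)) by lia. }
        split; [lia|].
        split; [intros e He; destruct (Z.eqb_spec e i); [lia|apply J2; lia]|].
        split; [intros e He; destruct (Z.eqb_spec e i) as [->|]; auto|].
        split; [intros e He Hlt; destruct (Z.eqb_spec e i) as [->|]; [lia|auto]|].
        split; [intros e He Hlt; destruct (Z.eqb_spec e i) as [->|]; [lia|auto]|].
        split.
        { rewrite (sumz_change (fun e => S e * P e) _ 0 n i); try lia.
          - rewrite Z.eqb_refl, HPi. lia.
          - intros e He Hne. now rewrite (proj2 (Z.eqb_neq _ _) Hne). }
        split; [lia|].
        destruct Hor as [->|Hor]; [|lia]. destruct J8 as [J8|J8]; [left; lia|right].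
        intros e He Hq. destruct (Z.eqb_spec e i) as [->|]; auto. apply J8; auto; lia. }
      ws; fold_all i; fold_all xv; fold_all xs; fold_all rem; rewrite ?HS, ?HV, ?HU in *;
        try lia.
      * split; [|lia]. apply Hfin; lia.
      * split; [|lia]. apply Hfin; lia.
      * split; [|lia]. split; [lia|]. split; [intros; apply J2; lia|].
        do 3 (split; [auto|]). split; [auto|]. split; [auto|].
        destruct J8 as [J8|J8]; [auto|right]. intros e He Hq.
        destruct (Z.eq_dec e i) as [->|]; [lia|apply J8; auto; lia].
    + intros s3 t3 Ht3 F3 (J1 & J2 & J3 & J4 & J5 & J6 & J7 & J8) Hb3 Ht3'. frs.
      rewrite Hn in *. assert (Ei3 : rg s3 r_i = n) by lia. rewrite Ei3 in *.
      split; [|lia]. split; [auto|]. split; [auto|]. split; [auto|]. split.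
      * exists xv, xs. split; [auto|]. split; intros e He Hlt.
        -- destruct (Z_le_gt_dec (xv * S e) (V e * xs)); auto.
           rewrite J5 in Hlt by lia. lia.
        -- destruct (Z_le_gt_dec (V e * xs) (xv * S e)); auto.
           rewrite J4 in Hlt by lia. lia.
      (* If all ties were taken completely, the greedy solution would have exactly the total size
         that selection proved to exceed [t]. So only the case remains where everything lies
         strictly above the threshold. *)
      * destruct J8 as [J8|J8]; [auto|right]. destruct Q3 as [Q3|Q3].
        -- exfalso. enough (sumz (fun e => S e * ar s3 a_P e) 0 n
             = sumz (fun e => if xv * ks e <=? kv e * xs then kw e else 0) 0 n) by lia.
           apply sumz_ext. intros e He. destruct (Hin e He) as (_ & _ & _ & -> & -> & ->).
           destruct (Z.leb_spec (xv * S e) (V e * xs)) as [L|L].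
           ++ destruct (Z.eq_dec (xv * S e) (V e * xs)).
              ** rewrite J8; auto.
              ** rewrite J4; auto. lia.
           ++ rewrite J5; auto. lia.
        -- intros e He. apply J4; auto. specialize (Q3 e He).
           destruct (Hin e He) as (_ & _ & _ & E1 & E2 & _). rewrite E1, E2 in Q3. auto.
Qed.

(** * The best copies of one size *)

(** Within one size the ratio order is the value order, so all keys get denominator 1. The sign
    makes the cheapest copies the best ones to remove. Weights count copies, so that selection with
    capacity [D] finds the best [D] copies. *)
Definition collect : cmd :=
  Asg r_m0 (#0) ;; Asg r_j (a_hd@[$r_k]) ;;
  While (CLt (#0) ($r_j))
    (Asg r_e ($r_j - #1) ;; Sto a_kV ($r_m0) ($r_sg * a_V@[$r_e]) ;; Sto a_kS ($r_m0) (#1) ;;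
     If (CLt ($r_par) (#1)) (Asg r_x1 (a_U@[$r_e] - a_P@[$r_e])) (Asg r_x1 (a_P@[$r_e])) ;;
     Sto a_kW ($r_m0) ($r_x1) ;; Sto a_kI ($r_m0) ($r_e) ;;
     Asg r_m0 ($r_m0 + #1) ;; Asg r_j (a_nx@[$r_e])).

Definition class_keys (n : Z) (S V U P : Z -> Z) (q m : Z) (kv ks kw ki : Z -> Z) : Prop :=
  0 <= m
  /\ (forall f, sumz (fun e => f (ki e)) 0 m
        = sumz (fun i => if S i =? q_size q then f i else 0) 0 n)
  /\ (forall e, 0 <= e < m -> 0 <= ki e < n /\ S (ki e) = q_size q
        /\ kv e = q_sign q * V (ki e) /\ ks e = 1 /\ kw e = step_w U P q (ki e)).

Definition class_size (n : Z) (S : Z -> Z) (k : Z) : Z :=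
  sumz (fun i => if S i =? k then 1 else 0) 0 n.

Lemma class_keys_size n S V U P q m kv ks kw ki :
  class_keys n S V U P q m kv ks kw ki -> m = class_size n S (q_size q).
Proof.
  intros (H1 & H2 & _). specialize (H2 (fun _ => 1)). cbv beta in H2.
  rewrite sumz_const in H2 by auto. unfold class_size. lia.
Qed.

Lemma class_size_le n S k : 0 <= n -> 0 <= class_size n S k <= n.
Proof.
  intros Hn. unfold class_size. split.
  - apply sumz_nonneg. intros; destruct (_ =? _); lia.
  - transitivity (sumz (fun _ => 1) 0 n); [|rewrite sumz_const; lia].
    apply sumz_le. intros; destruct (_ =? _); lia.
Qed.

Lemma lsum_nonneg_const l : 0 <= lsum (fun _ => 1) l.
Proof. induction l; cbn [lsum fold_right]; [lia|]. fold (lsum (fun _ => 1) l). lia. Qed.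

Lemma collect_spec B n s q vm (S V U P : Z -> Z) :
  rg s r_k = q_size q -> rg s r_par = q_par q -> rg s r_sg = q_sign q ->
  0 <= q_size q <= B -> 0 <= n -> n + 1 <= B -> 0 <= vm <= B ->
  ar s a_S = S -> ar s a_V = V -> ar s a_U = U -> ar s a_P = P ->
  bucket n S (ar s a_nx) (ar s a_hd) (q_size q) ->
  (forall i, 0 <= i < n -> 0 <= V i <= vm /\ 0 <= P i <= U i /\ U i <= B) ->
  wp B n collect s (fun s' t =>
    class_keys n S V U P q (rg s' r_m0) (ar s' a_kV) (ar s' a_kS) (ar s' a_kW) (ar s' a_kI)
    /\ t <= class_size n S (q_size q) + 1).
Proof.
  intros Hk Hpar Hsg HkB Hn HnB HvB HS HV HU HP (l & L1 & L2 & L3) Hin.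
  unfold collect. ws; rewrite ?Hk; try lia.
  set (nx := ar s a_nx) in *.
  eapply wp_while with
    (I := fun s1 => let m := rg s1 r_m0 in
      0 <= m
      /\ (exists l2, chain nx (rg s1 r_j) l2 /\ (forall x, In x l2 -> In x l)
           /\ forall f, sumz (fun e => f (ar s1 a_kI e)) 0 m + lsum f l2
                = sumz (fun i => if S i =? q_size q then f i else 0) 0 n)
      /\ (forall e, 0 <= e < m -> 0 <= ar s1 a_kI e < n /\ S (ar s1 a_kI e) = q_size q
           /\ ar s1 a_kV e = q_sign q * V (ar s1 a_kI e) /\ ar s1 a_kS e = 1
           /\ ar s1 a_kW e = step_w U P q (ar s1 a_kI e)))
    (phi := fun s1 => class_size n S (q_size q) - rg s1 r_m0).
  - simp. split; [lia|]. split; [|intros; lia]. exists l. split; [auto|]. split; [auto|].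
    intros f. rewrite sumz_empty, <- L3; lia.
  - intros s1 F1 (I1 & (l2 & I2 & I3 & I4) & I5). frs. split; [sfty|].
    specialize (I4 (fun _ => 1)). cbv beta in I4. rewrite sumz_const in I4 by auto.
    pose proof (lsum_nonneg_const l2). unfold class_size. lia.
  - intros s1 F1 (I1 & (l2 & I2 & I3 & I4) & I5) Hb. frs.
    set (m := rg s1 r_m0) in *. set (j := rg s1 r_j) in *.
    destruct l2 as [|x l2]; cbn [chain] in I2; [lia|].
    destruct I2 as (X1 & X2 & X3).
    destruct (L2 x (I3 x (or_introl eq_refl))) as [X4 X5].
    assert (Hm : m + 1 <= n).
    { specialize (I4 (fun _ => 1)). cbv beta in I4. rewrite sumz_const in I4 by auto.
      cbn [lsum fold_right] in I4. fold (lsum (fun _ => 1) l2) in I4.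
      pose proof (lsum_nonneg_const l2).
      pose proof (class_size_le n S (q_size q) Hn). unfold class_size in *. lia. }
    destruct (Hin x X4) as (Y1 & Y2 & Y3).
    assert (Hsv : Z.abs (q_sign q * V x) <= B)
      by (destruct (q_sign_cases q) as [[-> _]|[-> _]]; lia).
    assert (Hw : step_w U P q x = if q_par q =? 0 then U x - P x else P x) by reflexivity.
    pose proof (q_par_range q) as Hpr.
    assert (Hfin : forall w, w = step_w U P q x ->
      0 <= m + 1
      /\ (exists l3, chain nx (nx x) l3 /\ (forall y, In y l3 -> In y l)
           /\ forall f, sumz (fun e => f (if e =? m then x else ar s1 a_kI e)) 0 (m + 1) + lsum f l3
                = sumz (fun i => if S i =? q_size q then f i else 0) 0 n)
      /\ (forall e, 0 <= e < m + 1 ->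
           0 <= (if e =? m then x else ar s1 a_kI e) < n
           /\ S (if e =? m then x else ar s1 a_kI e) = q_size q
           /\ (if e =? m then q_sign q * V x else ar s1 a_kV e)
                = q_sign q * V (if e =? m then x else ar s1 a_kI e)
           /\ (if e =? m then 1 else ar s1 a_kS e) = 1
           /\ (if e =? m then w else ar s1 a_kW e)
                = step_w U P q (if e =? m then x else ar s1 a_kI e))).
    { intros w ->. split; [lia|]. split.
      - exists l2. split; [auto|]. split; [intros; apply I3; now right|].
        intros f. rewrite <- I4, sumz_last by lia. rewrite Z.eqb_refl.
        rewrite (sumz_ext _ (fun e => f (ar s1 a_kI e))).
        + cbn [lsum fold_right]. fold (lsum f l2). lia.
        + intros e He. destruct (Z.eqb_spec e m); [lia|auto].
      - intros e He. destruct (Z.eqb_spec e m) as [->|]; [repeat split; auto; lia|].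
        apply I5. lia. }
    replace (j - 1) with x in * by lia.
    apply wp_asg_seq; [sfty; fold j; lia|]. frs. fold j. replace (j - 1) with x by lia.
    apply wp_sto_seq; [sfty; rewrite ?Hsg, ?HV; lia|]. frs. rewrite Hsg, HV. fold m.
    ws; fold m; rewrite ?HU, ?HP, ?Hpar in *; try lia.
    + split; [|lia]. apply Hfin. rewrite Hw. destruct (Z.eqb_spec (q_par q) 0); lia.
    + split; [|lia]. apply Hfin. rewrite Hw. destruct (Z.eqb_spec (q_par q) 0); lia.
  - intros s1 t1 Ht1 F1 (I1 & (l2 & I2 & I3 & I4) & I5) Hb Ht1'. frs.
    destruct l2 as [|x l2]; cbn [chain] in I2; [|lia].
    assert (I4' := I4 (fun _ => 1)). cbv beta in I4'. rewrite sumz_const in I4' by auto.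
    cbn [lsum fold_right] in I4'. fold (class_size n S (q_size q)) in I4'.
    split; [|lia]. split; [auto|]. split; [|auto].
    intros f. rewrite <- I4. cbn [lsum fold_right]. lia.
Qed.

(** Elements are listed with multiplicity but never beyond [D] entries in total, since
    multiplicities may be huge. *)
Definition emit (b : cond) : cmd :=
  Asg r_i (#0) ;;
  While (CLt ($r_i) ($r_m0))
    (If b
      (Asg r_x1 (a_kW@[$r_i]) ;;
       If (CLt ($r_D - $r_cnt) ($r_x1)) (Asg r_cc ($r_D - $r_cnt)) (Asg r_cc ($r_x1)) ;;
       While (CLt (#0) ($r_cc))
         (Sto a_Y ($r_cnt) ($r_i) ;; Asg r_cnt ($r_cnt + #1) ;; Asg r_cc ($r_cc - #1)))
      Skip ;;
     Asg r_i ($r_i + #1)).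

(** Holding for all [f], this means that the list contains each [e] exactly [occ e] times. *)
Definition occurs (Y occ : Z -> Z) (cnt m : Z) : Prop :=
  forall f, sumz (fun x => f (Y x)) 0 cnt = sumz (fun e => occ e * f e) 0 m.

Lemma emit_spec B n s b (bb : Z -> bool) m D kw occ :
  rg s r_m0 = m -> rg s r_D = D -> ar s a_kW = kw ->
  0 <= m -> m + 1 <= B -> 0 <= D -> D + 1 <= B ->
  (forall e, 0 <= e < m -> 0 <= kw e <= B) ->
  (forall s1, fr (emit b) s s1 -> 0 <= rg s1 r_i < m ->
     safec B n s1 b /\ (tvp s1 b <-> bb (rg s1 r_i) = true)) ->
  0 <= rg s r_cnt <= D -> occurs (ar s a_Y) occ (rg s r_cnt) m ->
  wp B n (emit b) s (fun s' t =>
    rg s r_cnt <= rg s' r_cnt <= D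
    /\ t <= 2 * m + (rg s' r_cnt - rg s r_cnt) + 1
    /\ exists occ', occurs (ar s' a_Y) occ' (rg s' r_cnt) m
      /\ (forall e, 0 <= e < m ->
           (bb e = false -> occ' e = occ e)
           /\ occ e <= occ' e <= occ e + kw e
           /\ (bb e = true -> occ' e = occ e + kw e \/ rg s' r_cnt = D))).
Proof.
  intros Hm HD Hkw Hm0 HmB HD0 HDB Hw Hcond Hcnt Hocc.
  unfold emit. ws.
  set (c0 := rg s r_cnt) in *.
  eapply wp_while with
    (I := fun s1 => 0 <= rg s1 r_i <= m /\ c0 <= rg s1 r_cnt <= D
      /\ exists occ', occurs (ar s1 a_Y) occ' (rg s1 r_cnt) m
      /\ (forall e, 0 <= e < m -> (rg s1 r_i <= e -> occ' e = occ e) /\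
           (bb e = false -> occ' e = occ e)
           /\ occ e <= occ' e <= occ e + kw e
           /\ (e < rg s1 r_i -> bb e = true -> occ' e = occ e + kw e \/ rg s1 r_cnt = D)))
    (phi := fun s1 => 2 * (m - rg s1 r_i) + (D - rg s1 r_cnt)).
  - simp. split; [lia|]. split; [fold c0; lia|]. exists occ. split; [auto|].
    intros e He. specialize (Hw e He). repeat split; intros; auto; lia.
  - intros s1 F1 (I1 & I2 & I3). frs. split; [sfty|lia].
  - intros s1 F1 (I1 & I2 & occ1 & I3 & I4) Hb.
    assert (Hfr : fr (emit b) s s1).
    { destruct F1 as [G1 G2]. split; intros x Hx.
      - assert (Hx2 := Hx). unfold emit in Hx2. cbn [modr] in Hx2. rewrite inb_app in Hx2.
        apply orb_false_iff in Hx2 as [Hx1 Hx2]. rewrite G1 by auto. cbn.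
        unfold update. destruct (Nat.eqb x r_i) eqn:E; auto.
        unfold inb in Hx1. cbn in Hx1. rewrite E in Hx1. discriminate.
      - rewrite G2; auto. }
    frs. rewrite Hm in Hb. set (i := rg s1 r_i) in *. set (c := rg s1 r_cnt) in *.
    destruct (Hcond s1 Hfr ltac:(fold i; lia)) as [Hsf Hbb]. fold i in Hbb.
    pose proof (Hw i ltac:(lia)) as Hwi.
    destruct (I4 i ltac:(lia)) as (E1 & _). specialize (E1 ltac:(lia)).
    apply wp_if_seq; auto.
    + intros Hc. apply Hbb in Hc.
      assert (Hin : forall c1, 0 <= c1 <= kw i -> c1 <= D - c -> (c1 = kw i \/ c1 = D - c) ->
        wp B n (While (CLt (#0) ($r_cc))
         (Sto a_Y ($r_cnt) ($r_i) ;; Asg r_cnt ($r_cnt + #1) ;; Asg r_cc ($r_cc - #1)) ;;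
         Asg r_i ($r_i + #1)) (setr (setr s1 r_x1 (kw i)) r_cc c1)
         (fun s2 t => (0 <= rg s2 r_i <= m /\ c0 <= rg s2 r_cnt <= D
      /\ exists occ', occurs (ar s2 a_Y) occ' (rg s2 r_cnt) m
      /\ (forall e, 0 <= e < m -> (rg s2 r_i <= e -> occ' e = occ e) /\
           (bb e = false -> occ' e = occ e)
           /\ occ e <= occ' e <= occ e + kw e
           /\ (e < rg s2 r_i -> bb e = true -> occ' e = occ e + kw e \/ rg s2 r_cnt = D)))
          /\ t + 1 + (2 * (m - rg s2 r_i) + (D - rg s2 r_cnt)) <= 2 * (m - i) + (D - c))).
      { intros c1 Hc1 Hc1D Hor. apply wp_seq.
        eapply wp_while with
          (I := fun s2 => let u := rg s2 r_cnt - c in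
            0 <= u <= c1 /\ rg s2 r_cc = c1 - u
            /\ occurs (ar s2 a_Y) (fun e => occ1 e + if e =? i then u else 0) (rg s2 r_cnt) m)
          (phi := fun s2 => rg s2 r_cc).
        - simp. fold c. split; [lia|]. split; [lia|]. intros f. rewrite I3.
          apply sumz_ext. intros e He. replace (c - c) with 0 by lia. destruct (e =? i); lia.
        - intros s2 F2 (J1 & J2 & J3). frs. split; [sfty|lia].
        - intros s2 F2 (J1 & J2 & J3) Hb2. frs.
          ws. fold i. set (c2 := rg s2 r_cnt) in *.
          split; [|lia]. split; [lia|]. split; [lia|]. intros f.
          rewrite sumz_last by lia. rewrite Z.eqb_refl.
          rewrite (sumz_ext _ (fun x => f (ar s2 a_Y x)))
            by (intros x Hx; destruct (Z.eqb_spec x c2); [lia|auto]).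
          rewrite J3.
          rewrite (sumz_change (fun e => (occ1 e + (if e =? i then c2 - c else 0)) * f e)
            (fun e => (occ1 e + (if e =? i then c2 + 1 - c else 0)) * f e) 0 m i).
          + rewrite Z.eqb_refl. lia.
          + lia.
          + intros e He Hne. rewrite (proj2 (Z.eqb_neq _ _) Hne). auto.
        - intros s2 t2 Ht2 F2 (J1 & J2 & J3) Hb2 Ht2'. frs.
          set (c2 := rg s2 r_cnt) in *. ws. fold c2 i.
          replace (c2 - c) with c1 in J3 by lia.
          split; [|lia]. split; [lia|]. split; [lia|].
          exists (fun e => occ1 e + if e =? i then c1 else 0). split; [auto|].
          intros e He. destruct (I4 e He) as (A1 & A2 & A3 & A4).
          destruct (Z.eqb_spec e i) as [->|].
          + repeat split; intros; try lia. congruence.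
          + rewrite Z.add_0_r. repeat split; auto; try lia; intros;
              destruct A4; auto; lia. }
      ws; fold_all c; fold_all i; rewrite ?HD, ?Hkw in *; try lia; apply Hin; lia.
    + intros Hc. assert (Hbf : bb i = false) by (destruct (bb i); tauto).
      ws. fold i c. split; [|lia]. split; [lia|]. split; [lia|].
      exists occ1. split; [auto|].
      intros e He. destruct (I4 e He) as (A1 & A2 & A3 & A4).
      repeat split; auto; try lia.
      intros Hlt Hbt. apply A4; auto. assert (e <> i) by congruence. lia.
  - intros s1 t1 Ht1 F1 (I1 & I2 & occ1 & I3 & I4) Hb Ht1'. frs. rewrite Hm in *.
    fold c0 in Ht1'. split; [lia|]. split; [lia|].
    exists occ1. split; [auto|]. intros e He. destruct (I4 e He) as (A1 & A2 & A3 & A4).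
    repeat split; auto; try lia. intros Hbt. apply A4; auto; lia.
Qed.

(** The copies strictly above the threshold all fit into the list, and ties fill it up to [D]. Only
    these at most [2 s] entries are sorted, so quadratic sorting costs [O(s^2)]. *)
Definition top_copies : cmd :=
  Asg r_cap ($r_D) ;; select ;; Asg r_cnt (#0) ;;
  emit (CLt ($r_xv * a_kS@[$r_i]) (a_kV@[$r_i] * $r_xs)) ;;
  emit (CAnd (CLt (a_kV@[$r_i] * $r_xs) ($r_xv * a_kS@[$r_i] + #1))
             (CLt ($r_xv * a_kS@[$r_i]) (a_kV@[$r_i] * $r_xs + #1))) ;;
  Asg r_lo (#0) ;; Asg r_hi ($r_cnt) ;; insort.

Definition top_ok (kv kw Y occ : Z -> Z) (m D cnt : Z) : Prop :=
  0 <= cnt <= D /\ occurs Y occ cnt m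
  /\ (forall e, 0 <= e < m -> 0 <= occ e <= kw e)
  /\ (forall i, 0 <= i < cnt -> 0 <= Y i < m)
  /\ (forall i j, 0 <= i < j -> j < cnt -> kv (Y j) <= kv (Y i))
  /\ ((forall e, 0 <= e < m -> occ e = kw e)
      \/ (cnt = D /\ forall e i, 0 <= e < m -> 0 <= i < cnt -> occ e < kw e -> kv e <= kv (Y i))).

Lemma occurs_in Y occ cnt m x :
  occurs Y occ cnt m -> 0 <= x < cnt -> 0 <= Y x < m /\ occ (Y x) <> 0.
Proof.
  intros H Hx. specialize (H (fun z => if z =? Y x then 1 else 0)). cbv beta in H.
  pose proof (sumz_term (fun z => if Y z =? Y x then 1 else 0) 0 cnt x
    ltac:(intros; cbv beta; destruct (_ =? _); lia) Hx) as Ht.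
  cbv beta in Ht. rewrite Z.eqb_refl, H in Ht.
  destruct (sumz_pos_ex (fun e => occ e * (if e =? Y x then 1 else 0)) 0 m) as (e & He & Hp);
    [lia|].
  destruct (Z.eqb_spec e (Y x)) as [->|]; [split; [auto|]; lia|lia].
Qed.

Lemma top_copies_spec B n s m D vm kv ks kw :
  rg s r_m0 = m -> rg s r_D = D -> rg s r_vm = vm ->
  ar s a_kV = kv -> ar s a_kS = ks -> ar s a_kW = kw ->
  0 <= m -> 8 * m + 1 <= B -> 200 <= B -> 0 <= D -> D + 1 <= B -> 0 <= vm -> vm + 2 <= B ->
  (forall e, 0 <= e < m -> ks e = 1 /\ Z.abs (kv e) <= vm /\ 0 <= kw e) ->
  sumz kw 0 m <= B ->
  wp B n top_copies s (fun s' t =>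
    (exists occ, top_ok kv kw (ar s' a_Y) occ m D (rg s' r_cnt))
    /\ t <= 4005 * m + (D + 1) * (D + 1) + D + 5).
Proof.
  intros Hm HD Hvm Hkv Hks Hkw Hm0 HmB HB HD0 HDB Hvm0 HvB Hin HwB.
  assert (Hk : keys_ok B kv ks m).
  { split; [lia|]. intros e He. destruct (Hin e He) as (E1 & E2 & E3). rewrite E1.
    split; [lia|]. intros f Hf. destruct (Hin f Hf) as (G1 & _). rewrite G1. lia. }
  assert (HwB1 : forall e, 0 <= e < m -> 0 <= kw e <= B).
  { intros e He. split; [apply Hin; auto|]. etransitivity; [|exact HwB].
    apply sumz_term; auto. intros j Hj. apply Hin; auto. }
  unfold top_copies. ws. rewrite HD. apply wp_seq. eapply wp_conseq.
  { eapply select_spec with (m0 := m) (cap := D) (vm := vm) (kv := kv) (ks := ks) (kw := kw);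
      frs; auto; try lia; intros e He; apply Hin; auto. }
  cbv beta. intros s1 t1 Ht1 F1 ((Q1 & Q2 & Q3) & P2 & P3).
  set (xv := rg s1 r_xv) in *. set (xs := rg s1 r_xs) in *.
  assert (Hxv : Z.abs xv <= vm + 1 /\ xs = 1).
  { destruct P2 as [(x & Hx & -> & ->)|[-> ->]]; [|lia].
    destruct (Hin x Hx) as (I1 & I2 & I3). lia. }
  destruct Hxv as [Hxv Hxs].
  ws. apply wp_seq. eapply wp_conseq.
  { eapply emit_spec with (bb := fun e => xv <? kv e) (m := m) (D := D) (kw := kw)
      (occ := fun _ => 0); frs; auto; try lia.
    - intros s2 F2 Hi. frs. fold xv xs. rewrite ?Hkv, ?Hks, ?Hxs.
      destruct (Hin _ Hi) as (G1 & G2 & G3). rewrite G1.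
      split; [sfty; fold xv xs; rewrite ?Hkv, ?Hks, ?Hxs, ?G1; lia|].
      rewrite Z.ltb_lt, !Z.mul_1_r. tauto.
    - intros f. rewrite sumz_empty, sumz_zero; auto; intros; lia. }
  cbv beta. intros s2 t2 Ht2 F2 (K1 & K2 & occ1 & K3 & K4). frs.
  set (c1 := rg s2 r_cnt) in *.
  (* The first pass cuts nothing off: by selection the copies strictly above the threshold number at
     most [D]. *)
  assert (Hocc1 : forall e, 0 <= e < m -> occ1 e = if xv <? kv e then kw e else 0).
  { intros e He. destruct (K4 e He) as (A1 & A2 & A3).
    destruct (Z.ltb_spec xv (kv e)) as [L|L]; [|apply A1; auto].
    destruct A3 as [A3|A3]; auto.
    destruct (Z.eq_dec (occ1 e) (kw e)); auto. exfalso.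
    pose proof (sumz_term (fun e => (if xv * ks e <? kv e * xs then kw e else 0) + -1 * occ1 e)
      0 m e) as T.
    assert (Hnn : forall j, 0 <= j < m ->
      0 <= (if xv * ks j <? kv j * xs then kw j else 0) + -1 * occ1 j).
    { intros j Hj. destruct (K4 j Hj) as (C1 & C2 & _). destruct (Hin j Hj) as (-> & _ & C3).
      rewrite Hxs. destruct (Z.ltb_spec (xv * 1) (kv j * 1)) as [L'|L']; [lia|].
      rewrite C1; [lia|]. apply Z.ltb_ge. lia. }
    specialize (T Hnn He). cbv beta in T. rewrite sumz_add, sumz_scal in T.
    specialize (K3 (fun _ => 1)). cbv beta in K3. rewrite sumz_const in K3 by lia.
    rewrite (sumz_ext (fun e => occ1 e * 1) occ1) in K3 by (intros; lia).
    destruct (Hin e He) as (C & _). rewrite C in T. rewrite Hxs in T, Q2.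
    rewrite (proj2 (Z.ltb_lt (xv * 1) (kv e * 1))) in T by lia. lia. }
  apply wp_seq. eapply wp_conseq.
  { eapply emit_spec with (bb := fun e => xv =? kv e) (m := m) (D := D) (kw := kw)
      (occ := occ1); frs; auto; try lia.
    intros s3 F3 Hi. frs. fold xv xs. rewrite ?Hkv, ?Hks, ?Hxs.
    destruct (Hin _ Hi) as (G1 & G2 & G3). rewrite G1.
    split; [sfty; fold xv xs; rewrite ?Hkv, ?Hks, ?Hxs, ?G1; lia|].
    rewrite Z.eqb_eq, !Z.mul_1_r. lia. }
  cbv beta. intros s3 t3 Ht3 F3 (L1 & L2 & occ & L3 & L4). frs.
  fold c1 in L1, L2. set (cnt := rg s3 r_cnt) in *.
  assert (Hocc0 : forall e, 0 <= e < m -> 0 <= occ e <= kw e /\ (kv e < xv -> occ e = 0)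
    /\ (xv < kv e -> occ e = kw e)).
  { intros e He. destruct (L4 e He) as (A1 & A2 & _). specialize (Hocc1 e He).
    destruct (Hin e He) as (_ & _ & C3).
    destruct (Z.ltb_spec xv (kv e)), (Z.eqb_spec xv (kv e)); try lia;
      rewrite ?A1 in * by auto; lia. }
  ws. fold cnt. eapply wp_conseq.
  { eapply insort_spec with (lo := 0) (hi := cnt) (m := m) (kv := kv) (ks := ks);
      frs; auto; try lia.
    intros i Hi. eapply occurs_in; eauto. }
  cbv beta. intros s4 t4 Ht4 F4 (N1 & N2 & N3 & N4). frs. fold cnt.
  assert (HoccY : occurs (ar s4 a_Y) occ cnt m) by (intros f; rewrite N1; apply L3).
  split.
  2:{ replace (cnt - 0 + 1) with (cnt + 1) in N4 by lia.
      assert ((cnt + 1) * (cnt + 1) <= (D + 1) * (D + 1)) by (apply Z.mul_le_mono_nonneg; lia).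
      lia. }
  exists occ. split; [lia|]. split; [auto|]. split; [intros e He; apply Hocc0; auto|].
  split; [intros i Hi; eapply occurs_in; eauto|]. split.
  { intros i j Hi Hj. specialize (N3 i j Hi Hj). unfold key_ge in N3. apply Z.leb_le in N3.
    destruct (occurs_in _ _ _ _ i HoccY ltac:(lia)) as [O1 _].
    destruct (occurs_in _ _ _ _ j HoccY ltac:(lia)) as [O2 _].
    destruct (Hin _ O1) as (E1 & _), (Hin _ O2) as (E2 & _). rewrite E1, E2 in N3. lia. }
  destruct Q3 as [Q3|Q3].
  - destruct (Z.eq_dec cnt D) as [EcD|NcD].
    + right. split; [auto|]. intros e i He Hi Hlt.
      destruct (occurs_in _ _ _ _ i HoccY Hi) as [O1 O2].
      destruct (Hocc0 e He) as (_ & _ & C1), (Hocc0 _ O1) as (_ & C2 & _).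
      assert (~ xv < kv e) by (intros C; specialize (C1 C); lia).
      assert (~ kv (ar s4 a_Y i) < xv) by (intros C; apply O2; auto). lia.
    (* With fewer than [D] entries no tie was cut off, so all copies at or above the threshold are
       listed; by selection these are more than [D]. *)
    + exfalso. specialize (HoccY (fun _ => 1)). cbv beta in HoccY.
      rewrite sumz_const in HoccY by lia.
      rewrite (sumz_ext (fun e => occ e * 1)
        (fun e => if xv * ks e <=? kv e * xs then kw e else 0)) in HoccY; [lia|].
      intros e He. destruct (Hocc0 e He) as (C0 & C1 & C2). destruct (L4 e He) as (_ & _ & A3).
      destruct (L4 e He) as (_ & A2 & _). specialize (Hocc1 e He).
      destruct (Hin e He) as (-> & _ & C3). rewrite Hxs.
      destruct (Z.leb_spec (xv * 1) (kv e * 1)) as [L|L].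
      * destruct (Z.eq_dec xv (kv e)) as [E|E].
        -- destruct A3 as [A3|A3]; [now apply Z.eqb_eq| |lia].
           destruct (Z.ltb_spec xv (kv e)); lia.
        -- rewrite C2; lia.
      * rewrite C1; lia.
  - left. intros e He. specialize (Q3 e He). destruct (Hin e He) as (E & _).
    rewrite E, Hxs in Q3. apply Hocc0; auto. lia.
Qed.

(** * One step of the dynamic program *)

(** Every copy beyond the available ones, and every copy in the wrong direction, costs [BIG]. Seen
    in the direction of the step, the slopes are [BIG] before 0, then the gains from best to worst,
    then [- BIG]: the table is concave throughout. *)
Definition table : cmd :=
  Sto a_F ($r_NN) (#0) ;; Asg r_d (#1) ;;
  While (CLt ($r_d) ($r_NN))
    (If (CLt ($r_d) ($r_cnt + #1))
        (Asg r_e (a_Y@[$r_d - #1]) ;; Asg r_ge (a_kV@[$r_e]) ;;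
         Sto a_LI ($r_q * $r_D + ($r_d - #1)) (a_kI@[$r_e]))
        (Asg r_ge (#0 - $r_BIG)) ;;
     Sto a_F ($r_NN + $r_sg * $r_d) (a_F@[$r_NN + $r_sg * ($r_d - #1)] + $r_ge) ;;
     Sto a_F ($r_NN - $r_sg * $r_d) (a_F@[$r_NN - $r_sg * ($r_d - #1)] - $r_BIG) ;;
     Asg r_d ($r_d + #1)).

Definition gain_sum (kv Y : Z -> Z) (cnt BIG j : Z) : Z :=
  sumz (fun x => if x <? cnt then kv (Y x) else - BIG) 0 j.

Definition table_ok (kv Y : Z -> Z) (cnt BIG NN sg : Z) (F : Z -> Z) : Prop :=
  forall j, 0 <= j < NN ->
    F (NN + sg * j) = gain_sum kv Y cnt BIG j /\ F (NN - sg * j) = - BIG * j.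

Lemma gain_sum_bound kv Y cnt BIG j :
  0 <= j -> 0 <= BIG -> (forall x, 0 <= x < cnt -> Z.abs (kv (Y x)) <= BIG) ->
  Z.abs (gain_sum kv Y cnt BIG j) <= BIG * j.
Proof.
  intros Hj HB H. unfold gain_sum.
  assert (sumz (fun x => if x <? cnt then kv (Y x) else - BIG) 0 j <= sumz (fun _ => BIG) 0 j).
  { apply sumz_le. intros x Hx. destruct (Z.ltb_spec x cnt); [|lia].
    specialize (H x ltac:(lia)). lia. }
  assert (sumz (fun _ => - BIG) 0 j <= sumz (fun x => if x <? cnt then kv (Y x) else - BIG) 0 j).
  { apply sumz_le. intros x Hx. destruct (Z.ltb_spec x cnt); [|lia].
    specialize (H x ltac:(lia)). lia. }
  rewrite sumz_const in * by lia. lia.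
Qed.

Lemma table_spec B n s q sg D NN BIG cnt m kv ki Y :
  rg s r_q = q -> rg s r_D = D -> rg s r_NN = NN -> rg s r_BIG = BIG -> rg s r_cnt = cnt ->
  rg s r_sg = sg -> (sg = 1 \/ sg = -1) -> ar s a_kV = kv -> ar s a_kI = ki -> ar s a_Y = Y ->
  0 <= q -> 0 <= cnt <= D -> D < NN -> 0 <= BIG -> m <= B ->
  (forall x, 0 <= x < cnt -> 0 <= Y x < m /\ Z.abs (kv (Y x)) <= BIG) ->
  q * D + NN <= B -> 3 * NN <= B -> BIG * NN <= B -> BIG <= B -> 1 <= NN ->
  wp B n table s (fun s' t =>
    table_ok kv Y cnt BIG NN sg (ar s' a_F)
    /\ (forall x, 0 <= x < cnt -> ar s' a_LI (q * D + x) = ki (Y x))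
    /\ (forall x, x < q * D -> ar s' a_LI x = ar s a_LI x)
    /\ t <= NN + 1).
Proof.
  intros Hq HD HNN HBIG Hcnt Hsg Hsg1 Hkv Hki HY Hq0 Hc0 HDN HB0 HmB HYb HLB HNB HBB HBB1 HN1.
  assert (HqD : 0 <= q * D) by (apply Z.mul_nonneg_nonneg; lia).
  unfold table. ws; rewrite ?HNN; try lia.
  eapply wp_while with
    (I := fun s1 => let d := rg s1 r_d in 1 <= d <= NN
      /\ (forall j, 0 <= j < d -> ar s1 a_F (NN + sg * j) = gain_sum kv Y cnt BIG j
           /\ ar s1 a_F (NN - sg * j) = - BIG * j)
      /\ (forall x, 0 <= x < cnt -> x < d - 1 -> ar s1 a_LI (q * D + x) = ki (Y x))
      /\ (forall x, x < q * D -> ar s1 a_LI x = ar s a_LI x))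
    (phi := fun s1 => NN - rg s1 r_d).
  - simp. split; [lia|]. split; [|split; [intros; lia|auto]].
    intros j Hj. replace j with 0 by lia. rewrite !Z.mul_0_r, Z.add_0_r, Z.sub_0_r, Z.eqb_refl.
    unfold gain_sum. rewrite sumz_empty; lia.
  - intros s1 F1 (I1 & I2 & I3 & I4). frs. split; [sfty|lia].
  - intros s1 F1 (I1 & I2 & I3 & I4) Hb. frs. rewrite HNN in Hb.
    set (d := rg s1 r_d) in *.
    destruct (I2 (d - 1) ltac:(lia)) as [G1 G2].
    assert (Hsd : sg * d = d \/ sg * d = - d) by (destruct Hsg1 as [-> | ->]; lia).
    assert (Hsd1 : sg * (d - 1) = sg * d - sg) by lia.
    assert (Hg0 := gain_sum_bound kv Y cnt BIG (d - 1) ltac:(lia) HB0 (fun x Hx => proj2 (HYb x Hx))).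
    assert (Hg1 := gain_sum_bound kv Y cnt BIG d ltac:(lia) HB0 (fun x Hx => proj2 (HYb x Hx))).
    assert (Hgs : gain_sum kv Y cnt BIG d = gain_sum kv Y cnt BIG (d - 1)
      + if d - 1 <? cnt then kv (Y (d - 1)) else - BIG).
    { unfold gain_sum. replace d with (d - 1 + 1) at 1 by lia. now rewrite sumz_last by lia. }
    assert (Hbd : BIG * d <= BIG * NN) by (apply Z.mul_le_mono_nonneg_l; lia).
    assert (Hne : forall j, 0 <= j < d -> NN + sg * j <> NN + sg * d /\ NN + sg * j <> NN - sg * d
       /\ NN - sg * j <> NN + sg * d /\ NN - sg * j <> NN - sg * d)
      by (intros j Hj; destruct Hsg1 as [-> | ->]; lia).
    assert (Hfin : forall ge, ge = (if d - 1 <? cnt then kv (Y (d - 1)) else - BIG) ->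
      forall j, 0 <= j < d + 1 ->
       (if NN + sg * j =? NN - sg * d then - BIG * (d - 1) - BIG
        else if NN + sg * j =? NN + sg * d then gain_sum kv Y cnt BIG (d - 1) + ge
        else ar s1 a_F (NN + sg * j)) = gain_sum kv Y cnt BIG j
       /\ (if NN - sg * j =? NN - sg * d then - BIG * (d - 1) - BIG
        else if NN - sg * j =? NN + sg * d then gain_sum kv Y cnt BIG (d - 1) + ge
        else ar s1 a_F (NN - sg * j)) = - BIG * j).
    { intros ge -> j Hj. destruct (Z.eq_dec j d) as [->|].
      - rewrite (proj2 (Z.eqb_neq (NN + sg * d) (NN - sg * d))) by lia.
        rewrite !Z.eqb_refl. split; [auto|lia].
      - destruct (Hne j ltac:(lia)) as (N1 & N2 & N3 & N4).
        rewrite !(proj2 (Z.eqb_neq _ _)) by auto. apply I2. lia. }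
    assert (Hne1 : NN - sg * (d - 1) <> NN + sg * d) by (destruct Hsg1 as [-> | ->]; lia).
    assert (Hrd : forall v, (if NN - sg * (d - 1) =? NN + sg * d then v
      else ar s1 a_F (NN - sg * (d - 1))) = - BIG * (d - 1)).
    { intros v. now rewrite (proj2 (Z.eqb_neq _ _) Hne1). }
    apply wp_if_seq; [sfty; rewrite ?Hcnt; lia| |]; intros Hc; cbn [tvp ev op_val] in Hc;
      frs; fold d in Hc; rewrite Hcnt in Hc.
    + destruct (HYb (d - 1) ltac:(lia)) as [Y1 Y2].
      rewrite (proj2 (Z.ltb_lt (d - 1) cnt)) in * by lia.
      ws; rewrite ?HY, ?Hkv, ?Hki, ?Hq, ?HD, ?HNN, ?Hsg, ?HBIG in *; fold_all d;
        rewrite ?G1, ?Hrd in *; try lia.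
      split; [|lia]. split; [lia|]. split; [apply Hfin; auto|]. split.
      * intros x Hx Hxd. destruct (Z.eqb_spec (q * D + x) (q * D + (d - 1))) as [E|].
        -- do 2 f_equal. lia.
        -- apply I3; lia.
      * intros x Hx. destruct (Z.eqb_spec x (q * D + (d - 1))); [lia|auto].
    + rewrite (proj2 (Z.ltb_ge (d - 1) cnt)) in * by lia.
      ws; rewrite ?HY, ?Hkv, ?Hki, ?Hq, ?HD, ?HNN, ?Hsg, ?HBIG in *; fold_all d;
        rewrite ?G1, ?Hrd in *; try lia.
      split; [|lia]. split; [lia|]. split; [apply Hfin; lia|]. split; [|auto].
      intros x Hx Hxd. apply I3; lia.
  - intros s1 t1 Ht1 F1 (I1 & I2 & I3 & I4) Hb Ht1'. frs. rewrite HNN in *.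
    assert (Ed : rg s1 r_d = NN) by lia. rewrite Ed in *.
    split; [intros j Hj; apply I2; auto|]. split; [intros; apply I3; lia|]. split; [auto|lia].
Qed.

(** * Concavity of the gain tables *)

Definition concave (NN : Z) (F : Z -> Z) : Prop :=
  forall d, - NN + 1 < d < NN - 1 -> F (d + 1) - F d <= F d - F (d - 1).

Lemma concave_step NN F d d' :
  concave NN F -> - NN < d <= d' -> d' < NN - 1 -> F (d' + 1) - F d' <= F (d + 1) - F d.
Proof.
  intros HF [H1 H2]. revert d' H2.
  apply (interval_ind d (fun d' => d' < NN - 1 -> F (d' + 1) - F d' <= F (d + 1) - F d)).
  - lia.
  - intros h Hh IH Hlt. specialize (HF (h + 1) ltac:(lia)).
    replace (h + 1 - 1) with h in HF by lia. specialize (IH ltac:(lia)). lia.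
Qed.

(** The increment over [u] positions is a sum of differences, none of which grows when the start
    moves from [p] to [q]. This is what makes the matrix of [F (a - b)] inverse Monge. *)
Lemma concave_quad NN F p q u :
  concave NN F -> - NN < p <= q -> 0 <= u -> q + u < NN ->
  F p + F (q + u) <= F (p + u) + F q.
Proof.
  intros HF Hp Hu. revert u Hu.
  apply (interval_ind 0 (fun u => q + u < NN -> F p + F (q + u) <= F (p + u) + F q)).
  - intros _. rewrite !Z.add_0_r. lia.
  - intros u Hu IH Hlt. specialize (IH ltac:(lia)).
    pose proof (concave_step NN F (p + u) (q + u) HF ltac:(lia) ltac:(lia)).
    rewrite !Z.add_assoc. lia.
Qed.

Section TableFacts.

Variables (n D NN vm BIG q m cnt : Z) (S V U P kv ks kw ki Y occ F li : Z -> Z).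
Hypothesis HD : 0 <= D < NN.
Hypothesis Hvm : 0 <= vm.
Hypothesis HBIG : D * vm < BIG.
Hypothesis HBIGv : vm <= BIG.
Hypothesis Hn : 0 <= n.
Hypothesis HV : forall i, 0 <= i < n -> 0 <= V i <= vm.
Hypothesis HP : forall i, 0 <= i < n -> 0 <= P i <= U i.
Hypothesis Hkeys : class_keys n S V U P q m kv ks kw ki.
Hypothesis Htop : top_ok kv kw Y occ m D cnt.
Hypothesis Htab : table_ok kv Y cnt BIG NN (q_sign q) F.
Hypothesis Hli : forall x, 0 <= x < cnt -> li x = ki (Y x).

Lemma table_kv x : 0 <= x < cnt -> Z.abs (kv (Y x)) <= vm.
Proof.
  intros Hx. destruct Htop as (_ & _ & _ & T4 & _). destruct Hkeys as (_ & _ & K3).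
  destruct (K3 (Y x) (T4 x Hx)) as (E1 & _ & -> & _). specialize (HV _ E1).
  destruct (q_sign_cases q) as [[-> _]|[-> _]]; lia.
Qed.

Lemma table_val d : - NN < d < NN ->
  F (NN + d) = if 0 <=? q_sign q * d then gain_sum kv Y cnt BIG (q_sign q * d)
               else BIG * (q_sign q * d).
Proof.
  intros Hd. destruct (q_sign_cases q) as [[E _]|[E _]]; rewrite E.
  - destruct (Z.leb_spec 0 (1 * d)).
    + destruct (Htab d ltac:(lia)) as [H1 _]. rewrite E in H1.
      replace (1 * d) with d in * by lia. auto.
    + destruct (Htab (- d) ltac:(lia)) as [_ H1]. rewrite E in H1.
      replace (NN - 1 * - d) with (NN + d) in H1 by lia. lia.
  - destruct (Z.leb_spec 0 (-1 * d)).
    + destruct (Htab (- d) ltac:(lia)) as [H1 _]. rewrite E in H1.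
      replace (NN + -1 * - d) with (NN + d) in H1 by lia.
      replace (-1 * d) with (- d) by lia. auto.
    + destruct (Htab d ltac:(lia)) as [_ H1]. rewrite E in H1.
      replace (NN - -1 * d) with (NN + d) in H1 by lia. lia.
Qed.

Lemma gain_sum_real j : 0 <= j <= cnt ->
  gain_sum kv Y cnt BIG j = sumz (fun x => kv (Y x)) 0 j.
Proof.
  intros Hj. apply sumz_ext. intros x Hx. now rewrite (proj2 (Z.ltb_lt _ _)) by lia.
Qed.

Lemma gain_real_le j : 0 <= j <= cnt -> sumz (fun x => kv (Y x)) 0 j <= D * vm.
Proof.
  intros Hj. transitivity (sumz (fun _ => vm) 0 j).
  - apply sumz_le. intros x Hx. pose proof (table_kv x). lia.
  - rewrite sumz_const by lia. destruct Htop as (T1 & _). nia.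
Qed.

Lemma table_concave : concave NN (fun d => F (NN + d)).
Proof.
  intros d Hd. cbv beta. rewrite !table_val by lia.
  destruct Htop as (T1 & _ & _ & _ & T5 & _).
  set (gn := fun x => if x <? cnt then kv (Y x) else - BIG).
  assert (Hgs : forall j, 0 <= j -> gain_sum kv Y cnt BIG (j + 1) = gain_sum kv Y cnt BIG j + gn j).
  { intros j Hj. unfold gain_sum. now rewrite sumz_last by lia. }
  assert (Hgn : forall j, 0 <= j -> gn (j + 1) <= gn j).
  { intros j Hj. unfold gn. pose proof (table_kv j).
    destruct (Z.ltb_spec (j + 1) cnt), (Z.ltb_spec j cnt); try lia. apply T5; lia. }
  assert (Hgb : forall j, 0 <= j -> - BIG <= gn j <= BIG).
  { intros j Hj. unfold gn. pose proof (table_kv j). destruct (Z.ltb_spec j cnt); lia. }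
  assert (Hg0 : gain_sum kv Y cnt BIG 0 = 0) by (unfold gain_sum; now rewrite sumz_empty by lia).
  destruct (q_sign_cases q) as [[-> _]|[-> _]].
  - rewrite !Z.mul_1_l. destruct (Z.leb_spec 0 (d + 1)), (Z.leb_spec 0 d), (Z.leb_spec 0 (d - 1)); try lia.
    + replace d with (d - 1 + 1) in * by lia.
      replace (d - 1 + 1 + 1) with (d - 1 + 1 + 1) by lia.
      rewrite (Hgs (d - 1 + 1)), (Hgs (d - 1)) by lia.
      replace (d - 1 + 1 - 1) with (d - 1) by lia.
      specialize (Hgn (d - 1) ltac:(lia)). lia.
    + assert (d = 0) by lia. subst d. rewrite (Hgs 0) by lia. rewrite Hg0.
      specialize (Hgb 0 ltac:(lia)). lia.
    + assert (d = -1) by lia. subst d. cbn [Z.add Z.pos_sub].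
      replace (-1 + 1) with 0 by lia. rewrite Hg0. lia.
  - destruct (Z.leb_spec 0 (-1 * (d + 1))), (Z.leb_spec 0 (-1 * d)), (Z.leb_spec 0 (-1 * (d - 1))); try lia.
    + replace (-1 * d) with (-1 * (d + 1) + 1) by lia.
      replace (-1 * (d - 1)) with (-1 * (d + 1) + 1 + 1) by lia.
      rewrite (Hgs (-1 * (d + 1) + 1)), (Hgs (-1 * (d + 1))) by lia.
      specialize (Hgn (-1 * (d + 1)) ltac:(lia)). lia.
    + assert (d = 0) by lia. subst d. replace (-1 * 0) with 0 by lia.
      replace (-1 * (0 - 1)) with (0 + 1) by lia. rewrite (Hgs 0), Hg0 by lia.
      specialize (Hgb 0 ltac:(lia)). lia.
    + assert (d = 1) by lia. subst d. replace (-1 * (1 - 1)) with 0 by lia. rewrite Hg0. lia.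
Qed.

(** True gains are at most [D * vm], so a single penalized copy already pushes the value down to
    [D * vm - BIG] or less. This gap separates possible from impossible changes. *)
Lemma table_step_ok :
  step_ok n D NN vm BIG S V U P q (fun d => F (NN + d)) li.
Proof.
  assert (Htop' := Htop). destruct Htop' as (T1 & T2 & T3 & T4 & T5 & T6).
  assert (Hkeys' := Hkeys). destruct Hkeys' as (K1 & K2 & K3).
  assert (Hlow : forall j, cnt < j -> gain_sum kv Y cnt BIG j <= D * vm - BIG).
  { intros j Hj. unfold gain_sum. rewrite (sumz_split _ 0 cnt) by lia.
    fold (gain_sum kv Y cnt BIG cnt). rewrite gain_sum_real by lia.
    pose proof (gain_real_le cnt ltac:(lia)).
    rewrite (sumz_ext _ (fun _ => - BIG) cnt j)
      by (intros x Hx; now rewrite (proj2 (Z.ltb_ge _ _)) by lia).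
    rewrite sumz_const by lia. assert (0 <= D * vm) by nia. nia. }
  assert (HDv : 0 <= D * vm) by nia.
  split; [|split; [|split]].
  - rewrite table_val by lia. rewrite Z.mul_0_r. cbn [Z.leb Z.compare].
    unfold gain_sum. now rewrite sumz_empty by lia.
  - intros d Hd. rewrite table_val by auto. destruct (Z.leb_spec 0 (q_sign q * d)); [|nia].
    destruct (Z_le_gt_dec (q_sign q * d) cnt).
    + rewrite gain_sum_real by lia. apply gain_real_le. lia.
    + specialize (Hlow (q_sign q * d)). lia.
  - intros d Hd Hlt c. rewrite table_val in Hlt by auto. fold c in Hlt.
    destruct (Z.leb_spec 0 c) as [Hc|Hc]; [|nia].
    assert (Hcc : c <= cnt) by (destruct (Z_le_gt_dec c cnt); auto; specialize (Hlow c); lia).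
    split; [lia|]. split; [|split].
    + rewrite table_val by auto. fold c. rewrite (proj2 (Z.leb_le _ _) Hc).
      rewrite gain_sum_real by lia. apply sumz_ext. intros x Hx. rewrite Hli by lia.
      apply K3. apply T4. lia.
    + intros x Hx. rewrite Hli by lia. destruct (K3 (Y x) (T4 x ltac:(lia))) as (E1 & E2 & _). auto.
    + intros i Hi. rewrite (sumz_ext _ (fun x => if ki (Y x) =? i then 1 else 0))
        by (intros x Hx; now rewrite Hli by lia).
      transitivity (sumz (fun x => if ki (Y x) =? i then 1 else 0) 0 cnt).
      { rewrite (sumz_split _ 0 c cnt) by lia.
        assert (0 <= sumz (fun x => if ki (Y x) =? i then 1 else 0) c cnt)
          by (apply sumz_nonneg; intros; destruct (_ =? _); lia). lia. }
      rewrite (T2 (fun e => if ki e =? i then 1 else 0)).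
      transitivity (sumz (fun e => if ki e =? i then step_w U P q (ki e) else 0) 0 m).
      { apply sumz_le. intros e He. destruct (K3 e He) as (_ & _ & _ & _ & <-).
        specialize (T3 e He). destruct (ki e =? i); lia. }
      rewrite (K2 (fun z => if z =? i then step_w U P q z else 0)).
      rewrite (sumz_single _ 0 n i).
      * rewrite Z.eqb_refl. specialize (HP i Hi). unfold step_w.
        destruct (S i =? q_size q), (q_par q =? 0); lia.
      * auto.
      * intros j Hj Hne. rewrite (proj2 (Z.eqb_neq _ _) Hne). now destruct (_ =? _).
  - intros y Hy HyD.
    assert (Hy0 : 0 <= sumz y 0 n) by (apply sumz_nonneg; intros i Hi; apply Hy; auto).
    assert (Ey : sumz (fun e => y (ki e)) 0 m = sumz y 0 n).
    { rewrite K2. apply sumz_ext. intros i Hi. specialize (Hy i Hi).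
      destruct (S i =? q_size q); lia. }
    destruct (best_copies kv kw Y (fun e => y (ki e)) occ m cnt D) as [B1 B2]; auto; try lia.
    { intros e He. destruct (K3 e He) as (E1 & E2 & _ & _ & ->). specialize (Hy _ E1).
      rewrite E2, Z.eqb_refl in Hy. auto. }
    rewrite Ey in B1, B2. rewrite table_val.
    2:{ destruct (q_sign_cases q) as [[-> _]|[-> _]]; lia. }
    replace (q_sign q * (q_sign q * sumz y 0 n)) with (sumz y 0 n)
      by (destruct (q_sign_cases q) as [[-> _]|[-> _]]; lia).
    rewrite (proj2 (Z.leb_le _ _) Hy0), gain_sum_real by lia.
    etransitivity; [|exact B2].
    rewrite (sumz_ext (fun e => kv e * y (ki e)) (fun e => q_sign q * V (ki e) * y (ki e)))
      by (intros e He; destruct (K3 e He) as (_ & _ & -> & _); auto).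
    rewrite (K2 (fun z => q_sign q * V z * y z)).
    apply Z.eq_le_incl, sumz_ext. intros i Hi. specialize (Hy i Hi).
    destruct (S i =? q_size q); [auto|]. replace (y i) with 0 by lia. lia.
Qed.

End TableFacts.

(** Changing copies of size [k] preserves the residue of the position modulo [k]. Each residue class
    is a square problem with [R] rows, and the [R] add up to [NN]. Results go to [a_H] first because
    the old table is still being read. *)
Definition convolve : cmd :=
  Asg r_r (#0) ;;
  While (CLt ($r_r) ($r_k))
    (Asg r_R (($r_NN - #1 - $r_r) / $r_k + #1) ;; smawk ;; Asg r_a (#0) ;;
     While (CLt ($r_a) ($r_R))
       (Asg r_b (a_row@[$r_a]) ;;
        Sto a_H ($r_r + $r_k * $r_a) (entry ($r_a) ($r_b)) ;;
        Sto a_ARG ($r_q * $r_NN + ($r_r + $r_k * $r_a)) ($r_a - $r_b) ;;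
        Asg r_a ($r_a + #1)) ;;
     Asg r_r ($r_r + #1)) ;;
  Asg r_i (#0) ;;
  While (CLt ($r_i) ($r_NN)) (Sto a_g ($r_i) (a_H@[$r_i]) ;; Asg r_i ($r_i + #1)).

Lemma convolve_spec B n s q k NN (g F : Z -> Z) :
  rg s r_q = q -> rg s r_k = k -> rg s r_NN = NN -> ar s a_g = g -> ar s a_F = F ->
  0 <= q -> 1 <= k <= NN -> (NN + 3) * (NN + 3) <= B -> (q + 1) * NN <= B ->
  concave NN (fun d => F (NN + d)) ->
  (forall i d, 0 <= i < NN -> - NN < d < NN -> Z.abs (g i + F (NN + d)) <= B) ->
  wp B n convolve s (fun s' t =>
    dp_ok NN k (fun d => F (NN + d)) g (ar s' a_g) (fun i => ar s' a_ARG (q * NN + i))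
    /\ (forall x, x < q * NN -> ar s' a_ARG x = ar s a_ARG x)
    /\ t <= 100 * NN).
Proof.
  intros Hq Hk HNN Hg HF Hq0 HkN HNB HqB Hconc HgF.
  assert (HqN : 0 <= q * NN) by (apply Z.mul_nonneg_nonneg; lia).
  assert (HB3 : NN * NN + 6 * NN + 9 <= B) by lia.
  assert (0 <= NN * NN) by (apply Z.mul_nonneg_nonneg; lia).
  set (good := fun (H ARG : Z -> Z) i =>
    0 <= i - k * ARG (q * NN + i) < NN
    /\ H i = g (i - k * ARG (q * NN + i)) + F (NN + ARG (q * NN + i))
    /\ forall d, 0 <= i - k * d < NN -> g (i - k * d) + F (NN + d) <= H i).
  assert (Hgood : forall H ARG H' ARG' i, H' i = H i -> ARG' (q * NN + i) = ARG (q * NN + i) ->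
    good H ARG i -> good H' ARG' i).
  { intros H1 A1 H2 A2 i E1 E2. unfold good. now rewrite E1, E2. }
  set (y := NN / k).
  pose proof (Z.div_mod NN k ltac:(lia)) as Dm. pose proof (Z.mod_pos_bound NN k ltac:(lia)) as Mb.
  fold y in Dm. assert (Hy0 : 0 <= y) by (apply Z.div_pos; lia).
  unfold convolve. ws. apply wp_seq.
  eapply wp_while with
    (I := fun s1 => 0 <= rg s1 r_r <= k
      /\ (forall r a, 0 <= r < rg s1 r_r -> 0 <= a -> r + k * a < NN ->
            good (ar s1 a_H) (ar s1 a_ARG) (r + k * a))
      /\ (forall x, x < q * NN -> ar s1 a_ARG x = ar s a_ARG x))
    (* A class has at most [y + 1] rows and costs about [42] per row; [k * y <= NN] and [k <= NN]
       make the total linear in [NN]. *)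
    (phi := fun s1 => (k - rg s1 r_r) * (42 * y + 46)).
  - simp. split; [lia|]. split; [intros; lia|auto].
  - intros s1 F1 (I1 & I2 & I3). frs. split; [sfty|apply Z.mul_nonneg_nonneg; lia].
  - intros s1 F1 (I1 & I2 & I3) Hb. frs. rewrite Hk in Hb. set (r := rg s1 r_r) in *.
    set (R := (NN - 1 - r) / k + 1).
    pose proof (Z.div_mod (NN - 1 - r) k ltac:(lia)) as Dm1.
    pose proof (Z.mod_pos_bound (NN - 1 - r) k ltac:(lia)) as Mb1.
    assert (HR0 : 0 <= (NN - 1 - r) / k) by (apply Z.div_pos; lia).
    assert (HRy : (NN - 1 - r) / k <= y) by (apply Z.div_le_mono; lia).
    assert (HRlast : r + k * (R - 1) <= NN - 1 < r + k * R) by (unfold R; lia).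
    assert (HRk : R - 1 <= k * (R - 1)).
    { assert (1 * (R - 1) <= k * (R - 1)) by (apply Z.mul_le_mono_nonneg_r; unfold R; lia). lia. }
    assert (HRr : forall b, 0 <= b < R -> 0 <= k * b /\ r + k * b < NN).
    { intros b Hbr. split; [apply Z.mul_nonneg_nonneg; lia|].
      assert (k * b <= k * (R - 1)) by (apply Z.mul_le_mono_nonneg_l; lia). lia. }
    assert (HRN : 1 <= R <= NN) by (unfold R in *; lia).
    apply wp_asg_seq.
    { sfty; rewrite ?Hk, ?HNN; fold r; fold R; try (unfold R in *; lia). }
    frs. rewrite HNN, Hk. fold r. fold R. fold r.
    apply wp_seq. eapply wp_conseq.
    { apply (smawk_spec B n g F r k R NN).
      - exact HRN.
      - intros b Hbr. specialize (HRr b Hbr). lia.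
      - auto.
      - intros a b Ha Hbr. unfold entry_val. apply HgF; [|lia]. specialize (HRr b Hbr). lia.
      (* The part from [g] depends on the column only and cancels; the rest is concavity at the four
         differences of row and column. *)
      - intros a a' b b' Ha Ha' Hbb Hb'. unfold entry_val.
        pose proof (concave_quad NN (fun d => F (NN + d)) (a - b') (a' - b') (b' - b)
          Hconc ltac:(lia) ltac:(lia) ltac:(lia)) as Hqd. cbv beta in Hqd.
        replace (a' - b' + (b' - b)) with (a' - b) in Hqd by lia.
        replace (a - b' + (b' - b)) with (a - b) in Hqd by lia. lia.
      - repeat split; frs; auto. }
    cbv beta. intros s2 t2 Ht2 F2 (J1 & J2).
    ws. apply wp_seq. set (row := ar s2 a_row) in *.
    eapply wp_while with
      (I := fun s3 => 0 <= rg s3 r_a <= R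
        /\ (forall r' a, 0 <= r' < r \/ r' = r /\ a < rg s3 r_a -> 0 <= a -> r' + k * a < NN ->
              good (ar s3 a_H) (ar s3 a_ARG) (r' + k * a))
        /\ (forall x, x < q * NN -> ar s3 a_ARG x = ar s a_ARG x))
      (phi := fun s3 => R - rg s3 r_a).
    + frs. split; [unfold R; lia|]. split; [|auto].
      intros r' a Hor Ha Hlt. apply I2; lia.
    + intros s3 F3 (K1 & K2 & K3). frs. split; [sfty|lia].
    + intros s3 F3 (K1 & K2 & K3) Hb3. frs. set (a := rg s3 r_a) in *.
      destruct (J1 a ltac:(lia)) as [R1 R2]. destruct (HRr a ltac:(lia)) as [R3 R4].
      destruct (HRr (row a) R1) as [R5 R6].
      apply wp_asg_seq; [sfty; fold a; lia|]. frs. fold a. fold row.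
      assert (Env : forall z, mat_env g F r k R NN (setr s3 r_b z))
        by (intros; repeat split; frs; auto).
      apply wp_sto_seq.
      { split; [|split].
        - sfty; fold a; fold r; rewrite ?Hk; lia.
        - apply (entry_safe B n g F r k R NN); auto;
            try exact I; try (frs; fold a; lia).
          + intros b Hbr. specialize (HRr b Hbr). lia.
          + intros a0 b Ha Hbr. unfold entry_val. apply HgF; [|lia]. specialize (HRr b Hbr). lia.
        - frs. fold r. rewrite Hk. fold a. lia. }
      rewrite (entry_ev g F r k R NN) by auto. frs. fold a. fold r. rewrite Hk.
      assert (Hqi : q * NN + (r + k * a) <= B) by lia.
      apply wp_sto_seq.
      { sfty; fold a; fold r; rewrite ?Hk, ?Hq, ?HNN; lia. }
      frs. fold a. fold r. rewrite Hk, Hq, HNN.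
      ws. fold a. split; [|lia]. split; [lia|]. split.
      * intros r' a' Hor Ha' Hlt.
        destruct (Z.eq_dec (r' + k * a') (r + k * a)) as [E|E].
        -- unfold good. rewrite E, !Z.eqb_refl.
           replace (r + k * a - k * (a - row a)) with (r + k * row a) by lia.
           split; [lia|]. split; [reflexivity|].
           intros d Hd. unfold entry_val in R2 |- *.
           (* An admissible change [d] comes from column [a - d] of the same residue class. *)
           assert (Hb1 : 0 <= a - d < R).
           { split.
             - destruct (Z_le_gt_dec 0 (a - d)); auto.
               assert (k * (a - d) <= k * -1) by (apply Z.mul_le_mono_nonneg_l; lia). lia.
             - destruct (Z_lt_le_dec (a - d) R); auto.
               assert (k * R <= k * (a - d)) by (apply Z.mul_le_mono_nonneg_l; lia). lia. }
           specialize (R2 (a - d) Hb1). replace (a - (a - d)) with d in R2 by lia.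
           replace (r + k * a - k * d) with (r + k * (a - d)) by lia. auto.
        -- apply Hgood with (ar s3 a_H) (ar s3 a_ARG).
           ++ now rewrite (proj2 (Z.eqb_neq _ _) E).
           ++ rewrite (proj2 (Z.eqb_neq _ _)); [auto|lia].
           ++ apply K2; auto. destruct Hor as [Hor|[-> Hor]]; [auto|right].
              split; auto. assert (a' <> a) by congruence. lia.
      * intros x Hx. destruct (Z.eqb_spec x (q * NN + (r + k * a))); [lia|auto].
    + intros s3 t3 Ht3 F3 (K1 & K2 & K3) Hb3 Ht3'. frs. ws; fold r; try lia.
      fold r. split; [|unfold R in *; lia]. split; [lia|]. split; [|auto].
      intros r' a Hr' Ha Hlt. apply K2; auto.
      destruct (Z.eq_dec r' r) as [->|]; [right|left; lia]. split; auto.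
      destruct (Z_lt_le_dec a R) as [|Hge]; [lia|].
      assert (k * R <= k * a) by (apply Z.mul_le_mono_nonneg_l; lia). lia.
  - intros s1 t1 Ht1 F1 (I1 & I2 & I3) Hb Ht1'. frs. rewrite Hk in *.
    assert (Er : rg s1 r_r = k) by lia. rewrite Er in *.
    ws.
    eapply wp_while with
      (I := fun s2 => 0 <= rg s2 r_i <= NN
        /\ (forall i, 0 <= i < rg s2 r_i -> ar s2 a_g i = ar s1 a_H i))
      (phi := fun s2 => NN - rg s2 r_i).
    + frs. split; [lia|]. intros; lia.
    + intros s2 F2 (J1 & J2). frs. split; [sfty|lia].
    + intros s2 F2 (J1 & J2) Hb2. frs. rewrite HNN in Hb2. ws.
      split; [|lia]. split; [lia|]. intros i Hi.
      destruct (Z.eqb_spec i (rg s2 r_i)) as [->|]; auto. apply J2. lia.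
    + intros s2 t2 Ht2 F2 (J1 & J2) Hb2 Ht2'. frs. rewrite HNN in *.
      assert (Ei : rg s2 r_i = NN) by lia. rewrite Ei in *.
      split; [|split; [auto|lia]].
      intros i Hi. rewrite J2 by auto.
      assert (Hi' : i = i mod k + k * (i / k)) by (pose proof (Z.div_mod i k); lia).
      pose proof (Z.mod_pos_bound i k ltac:(lia)).
      pose proof (Z.div_pos i k ltac:(lia) ltac:(lia)).
      rewrite Hi'. apply I2; auto; lia.
Qed.

Definition step : cmd :=
  Asg r_k ($r_q / #2 + #1) ;; Asg r_par ($r_q - #2 * ($r_q / #2)) ;;
  Asg r_sg (#1 - #2 * $r_par) ;; collect ;; top_copies ;; table ;; convolve.

(** Step [Q] writes only from [Q * D] and from [Q * NN] on, so the records of earlier steps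
    survive. *)
Lemma dp_inv_extend n D L NN vm BIG S V U P Q Fs gs LI ARG g F LI' ARG' g' :
  dp_inv n D L NN vm BIG S V U P Q Fs gs LI ARG g -> 0 <= Q -> 0 <= D -> 0 <= NN ->
  (forall x, x < Q * D -> LI' x = LI x) -> (forall x, x < Q * NN -> ARG' x = ARG x) ->
  step_ok n D NN vm BIG S V U P Q F (fun j => LI' (Q * D + j)) ->
  dp_ok NN (q_size Q) F g g' (fun i => ARG' (Q * NN + i)) ->
  exists Fs' gs', dp_inv n D L NN vm BIG S V U P (Q + 1) Fs' gs' LI' ARG' g'.
Proof.
  intros (H0 & HQ & Hst) HQ0 HD HN HLI HARG Hs Hd.
  exists (fun q => if q =? Q then F else Fs q).
  exists (fun q => if q =? Q + 1 then g' else gs q).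
  split; [|split].
  - intros i Hi. rewrite (proj2 (Z.eqb_neq 0 (Q + 1))) by lia. auto.
  - intros i Hi. now rewrite Z.eqb_refl.
  - intros q Hq. rewrite (proj2 (Z.eqb_neq q (Q + 1))) by lia.
    destruct (Z.eqb_spec q Q) as [->|Hne].
    + rewrite Z.eqb_refl. split; [auto|]. intros i Hi.
      destruct (Hd i Hi) as (D1 & D2 & D3).
      rewrite !HQ by auto. split; [auto|]. split; [auto|].
      intros d Hd'. rewrite HQ by auto. auto.
    + rewrite (proj2 (Z.eqb_neq (q + 1) (Q + 1))) by lia.
      destruct (Hst q ltac:(lia)) as [A1 A2].
      assert (E1 : forall j, 0 <= j < D -> LI' (q * D + j) = LI (q * D + j)).
      { intros j Hj. apply HLI. assert ((q + 1) * D <= Q * D)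
          by (apply Z.mul_le_mono_nonneg_r; lia). lia. }
      assert (E2 : forall i, 0 <= i < NN -> ARG' (q * NN + i) = ARG (q * NN + i)).
      { intros j Hj. apply HARG. assert ((q + 1) * NN <= Q * NN)
          by (apply Z.mul_le_mono_nonneg_r; lia). lia. }
      split.
      * destruct A1 as (B1 & B2 & B3 & B4). split; [auto|]. split; [auto|]. split; [|auto].
        intros d Hd1 Hd2 c. destruct (B3 d Hd1 Hd2) as (C1 & C2 & C3 & C4). fold c in C1, C2, C3, C4.
        split; [auto|]. split; [|split].
        -- rewrite C2. apply sumz_ext. intros x Hx. now rewrite E1 by lia.
        -- intros x Hx. rewrite E1 by lia. auto.
        -- intros i Hi. specialize (C4 i Hi).
           rewrite (sumz_ext _ (fun x => if LI (q * D + x) =? i then 1 else 0)); auto.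
           intros x Hx. now rewrite E1 by lia.
      * intros i Hi. destruct (A2 i Hi) as (C1 & C2 & C3). rewrite E2 by auto. auto.
Qed.

(** [BIG] exceeds [2 sm * (D * vm)], a bound on the gains of all steps together. Hence a final value
    that contains a penalty, or that started elsewhere than at [L], is negative. It also exceeds
    every single value, which concavity at 0 and at the end of the list needs. *)
Record dp_env (n sm vm : Z) (S V U P nx hd : Z -> Z) (s : st) : Prop := {
  env_s : 1 <= sm; env_vm : 0 <= vm; env_n : 0 <= n;
  env_D : rg s r_D = 2 * sm; env_L : rg s r_L = 2 * sm * sm;
  env_NN : rg s r_NN = 2 * (2 * sm * sm) + 1;
  env_BIG : rg s r_BIG = (2 * sm + 2) * (2 * sm * vm) + vm + 1;
  env_rvm : rg s r_vm = vm;
  env_aS : ar s a_S = S; env_aV : ar s a_V = V; env_aU : ar s a_U = U; env_aP : ar s a_P = P;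
  env_nx : ar s a_nx = nx; env_hd : ar s a_hd = hd;
  env_bucket : forall k, bucket n S nx hd k;
  env_range : forall i, 0 <= i < n -> 1 <= S i <= sm /\ 0 <= V i <= vm /\ 0 <= P i <= U i }.

Lemma step_w_nonneg U P q i : 0 <= P i <= U i -> 0 <= step_w U P q i <= U i.
Proof. unfold step_w. destruct (_ =? _); lia. Qed.

Lemma step_spec B n s sm vm S V U P nx hd q Fs gs :
  dp_env n sm vm S V U P nx hd s -> rg s r_q = q -> 0 <= q < 2 * sm ->
  let D := 2 * sm in let L := 2 * sm * sm in let NN := 2 * L + 1 in
  let BIG := (2 * sm + 2) * (2 * sm * vm) + vm + 1 in
  8 * n + 1 <= B -> 200 <= B -> vm + 2 <= B ->
  sumz U 0 n <= B -> BIG * (NN + 1) <= B -> (NN + 3) * (NN + 3) <= B -> (2 * sm + 1) * NN <= B ->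
  dp_inv n D L NN vm BIG S V U P q Fs gs (ar s a_LI) (ar s a_ARG) (ar s a_g) ->
  wp B n step s (fun s' t =>
    (exists Fs' gs', dp_inv n D L NN vm BIG S V U P (q + 1) Fs' gs'
       (ar s' a_LI) (ar s' a_ARG) (ar s' a_g))
    /\ t <= 4006 * class_size n S (q_size q) + 110 * NN).
Proof.
  intros Henv Hq Hq0 D L NN BIG HnB HB HvB HUB HBB HNB HqNB Hdp.
  destruct Henv as [Es Ev En ED EL ENN EBIG Ervm ES EV EU EP Enx Ehd Ebk Erg].
  assert (Hss : sm <= sm * sm) by nia.
  assert (HNN : 4 * sm + 1 <= NN) by (unfold NN, L; lia).
  assert (HDN : D < NN) by (unfold D; lia).
  assert (Hsv : 0 <= sm * vm) by nia.
  assert (Hssv : 0 <= sm * (sm * vm)) by nia.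
  assert (HBIGpos : D * vm < BIG /\ vm <= BIG /\ 2 * sm * (D * vm) <= BIG)
    by (unfold D, BIG; lia).
  assert (HDv : 0 <= D * vm) by (unfold D; lia).
  assert (HBIGN : BIG * 2 <= BIG * NN) by (apply Z.mul_le_mono_nonneg_l; lia).
  assert (HNNsq : NN * NN + 6 * NN + 9 <= B) by lia.
  assert (0 <= NN * NN) by (apply Z.mul_nonneg_nonneg; lia).
  pose proof (q_par_range q) as Hpr.
  pose proof (q_size_pos q ltac:(lia)) as Hk1.
  assert (Hk2 : q_size q <= sm).
  { unfold q_size. assert (q / 2 < sm) by (apply Z.div_lt_upper_bound; lia). lia. }
  assert (HUi : forall i, 0 <= i < n -> U i <= B).
  { intros i Hi. etransitivity; [|exact HUB]. apply sumz_term; auto.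
    intros j Hj. destruct (Erg j Hj) as (_ & _ & ?). lia. }
  unfold step.
  apply wp_asg_seq; [sfty; rewrite Hq; try discriminate; unfold q_size in *; lia|].
  frs. rewrite Hq. fold (q_size q).
  apply wp_asg_seq; [sfty; rewrite Hq; try discriminate; unfold q_size, q_par in *; lia|].
  frs. rewrite Hq. fold (q_par q).
  apply wp_asg_seq; [sfty; lia|]. frs. fold (q_sign q).
  apply wp_seq. eapply wp_conseq.
  { eapply collect_spec with (q := q) (vm := vm) (S := S) (V := V) (U := U) (P := P);
      frs; auto; try lia.
    - rewrite Enx, Ehd. apply Ebk.
    - intros i Hi. destruct (Erg i Hi) as (_ & ? & ?). specialize (HUi i Hi). lia. }
  cbv beta. intros s1 t1 Ht1 F1 (C1 & C2).
  pose proof (class_keys_size _ _ _ _ _ _ _ _ _ _ _ C1) as Em.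
  pose proof (class_size_le n S (q_size q) En) as Hcs.
  set (m := rg s1 r_m0) in *.
  assert (C1' := C1). destruct C1' as (M0 & M1 & M2).
  apply wp_seq. eapply wp_conseq.
  { eapply top_copies_spec with (m := m) (D := D) (vm := vm) (kv := ar s1 a_kV)
      (ks := ar s1 a_kS) (kw := ar s1 a_kW); frs; auto; try lia.
    - intros e He. destruct (M2 e He) as (A1 & A2 & A3 & A4 & A5).
      destruct (Erg _ A1) as (_ & B1 & B2). split; [auto|]. rewrite A3, A5.
      split; [destruct (q_sign_cases q) as [[-> _]|[-> _]]; lia|].
      apply step_w_nonneg; auto.
    - etransitivity; [|exact HUB].
      rewrite (sumz_ext (ar s1 a_kW) (fun e => step_w U P q (ar s1 a_kI e)))
        by (intros e He; apply M2; auto).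
      rewrite (M1 (fun z => step_w U P q z)). apply sumz_le. intros i Hi.
      destruct (Erg i Hi) as (_ & _ & B2). pose proof (step_w_nonneg U P q i B2).
      destruct (_ =? _); lia. }
  cbv beta. intros s2 t2 Ht2 F2 ((occ & T1) & T2).
  assert (Htab : forall x, 0 <= x < rg s2 r_cnt -> 0 <= ar s2 a_Y x < m
    /\ Z.abs (ar s1 a_kV (ar s2 a_Y x)) <= BIG).
  { intros x Hx. assert (T1' := T1). destruct T1' as (_ & _ & _ & T4 & _). split; [auto|].
    destruct (M2 _ (T4 x Hx)) as (A1 & _ & A3 & _). rewrite A3.
    destruct (Erg _ A1) as (_ & B1 & _).
    destruct (q_sign_cases q) as [[-> _]|[-> _]]; lia. }
  assert (Hcnt : 0 <= rg s2 r_cnt <= D) by apply T1.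
  assert (HqD : q * D + NN <= B).
  { assert (q * D <= (2 * sm) * NN) by (apply Z.mul_le_mono_nonneg; lia). lia. }
  apply wp_seq. eapply wp_conseq.
  { eapply table_spec with (q := q) (sg := q_sign q) (D := D) (NN := NN) (BIG := BIG) (m := m)
      (kv := ar s1 a_kV) (ki := ar s1 a_kI) (Y := ar s2 a_Y) (cnt := rg s2 r_cnt);
      frs; auto; try lia.
    destruct (q_sign_cases q); lia. }
  cbv beta. intros s3 t3 Ht3 F3 (G1 & G2 & G3 & G4).
  assert (Hconc : concave NN (fun d => ar s3 a_F (NN + d))).
  { eapply (table_concave n D NN vm BIG q m (rg s2 r_cnt) S V U P); eauto; try lia.
    intros i Hi. apply Erg; auto. }
  assert (Hstep : step_ok n D NN vm BIG S V U P q (fun d => ar s3 a_F (NN + d))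
    (fun j => ar s3 a_LI (q * D + j))).
  { eapply (table_step_ok n D NN vm BIG q m (rg s2 r_cnt) S V U P); eauto; try lia.
    - intros i Hi. apply Erg; auto.
    - intros i Hi. apply Erg; auto. }
  assert (Hgb : forall i, 0 <= i < NN -> - BIG <= ar s a_g i <= BIG).
  { intros i Hi. destruct Hdp as (D0 & D1 & D2). rewrite <- D1 by auto.
    pose proof (dp_bounds n D L NN vm BIG S V U P q Fs gs _ _ _ (conj D0 (conj D1 D2))
      ltac:(lia) HDv q ltac:(lia) i Hi).
    assert (q * (D * vm) <= 2 * sm * (D * vm)) by (apply Z.mul_le_mono_nonneg_r; lia). lia. }
  eapply wp_conseq.
  { eapply convolve_spec with (q := q) (k := q_size q) (NN := NN) (g := ar s a_g)
      (F := ar s3 a_F); frs; auto; try lia.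
    - assert ((q + 1) * NN <= (2 * sm + 1) * NN) by (apply Z.mul_le_mono_nonneg_r; lia). lia.
    - intros i d Hi Hd. specialize (Hgb i Hi).
      assert (Z.abs (ar s3 a_F (NN + d)) <= BIG * NN).
      { destruct (Z.abs_spec d) as [[Hd0 _]|[Hd0 _]].
        - destruct (q_sign_cases q) as [[E _]|[E _]]; destruct (G1 d ltac:(lia)) as [X1 X2];
            rewrite E in X1, X2.
          + replace (NN + 1 * d) with (NN + d) in X1 by lia. rewrite X1.
            etransitivity; [apply gain_sum_bound; try lia; intros; apply Htab; auto|].
            apply Z.mul_le_mono_nonneg_l; lia.
          + replace (NN - -1 * d) with (NN + d) in X2 by lia. rewrite X2.
            assert (0 <= BIG * d <= BIG * NN)
              by (split; [apply Z.mul_nonneg_nonneg; lia|apply Z.mul_le_mono_nonneg_l; lia]). lia.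
        - destruct (q_sign_cases q) as [[E _]|[E _]]; destruct (G1 (- d) ltac:(lia)) as [X1 X2];
            rewrite E in X1, X2.
          + replace (NN - 1 * - d) with (NN + d) in X2 by lia. rewrite X2.
            assert (0 <= BIG * - d <= BIG * NN)
              by (split; [apply Z.mul_nonneg_nonneg; lia|apply Z.mul_le_mono_nonneg_l; lia]). lia.
          + replace (NN + -1 * - d) with (NN + d) in X1 by lia. rewrite X1.
            etransitivity; [apply gain_sum_bound; try lia; intros; apply Htab; auto|].
            apply Z.mul_le_mono_nonneg_l; lia. }
      lia. }
  cbv beta. intros s4 t4 Ht4 F4 (N1 & N2 & N3). frs. split.
  - eapply dp_inv_extend with (F := fun d => ar s3 a_F (NN + d)); eauto; try lia.
  (* [NN] is [4 sm^2 + 1], so sorting at most [2 sm] copies is covered by a multiple of [NN]. *)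
  - assert (4 * (sm * sm) * 2 <= NN * 2) by (unfold NN, L; lia).
    unfold D in T2. lia.
Qed.

(** * The complete program *)

(** At most [2 s] copies of size at most [s] change the size by at most [L = 2 s^2] in either
    direction, which gives [2 L + 1] positions. Only the unchanged size, at [L], starts with value
    0. *)
Definition setup : cmd :=
  Asg r_D (#2 * $r_s) ;; Asg r_L ($r_D * $r_s) ;; Asg r_NN (#2 * $r_L + #1) ;;
  Asg r_BIG (($r_D + #2) * ($r_D * $r_vm) + $r_vm + #1) ;; Asg r_i (#0) ;;
  While (CLt ($r_i) ($r_NN)) (Sto a_g ($r_i) (#0 - $r_BIG) ;; Asg r_i ($r_i + #1)) ;;
  Sto a_g ($r_L) (#0).

Definition find_best : cmd :=
  Asg r_bi ($r_L) ;; Asg r_gb (a_g@[$r_L]) ;; Asg r_i (#0) ;;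
  While (CLt ($r_i) ($r_NN))
    (If (CAnd (CLt ($r_i - $r_L) ($r_rem + #1)) (CLt ($r_gb) (a_g@[$r_i])))
        (Asg r_bi ($r_i) ;; Asg r_gb (a_g@[$r_i])) Skip ;;
     Asg r_i ($r_i + #1)).

(** Recorded maximizers are followed from the last step to the first. Cell [2 e] of [a_TK] counts
    the added and cell [2 e + 1] the removed copies of item [e]. *)
Definition backtrack : cmd :=
  Asg r_q ($r_D) ;;
  While (CLt (#0) ($r_q))
    (Asg r_q ($r_q - #1) ;;
     Asg r_k ($r_q / #2 + #1) ;; Asg r_par ($r_q - #2 * ($r_q / #2)) ;;
     Asg r_sg (#1 - #2 * $r_par) ;;
     Asg r_dl (a_ARG@[$r_q * $r_NN + $r_bi]) ;; Asg r_j (#0) ;;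
     While (CLt ($r_j) ($r_sg * $r_dl))
       (Asg r_e (a_LI@[$r_q * $r_D + $r_j]) ;;
        Sto a_TK (#2 * $r_e + $r_par) (a_TK@[#2 * $r_e + $r_par] + #1) ;;
        Asg r_j ($r_j + #1)) ;;
     Asg r_bi ($r_bi - $r_k * $r_dl)).

(** Array 0 is raw memory, so cell [i] is where the output convention expects item [i]; the input is
    not read any more. *)
Definition write_output : cmd :=
  Asg r_i (#0) ;;
  While (CLt ($r_i) ($r_n))
    (Sto a_in ($r_i) (a_P@[$r_i] + a_TK@[#2 * $r_i] - a_TK@[#2 * $r_i + #1]) ;;
     Asg r_i ($r_i + #1)).

Definition main : cmd :=
  load ;; greedy ;; setup ;;
  Asg r_q (#0) ;; While (CLt ($r_q) ($r_D)) (step ;; Asg r_q ($r_q + #1)) ;;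
  find_best ;; backtrack ;; write_output.

Lemma setup_spec B n s sm vm :
  rg s r_s = sm -> rg s r_vm = vm -> 1 <= sm -> 0 <= vm ->
  let L := 2 * sm * sm in let NN := 2 * L + 1 in
  let BIG := (2 * sm + 2) * (2 * sm * vm) + vm + 1 in
  BIG * (NN + 1) <= B -> NN + 2 <= B ->
  wp B n setup s (fun s' t =>
    rg s' r_D = 2 * sm /\ rg s' r_L = L /\ rg s' r_NN = NN /\ rg s' r_BIG = BIG
    /\ (forall i, 0 <= i < NN -> ar s' a_g i = if i =? L then 0 else - BIG)
    /\ t <= NN + 1).
Proof.
  intros Hs Hvm Hs1 Hv0 L NN BIG HB1 HB2.
  assert (Hss : sm <= sm * sm) by nia.
  assert (Hsv : 0 <= sm * vm) by nia.
  assert (Hssv : 0 <= sm * (sm * vm)) by nia.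
  assert (HBB : BIG * 2 <= BIG * (NN + 1))
    by (apply Z.mul_le_mono_nonneg_l; unfold BIG, NN, L; lia).
  assert (HL : 0 <= L < NN) by (unfold NN, L; lia).
  unfold setup.
  ws; rewrite ?Hs, ?Hvm; try (unfold BIG, NN, L in *; lia).
  apply wp_seq.
  eapply wp_while with
    (I := fun s1 => 0 <= rg s1 r_i <= NN
      /\ (forall i, 0 <= i < rg s1 r_i -> ar s1 a_g i = - BIG))
    (phi := fun s1 => NN - rg s1 r_i).
  - frs. split; [lia|]. intros; lia.
  - intros s1 F1 (I1 & I2). frs. split; [sfty|lia].
  - intros s1 F1 (I1 & I2) Hb. frs. rewrite ?Hs, ?Hvm in *.
    replace (2 * (2 * sm * sm) + 1) with NN in * by (unfold NN, L; lia).
    ws; rewrite ?Hs, ?Hvm in *; try (unfold BIG in *; lia).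
    split; [|lia]. split; [lia|]. intros i Hi.
    destruct (Z.eqb_spec i (rg s1 r_i)); [unfold BIG; lia|apply I2; lia].
  - intros s1 t1 Ht1 F1 (I1 & I2) Hb Ht1'. frs. rewrite ?Hs, ?Hvm in *.
    replace (2 * (2 * sm * sm) + 1) with NN in * by (unfold NN, L; lia).
    ws; rewrite ?Hs, ?Hvm in *; try (unfold NN, L in *; lia).
    repeat split; auto; try lia.
    intros i Hi. fold L. destruct (Z.eqb_spec i L); auto. apply I2. lia.
Qed.

Lemma find_best_spec B n s L NN rem :
  rg s r_L = L -> rg s r_NN = NN -> rg s r_rem = rem -> 0 <= L < NN -> 0 <= rem ->
  rem + 1 <= B -> NN <= B ->
  wp B n find_best s (fun s' t =>
    0 <= rg s' r_bi < NN /\ rg s' r_bi - L <= rem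
    /\ (forall i, 0 <= i < NN -> i - L <= rem -> ar s a_g i <= ar s a_g (rg s' r_bi))
    /\ t <= NN + 1).
Proof.
  intros HL HNN Hrem HL0 Hr0 HrB HNB. unfold find_best. ws; rewrite ?HL; try lia.
  set (g := ar s a_g) in *.
  eapply wp_while with
    (I := fun s1 => 0 <= rg s1 r_i <= NN /\ 0 <= rg s1 r_bi < NN /\ rg s1 r_bi - L <= rem
      /\ rg s1 r_gb = g (rg s1 r_bi) /\ g L <= rg s1 r_gb
      /\ (forall i, 0 <= i < rg s1 r_i -> i - L <= rem -> g i <= g (rg s1 r_bi)))
    (phi := fun s1 => NN - rg s1 r_i).
  - simp. repeat split; try lia.
  - intros s1 F1 (I1 & I2 & I3 & I4 & I5 & I6). frs. split; [sfty|lia].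
  - intros s1 F1 (I1 & I2 & I3 & I4 & I5 & I6) Hb. frs. rewrite HNN in Hb.
    set (i := rg s1 r_i) in *.
    ws; fold_all i; fold_all g; rewrite ?HL, ?Hrem in *; try lia.
    + split; [|lia]. repeat split; auto; try lia. intros j Hj Hjr.
      destruct (Z.eq_dec j i) as [->|]; [lia|]. specialize (I6 j ltac:(lia) Hjr). lia.
    + split; [|lia]. repeat split; auto; try lia. intros j Hj Hjr.
      destruct (Z.eq_dec j i) as [->|]; [lia|]. apply I6; auto; lia.
  - intros s1 t1 Ht1 F1 (I1 & I2 & I3 & I4 & I5 & I6) Hb Ht1'. frs. rewrite HNN in *.
    repeat split; auto; try lia. intros i Hi Hir. apply I6; auto; lia.
Qed.

(** Double counting of the list entries, by item and by position. *)
Lemma sum_occurrences n (f li : Z -> Z) c :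
  (forall x, 0 <= x < c -> 0 <= li x < n) ->
  sumz (fun i => f i * sumz (fun x => if li x =? i then 1 else 0) 0 c) 0 n
  = sumz (fun x => f (li x)) 0 c.
Proof.
  intros H.
  rewrite (sumz_ext _ (fun i => sumz (fun x => f i * (if li x =? i then 1 else 0)) 0 c))
    by (intros; now rewrite sumz_scal).
  rewrite sumz_exchange. apply sumz_ext. intros x Hx.
  rewrite (sumz_single _ 0 n (li x)); [rewrite Z.eqb_refl; lia|auto|].
  intros i Hi Hne. rewrite (proj2 (Z.eqb_neq (li x) i)); lia.
Qed.

Lemma backtrack_spec B n s sm vm S V U P nx hd Fs gs :
  dp_env n sm vm S V U P nx hd s ->
  let D := 2 * sm in let L := 2 * sm * sm in let NN := 2 * L + 1 in
  let BIG := (2 * sm + 2) * (2 * sm * vm) + vm + 1 in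
  let b0 := rg s r_bi in
  0 <= b0 < NN -> 0 <= ar s a_g b0 -> (forall x, ar s a_TK x = 0) ->
  (2 * sm + 1) * NN <= B -> 2 * n + 2 <= B -> 200 <= B ->
  dp_inv n D L NN vm BIG S V U P (2 * sm) Fs gs (ar s a_LI) (ar s a_ARG) (ar s a_g) ->
  wp B n backtrack s (fun s' t => let TK := ar s' a_TK in
    (forall i, 0 <= i < n -> 0 <= TK (2 * i) <= U i - P i /\ 0 <= TK (2 * i + 1) <= P i)
    /\ sumz (fun i => V i * (TK (2 * i) - TK (2 * i + 1))) 0 n = ar s a_g b0
    /\ sumz (fun i => S i * (TK (2 * i) - TK (2 * i + 1))) 0 n = b0 - L
    /\ t <= 2 * sm * (D + 2) + 1).
Proof.
  intros Henv D L NN BIG b0 Hb0 Hgb0 HTK HNB HnB HB Hdp.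
  destruct Henv as [Es Ev En ED EL ENN EBIG Ervm ES EV EU EP Enx Ehd Ebk Erg].
  assert (Hss : sm <= sm * sm) by nia.
  assert (HNN : 4 * sm + 1 <= NN) by (unfold NN, L; lia).
  assert (Hsv : 0 <= sm * vm) by nia.
  assert (Hssv : 0 <= sm * (sm * vm)) by nia.
  assert (HDv : 0 <= D * vm) by (unfold D; lia).
  assert (HsN : sm <= sm * NN) by nia.
  assert (Hsss : 0 <= sm * (sm * sm)) by nia.
  pose proof (dp_bounds _ _ _ _ _ _ _ _ _ _ _ _ _ _ _ _ Hdp ltac:(unfold BIG; lia) HDv) as Hbnd.
  assert (Hdp' := Hdp). destruct Hdp' as (D0 & D1 & D2).
  set (LI := ar s a_LI) in *. set (ARG := ar s a_ARG) in *. set (G := ar s a_g b0) in *.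
  unfold backtrack. ws. rewrite ED.
  (* The last clause is what excludes penalties: the final value is nonnegative, and each step
     undone so far contributed at most [D * vm], which bounds the remaining value from below. *)
  eapply wp_while with
    (I := fun s1 => let Q := rg s1 r_q in let bi := rg s1 r_bi in let TK := ar s1 a_TK in
      0 <= Q <= 2 * sm /\ 0 <= bi < NN
      /\ (forall i, 0 <= i < n -> 0 <= TK (2 * i) <= U i - P i /\ 0 <= TK (2 * i + 1) <= P i
           /\ (2 * (S i - 1) < Q -> TK (2 * i) = 0)
           /\ (2 * (S i - 1) + 1 < Q -> TK (2 * i + 1) = 0))
      /\ sumz (fun i => V i * (TK (2 * i) - TK (2 * i + 1))) 0 n + gs Q bi = G
      /\ sumz (fun i => S i * (TK (2 * i) - TK (2 * i + 1))) 0 n + bi = b0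
      /\ - (2 * sm - Q) * (D * vm) <= gs Q bi)
    (phi := fun s1 => rg s1 r_q * (D + 2)).
  - frs. fold b0. split; [lia|]. split; [lia|]. split.
    { intros i Hi. rewrite !HTK. destruct (Erg i Hi) as (_ & _ & ?). repeat split; auto; lia. }
    rewrite D1 by auto. fold G.
    rewrite !sumz_zero by (intros; rewrite !HTK; lia).
    repeat split; lia.
  - intros s1 F1 (I1 & I2 & _). frs. split; [sfty|].
    apply Z.mul_nonneg_nonneg; unfold D; lia.
  - intros s1 F1 (I1 & I2 & I3 & I4 & I5 & I6) Hb. frs.
    set (Q := rg s1 r_q) in *. set (bi := rg s1 r_bi) in *. set (TK := ar s1 a_TK) in *.
    set (q := Q - 1).
    destruct (D2 q ltac:(unfold q; lia)) as [Hst Hdq].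
    destruct (Hdq bi I2) as (A1 & A2 & _). replace (q + 1) with Q in A2 by (unfold q; lia).
    set (dl := ARG (q * NN + bi)) in *.
    pose proof (q_size_pos q ltac:(unfold q; lia)) as Hk1.
    assert (Hk2 : q_size q <= sm).
    { unfold q_size. assert (q / 2 < sm) by (apply Z.div_lt_upper_bound; unfold q; lia). lia. }
    assert (Hdl : - NN < dl < NN) by exact (shift_range NN (q_size q) bi dl Hk1 I2 A1).
    destruct Hst as (S1 & S2 & S3 & _).
    pose proof (S2 dl Hdl) as Hup.
    pose proof (Hbnd q ltac:(unfold q; lia) _ A1) as Hbq.
    (* A penalized change would lose more than all the other steps can gain. *)
    assert (Hreal : D * vm - BIG < Fs q dl).
    { assert (q * (D * vm) + (2 * sm - Q) * (D * vm) <= 2 * sm * (D * vm)).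
      { replace (q * (D * vm) + (2 * sm - Q) * (D * vm)) with ((2 * sm - 1) * (D * vm))
          by (unfold q; ring). lia. }
      unfold BIG. unfold D in *. lia. }
    destruct (S3 dl Hdl Hreal) as (C1 & C2 & C3 & C4).
    set (c := q_sign q * dl) in *.
    assert (Hkc : q_size q * dl = q_sign q * (q_size q * c)).
    { unfold c. destruct (q_sign_cases q) as [[-> _]|[-> _]]; lia. }
    pose proof (q_par_range q) as Hpr.
    assert (HqN : 0 <= q * NN <= (2 * sm - 1) * NN).
    { split; [apply Z.mul_nonneg_nonneg; unfold q; lia|].
      apply Z.mul_le_mono_nonneg_r; unfold q; lia. }
    assert (HqD : 0 <= q * D <= (2 * sm - 1) * NN).
    { split; [apply Z.mul_nonneg_nonneg; unfold q, D; lia|].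
      apply Z.mul_le_mono_nonneg; unfold q, D; lia. }
    assert (HNp : 0 <= (2 * sm - 1) * NN) by lia.
    apply wp_asg_seq; [sfty; fold Q; lia|]. frs. fold Q. fold q.
    apply wp_asg_seq; [sfty; try discriminate; unfold q_size in *; lia|]. frs. fold (q_size q).
    apply wp_asg_seq; [sfty; try discriminate; unfold q_size, q_par in *; lia|].
    frs. fold (q_par q).
    apply wp_asg_seq; [sfty; lia|]. frs. fold (q_sign q).
    apply wp_asg_seq; [sfty; fold bi; rewrite ?ENN; fold L; fold NN; lia|].
    frs. fold bi. rewrite ENN. fold L. fold NN. fold ARG. fold dl.
    ws. apply wp_seq.
    set (par := q_par q) in *.
    eapply wp_while with
      (I := fun s2 => 0 <= rg s2 r_j <= c
        /\ (forall i, 0 <= i < n ->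
             ar s2 a_TK (2 * i + par) = TK (2 * i + par)
               + sumz (fun x => if LI (q * D + x) =? i then 1 else 0) 0 (rg s2 r_j)
             /\ ar s2 a_TK (2 * i + (1 - par)) = TK (2 * i + (1 - par))))
      (phi := fun s2 => c - rg s2 r_j).
    + frs. split; [lia|]. intros i Hi. rewrite sumz_empty by lia. fold TK. lia.
    + intros s2 F2 (J1 & J2). frs. fold c. split; [sfty; fold c; lia|lia].
    + intros s2 F2 (J1 & J2) Hb2. frs. fold c in Hb2. set (j := rg s2 r_j) in *.
      destruct (C3 j ltac:(lia)) as [L1 L2].
      set (e := LI (q * D + j)) in *.
      assert (HTe : 0 <= ar s2 a_TK (2 * e + par) <= D).
      { rewrite (proj1 (J2 e L1)).
        (* No other step touches this counter, so it was 0 before the current step; this bounds it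
           by [D]. *)
        assert (E0 : TK (2 * e + par) = 0).
        { destruct (I3 e L1) as (_ & _ & Z1 & Z2). unfold par in *.
          unfold q_size, q_par in L2, Hpr |- *.
          destruct (Z.eq_dec (q - 2 * (q / 2)) 0) as [E|E].
          - rewrite E, Z.add_0_r. apply Z1. unfold q in *. lia.
          - replace (q - 2 * (q / 2)) with 1 by lia. apply Z2. unfold q in *. lia. }
        rewrite E0. split.
        - apply Z.add_nonneg_nonneg; [lia|]. apply sumz_nonneg. intros; destruct (_ =? _); lia.
        - transitivity (0 + sumz (fun _ => 1) 0 j).
          + apply Z.add_le_mono_l, sumz_le. intros; destruct (_ =? _); lia.
          + rewrite sumz_const by lia. lia. }
      apply wp_asg_seq; [sfty; fold j; rewrite ?ED; fold D; lia|].
      frs. fold j. rewrite ED. fold D. fold LI. fold e.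
      apply wp_sto_seq; [sfty; fold par; lia|]. frs. fold par.
      ws; fold j; try lia. split; [|lia]. split; [lia|].
      intros i Hi. destruct (J2 i Hi) as [J3 J4]. rewrite sumz_last by lia. fold e.
      split.
      * destruct (Z.eqb_spec (2 * i + par) (2 * e + par)) as [E|E].
        -- assert (i = e) by lia. subst i. rewrite Z.eqb_refl, J3. fold j. lia.
        -- rewrite (proj2 (Z.eqb_neq e i)) by lia. rewrite J3. fold j. lia.
      * destruct (Z.eqb_spec (2 * i + (1 - par)) (2 * e + par)); [lia|auto].
    + intros s2 t2 Ht2 F2 (J1 & J2) Hb2 Ht2'. frs. fold c in Hb2.
      assert (Ej : rg s2 r_j = c) by lia. rewrite Ej in *.
      ws; fold bi; fold dl; try lia.
      fold Q bi dl. fold q.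
      set (o := fun i => sumz (fun x => if LI (q * D + x) =? i then 1 else 0) 0 c) in *.
      assert (Ho0 : forall i, 0 <= i < n -> S i <> q_size q -> o i = 0).
      { intros i Hi Hne. unfold o. apply sumz_zero. intros x Hx.
        destruct (C3 x Hx) as [_ L2]. destruct (Z.eqb_spec (LI (q * D + x)) i); [|auto].
        congruence. }
      assert (Ho1 : forall i, 0 <= i < n -> 0 <= o i <= step_w U P q i).
      { intros i Hi. split; [|apply C4; auto]. unfold o. apply sumz_nonneg.
        intros; destruct (_ =? _); lia. }
      assert (HT : forall i, 0 <= i < n ->
        ar s2 a_TK (2 * i) - ar s2 a_TK (2 * i + 1)
        = TK (2 * i) - TK (2 * i + 1) + q_sign q * o i).
      { intros i Hi. destruct (J2 i Hi) as [J3 J4]. fold (o i) in J3. unfold q_sign. fold par.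
        destruct (Z.eq_dec par 0) as [E|E].
        - rewrite E in *. rewrite !Z.add_0_r in J3. replace (1 - 0) with 1 in J4 by lia. lia.
        - replace par with 1 in * by lia. replace (1 - 1) with 0 in J4 by lia.
          rewrite !Z.add_0_r in J4. lia. }
      assert (HTf : forall f, sumz (fun i => f i * (ar s2 a_TK (2 * i) - ar s2 a_TK (2 * i + 1))) 0 n
        = sumz (fun i => f i * (TK (2 * i) - TK (2 * i + 1))) 0 n
          + q_sign q * sumz (fun x => f (LI (q * D + x))) 0 c).
      { intros f.
        rewrite <- (sum_occurrences n f (fun x => LI (q * D + x)) c)
          by (intros x Hx; apply C3; auto).
        rewrite <- sumz_scal, <- sumz_add. apply sumz_ext. intros i Hi.
        rewrite HT by auto. fold (o i). lia. }
      split; [|lia].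
      split; [unfold q; lia|]. split; [lia|]. split; [|split; [|split]].
      * intros i Hi. destruct (J2 i Hi) as [J3 J4]. fold (o i) in J3.
        destruct (I3 i Hi) as (X1 & X2 & X3 & X4). specialize (Ho1 i Hi). specialize (Ho0 i Hi).
        pose proof (Z.div_mod q 2 ltac:(lia)) as Dm.
        assert (Hpar : q = 2 * (q_size q - 1) + par) by (unfold par, q_par, q_size; lia).
        unfold step_w in Ho1. fold par in Ho1.
        destruct (Z.eq_dec par 0) as [E|E].
        -- rewrite E in *. rewrite !Z.add_0_r in J3. replace (1 - 0) with 1 in J4 by lia.
           cbn [Z.eqb] in Ho1. destruct (Z.eq_dec (S i) (q_size q)) as [Ek|Ek].
           ++ specialize (X3 ltac:(unfold q in *; lia)). repeat split; try lia;
                intros; rewrite ?J4; try apply X4; unfold q in *; lia.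
           ++ specialize (Ho0 Ek). repeat split; try lia;
                intros; rewrite ?J3, ?J4, ?Ho0, ?Z.add_0_r; try apply X3; try apply X4;
                unfold q in *; lia.
        -- replace par with 1 in * by lia. replace (1 - 1) with 0 in J4 by lia.
           rewrite !Z.add_0_r in J4. cbn [Z.eqb] in Ho1.
           destruct (Z.eq_dec (S i) (q_size q)) as [Ek|Ek].
           ++ specialize (X4 ltac:(unfold q in *; lia)). repeat split; try lia;
                intros; rewrite ?J4; try apply X3; unfold q in *; lia.
           ++ specialize (Ho0 Ek). repeat split; try lia;
                intros; rewrite ?J3, ?J4, ?Ho0, ?Z.add_0_r; try apply X3; try apply X4;
                unfold q in *; lia.
      * rewrite HTf, <- sumz_scal, <- C2. lia.
      * rewrite HTf.
        rewrite (sumz_ext (fun x => S (LI (q * D + x))) (fun _ => q_size q))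
          by (intros x Hx; apply C3; auto).
        rewrite sumz_const by lia. replace (c - 0) with c by lia. lia.
      * unfold q in *. lia.
  - intros s1 t1 Ht1 F1 (I1 & I2 & I3 & I4 & I5 & I6) Hb Ht1'. frs.
    assert (EQ : rg s1 r_q = 0) by lia. rewrite EQ in *.
    (* Every position other than [L] starts at [- BIG], below the bound of the invariant. *)
    assert (Ebi : rg s1 r_bi = L).
    { destruct (Z.eq_dec (rg s1 r_bi) L) as [|Hne]; auto. exfalso.
      rewrite D0 in I6 by auto. rewrite (proj2 (Z.eqb_neq _ _) Hne) in I6.
      unfold BIG, D in I6. lia. }
    rewrite Ebi in *. rewrite D0, Z.eqb_refl in I4 by (unfold NN, L; lia).
    split; [|split; [lia|split; [lia|unfold D in *; lia]]].
    intros i Hi. destruct (I3 i Hi) as (X1 & X2 & _). auto.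
Qed.

Lemma write_output_spec B n s (P TK : Z -> Z) :
  rg s r_n = n -> 0 <= n -> 2 * n + 2 <= B -> ar s a_P = P -> ar s a_TK = TK ->
  (forall i, 0 <= i < n -> Z.abs (P i + TK (2 * i)) <= B
     /\ Z.abs (P i + TK (2 * i) - TK (2 * i + 1)) <= B) ->
  wp B n write_output s (fun s' t =>
    (forall i, 0 <= i < n -> ar s' a_in i = P i + TK (2 * i) - TK (2 * i + 1)) /\ t <= n + 1).
Proof.
  intros Hn Hn0 HnB HP HTK Hb. unfold write_output. ws.
  eapply wp_while with
    (I := fun s1 => 0 <= rg s1 r_i <= n
      /\ (forall i, 0 <= i < rg s1 r_i -> ar s1 a_in i = P i + TK (2 * i) - TK (2 * i + 1)))
    (phi := fun s1 => n - rg s1 r_i).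
  - frs. split; [lia|]. intros; lia.
  - intros s1 F1 (I1 & I2). frs. split; [sfty|lia].
  - intros s1 F1 (I1 & I2) Hc. frs. rewrite Hn in Hc. set (i := rg s1 r_i) in *.
    destruct (Hb i ltac:(lia)) as [B1 B2].
    ws; fold i; rewrite ?HP, ?HTK; try lia.
    split; [|lia]. split; [lia|]. intros j Hj.
    destruct (Z.eqb_spec j i) as [->|]; auto. apply I2. lia.
  - intros s1 t1 Ht1 F1 (I1 & I2) Hc Ht1'. frs. rewrite Hn in *.
    split; [|lia]. intros i Hi. apply I2. lia.
Qed.

Lemma bucket_ext n S S' nx hd k :
  (forall i, 0 <= i < n -> S' i = S i) -> bucket n S nx hd k -> bucket n S' nx hd k.
Proof.
  intros He (l & L1 & L2 & L3). exists l. split; [auto|]. split.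
  - intros x Hx. destruct (L2 x Hx). split; auto. rewrite He; auto.
  - intros f. rewrite L3. apply sumz_ext. intros i Hi. now rewrite He.
Qed.

Lemma main_spec B n s X t (sz vl mu : Z -> Z) :
  rg s r_n = n -> rg s r_t = t -> 2 <= X -> B = X ^ 12 -> 0 <= n <= X -> 0 <= t <= X ->
  (forall i, 0 <= i < n -> ar s a_in (3 * i) = sz i /\ ar s a_in (3 * i + 1) = vl i
     /\ ar s a_in (3 * i + 2) = mu i /\ 1 <= sz i <= X /\ Z.abs (vl i) <= X /\ 1 <= mu i <= X) ->
  (forall k, ar s a_hd k = 0) -> (forall k, ar s a_TK k = 0) ->
  wp B n main s (fun s' tm => let x := ar s' a_in in
    (forall i, 0 <= i < n -> 0 <= x i <= mu i)
    /\ sumz (fun i => sz i * x i) 0 n <= t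
    /\ (forall y, (forall i, 0 <= i < n -> 0 <= y i <= mu i) ->
          sumz (fun i => sz i * y i) 0 n <= t ->
          sumz (fun i => vl i * y i) 0 n <= sumz (fun i => vl i * x i) 0 n)
    /\ exists sm, 1 <= sm /\ (sm = 1 \/ exists i, 0 <= i < n /\ sm = sz i)
       /\ tm <= 20000 * (n + sm ^ 3)).
Proof.
  intros Hn Ht HX HBX HnX HtX Hin Hhd HTK.
  (* The products formed below stay within a constant multiple of [X^5], the extreme one being
     [BIG * (NN + 1) <= 35 X^5]; the remaining seven factors [X >= 2] give 128. *)
  assert (HB : 128 * (X * (X * (X * (X * X)))) <= B).
  { rewrite HBX. replace (X ^ 12) with (X * (X * (X * (X * (X * (X * (X * (X * (X * (X * (X * X))))))))))) by ring.
    assert (H2 : forall z, 0 <= z -> 2 * z <= X * z) by (intros; nia).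
    set (x5 := X * (X * (X * (X * X)))). assert (0 <= x5) by (unfold x5; nia).
    pose proof (H2 x5 ltac:(lia)). pose proof (H2 (X * x5) ltac:(lia)).
    pose proof (H2 (X * (X * x5)) ltac:(lia)).
    pose proof (H2 (X * (X * (X * x5))) ltac:(lia)).
    pose proof (H2 (X * (X * (X * (X * x5)))) ltac:(lia)).
    pose proof (H2 (X * (X * (X * (X * (X * x5))))) ltac:(lia)).
    pose proof (H2 (X * (X * (X * (X * (X * (X * x5)))))) ltac:(lia)). lia. }
  set (X2 := X * X) in *. set (X3 := X * X2) in *. set (X4 := X * X3) in *.
  set (X5 := X * X4) in *.
  assert (HX2 : 2 * X <= X2) by (unfold X2; nia).
  assert (HX3 : 2 * X2 <= X3) by (unfold X3; nia).
  assert (HX4 : 2 * X3 <= X4) by (unfold X4; nia).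
  assert (HX5 : 2 * X4 <= X5) by (unfold X5; nia).
  clear HBX. unfold main.
  apply wp_seq. eapply wp_conseq.
  { eapply load_spec with (X := X) (sz := sz) (vl := vl) (mu := mu); auto. lia. }
  cbv beta zeta. intros s1 t1 Ht1 F1 (A1 & A2 & A3 & A4 & A5 & A6). frs.
  set (S := ar s1 a_S) in *. set (V := ar s1 a_V) in *. set (U := ar s1 a_U) in *.
  set (sm := rg s1 r_s) in *. set (vm := rg s1 r_vm) in *.
  assert (HS : forall i, 0 <= i < n -> S i = sz i) by (intros i Hi; apply A1; auto).
  assert (HV : forall i, 0 <= i < n -> V i = if vl i <? 1 then 0 else vl i)
    by (intros i Hi; apply A1; auto).
  assert (HU : forall i, 0 <= i < n -> U i = if vl i <? 1 then 0 else mu i)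
    by (intros i Hi; apply A1; auto).
  assert (Hrg : forall i, 0 <= i < n -> 1 <= S i <= sm /\ 0 <= V i <= vm /\ 0 <= U i <= X).
  { intros i Hi. destruct (Hin i Hi) as (_ & _ & _ & R1 & R2 & R3). destruct (A4 i Hi) as [R4 R5].
    rewrite HS, HV, HU by auto. destruct (Z.ltb_spec (vl i) 1); lia. }
  assert (HsmX : 1 <= sm <= X).
  { destruct A2 as [? [->|(i & Hi & ->)]]; [lia|]. apply Hin; auto. }
  assert (HvmX : 0 <= vm <= X).
  { destruct A3 as [? [->|(i & Hi & E)]]; [lia|]. destruct (Hin i Hi) as (_ & _ & _ & _ & R2 & _).
    rewrite E. destruct (Z.ltb_spec (vl i) 1); lia. }
  assert (HSU : sumz (fun i => S i * U i) 0 n <= X3).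
  { transitivity (sumz (fun _ => X * X) 0 n).
    - apply sumz_le. intros i Hi. destruct (Hrg i Hi) as (R1 & _ & R3).
      apply Z.mul_le_mono_nonneg; lia.
    - rewrite sumz_const by lia. fold X2. unfold X3.
      replace (X2 * (n - 0)) with (n * X2) by lia. apply Z.mul_le_mono_nonneg_r; lia. }
  assert (HUs : sumz U 0 n <= X2).
  { transitivity (sumz (fun _ => X) 0 n).
    - apply sumz_le. intros i Hi. apply Hrg; auto.
    - rewrite sumz_const by lia. unfold X2.
      replace (X * (n - 0)) with (n * X) by lia. apply Z.mul_le_mono_nonneg_r; lia. }
  assert (Hvs : (vm + 1) * sm <= (X + 1) * X) by (apply Z.mul_le_mono_nonneg; lia).
  replace ((X + 1) * X) with (X2 + X) in Hvs by (unfold X2; ring).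
  apply wp_seq. eapply wp_conseq.
  { eapply greedy_spec with (t := t) (vm := vm) (sm := sm) (S := S) (V := V) (U := U);
      frs; auto; try lia.
    - intros i Hi. destruct (Hrg i Hi) as (R1 & R2 & R3).
      destruct (A1 i Hi) as (E1 & E2 & E3 & E4 & E5 & E6). fold S in E1. fold V in E2. fold U in E3.
      rewrite E4, E5, E6, <- E1, <- E2, <- E3. repeat split; auto; lia.
    - intros i Hi. destruct (Hrg i Hi) as (R1 & R2 & R3). lia. }
  cbv beta. intros s2 t2 Ht2 F2 (G & T2). frs.
  set (P := ar s2 a_P) in *. set (rem := rg s2 r_rem) in *.
  destruct G as (G1 & G2 & G3 & (xv & xs & G4 & G5 & G6) & G7).
  set (L := 2 * sm * sm). set (NN := 2 * L + 1).
  set (BIG := (2 * sm + 2) * (2 * sm * vm) + vm + 1).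
  assert (Hss : sm <= sm * sm <= X2).
  { split; [assert (1 * sm <= sm * sm) by (apply Z.mul_le_mono_nonneg_r; lia); lia|].
    unfold X2. apply Z.mul_le_mono_nonneg; lia. }
  assert (Hsss : sm * sm <= sm * (sm * sm)).
  { assert (1 * (sm * sm) <= sm * (sm * sm)) by (apply Z.mul_le_mono_nonneg_r; lia). lia. }
  assert (HNN : NN + 1 <= 5 * X2) by (unfold NN, L; lia).
  assert (HNN1 : 5 <= NN) by (unfold NN, L; lia).
  assert (HBIG : 0 <= BIG <= 7 * X3).
  { unfold BIG. assert (V1 : 0 <= sm * vm <= X2)
      by (split; [apply Z.mul_nonneg_nonneg; lia|unfold X2; apply Z.mul_le_mono_nonneg; lia]).
    assert (V2 : 0 <= sm * (sm * vm) <= X3)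
      by (split; [apply Z.mul_nonneg_nonneg; lia|unfold X3; apply Z.mul_le_mono_nonneg; lia]). lia. }
  assert (HBN : BIG * (NN + 1) <= B).
  { assert (BIG * (NN + 1) <= 7 * X3 * (5 * X2)) by (apply Z.mul_le_mono_nonneg; lia).
    replace (7 * X3 * (5 * X2)) with (35 * X5) in H by (unfold X5, X4, X3, X2; ring). lia. }
  assert (HNsq : (NN + 3) * (NN + 3) <= B).
  { assert ((NN + 3) * (NN + 3) <= (6 * X2) * (6 * X2)) by (apply Z.mul_le_mono_nonneg; lia).
    replace (6 * X2 * (6 * X2)) with (36 * X4) in H by (unfold X4, X3, X2; ring). lia. }
  assert (HsN : (2 * sm + 1) * NN <= B).
  { assert ((2 * sm + 1) * NN <= (3 * X) * (5 * X2)) by (apply Z.mul_le_mono_nonneg; lia).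
    replace (3 * X * (5 * X2)) with (15 * X3) in H by (unfold X3, X2; ring). lia. }
  assert (HPnn : 0 <= sumz (fun i => S i * P i) 0 n).
  { apply sumz_nonneg. intros i Hi. specialize (G1 i Hi). destruct (Hrg i Hi) as (R1 & _).
    apply Z.mul_nonneg_nonneg; lia. }
  apply wp_seq. eapply wp_conseq.
  { eapply setup_spec with (sm := sm) (vm := vm); frs; auto; try lia. }
  cbv beta zeta. intros s3 t3 Ht3 F3 (C1 & C2 & C3 & C4 & C5 & C6).
  fold L in C2, C3, C5, C6. fold NN in C3, C5, C6. fold BIG in C4, C5.
  ws. apply wp_seq.
  assert (Henv : forall s4, rg s4 r_D = 2 * sm -> rg s4 r_L = L -> rg s4 r_NN = NN ->
    rg s4 r_BIG = BIG -> rg s4 r_vm = vm -> ar s4 a_S = S -> ar s4 a_V = V -> ar s4 a_U = U ->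
    ar s4 a_P = P -> ar s4 a_nx = ar s1 a_nx -> ar s4 a_hd = ar s1 a_hd ->
    dp_env n sm vm S V U P (ar s1 a_nx) (ar s1 a_hd) s4).
  { intros s4 E1 E2 E3 E4 E5 E6 E7 E8 E9 E10 E11. constructor; auto; try lia.
    - intros k. apply bucket_ext with sz; auto.
    - intros i Hi. destruct (Hrg i Hi) as (R1 & R2 & R3). specialize (G1 i Hi). lia. }
  eapply wp_while with
    (I := fun s4 => 0 <= rg s4 r_q <= 2 * sm
      /\ exists Fs gs, dp_inv n (2 * sm) L NN vm BIG S V U P (rg s4 r_q) Fs gs
           (ar s4 a_LI) (ar s4 a_ARG) (ar s4 a_g))
    (* The steps have different costs, depending on the sizes of their classes; the potential adds
       up those still to come. *)
    (phi := fun s4 => sumz (fun q => 4006 * class_size n S (q_size q) + (110 * NN + 1))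
                       (rg s4 r_q) (2 * sm)).
  - simp. split; [lia|]. exists (fun _ _ => 0), (fun _ => ar s3 a_g).
    split; [auto|]. split; [auto|]. intros; lia.
  - intros s4 F4 (I1 & I2). frs. split; [sfty|]. apply sumz_nonneg. intros q Hq.
    pose proof (class_size_le n S (q_size q)). lia.
  - intros s4 F4 (I1 & Fs & gs & I2) Hb. frs. rewrite C1 in Hb.
    set (q := rg s4 r_q) in *.
    apply wp_seq. eapply wp_conseq.
    { eapply step_spec with (sm := sm) (vm := vm) (S := S) (V := V) (U := U) (P := P) (q := q)
        (Fs := Fs) (gs := gs); auto; try lia; try exact I2. apply Henv; frs; auto. }
    cbv beta zeta. intros s5 t5 Ht5 F5 (J1 & J2).
    ws; fold q; try lia. fold q. split; [split; [lia|exact J1]|].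
    fold L in J2. fold NN in J2.
    rewrite (sumz_first _ q) by lia. lia.
  - intros s4 t4 Ht4 F4 (I1 & Fs & gs & I2) Hb Ht4'. frs. rewrite C1 in Hb.
    assert (Eq : rg s4 r_q = 2 * sm) by lia. rewrite Eq in *.
    rewrite (sumz_empty _ (2 * sm) (2 * sm)) in Ht4' by lia.
    set (g := ar s4 a_g) in *.
    apply wp_seq. eapply wp_conseq.
    { eapply find_best_spec with (L := L) (NN := NN) (rem := rem); frs; auto; lia. }
    cbv beta. intros s5 t5 Ht5 F5 (K1 & K2 & K3 & K4). frs. fold g in K3.
    set (bi := rg s5 r_bi) in *.
    assert (Hcomp : forall x, (forall i, 0 <= i < n -> 0 <= x i <= U i) ->
      sumz (fun i => Z.abs (x i - P i)) 0 n <= 2 * sm ->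
      sumz (fun i => S i * x i) 0 n <= t ->
      sumz (fun i => V i * (x i - P i)) 0 n <= g bi).
    { intros x Hx Hl1 Hxt.
      destruct (dp_complete n sm vm BIG S V U P Fs gs (ar s4 a_LI) (ar s4 a_ARG) g x) as [D1 D2];
        auto; try lia.
      - intros i Hi. apply Hrg; auto.
      - etransitivity; [exact D2|]. apply K3; auto.
        assert (E : sumz (fun i => S i * (x i - P i)) 0 n
          = sumz (fun i => S i * x i) 0 n + -1 * sumz (fun i => S i * P i) 0 n).
        { rewrite <- sumz_scal, <- sumz_add. apply sumz_ext. intros; lia. }
        fold L. lia. }
    (* The greedy solution is itself a candidate, with change 0. *)
    assert (Hg0 : 0 <= g bi).
    { etransitivity; [|apply (Hcomp P)]; auto; try lia.
      - rewrite sumz_zero; intros; lia.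
      - rewrite sumz_zero; intros; lia. }
    apply wp_seq. eapply wp_conseq.
    { eapply backtrack_spec with (sm := sm) (vm := vm) (S := S) (V := V) (U := U) (P := P)
        (Fs := Fs) (gs := gs); try lia.
      - apply Henv; frs; auto.
      - frs. exact Hg0.
      - intros k. frs. auto.
      - frs. exact I2. }
    cbv beta zeta. intros s6 t6 Ht6 F6 (M1 & M2 & M3 & M4). fold bi in M2, M3.
    set (TK := ar s6 a_TK) in *.
    eapply wp_conseq.
    { eapply write_output_spec with (P := P) (TK := TK); frs; auto; try lia.
      intros i Hi. destruct (M1 i Hi) as [N1 N2]. destruct (Hrg i Hi) as (_ & _ & R3).
      specialize (G1 i Hi). lia. }
    cbv beta. intros s7 t7 Ht7 F7 (W1 & W2).
    set (x := ar s7 a_in) in *.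
    assert (Hx : forall i, 0 <= i < n -> 0 <= x i <= U i).
    { intros i Hi. rewrite W1 by auto. destruct (M1 i Hi). specialize (G1 i Hi). lia. }
    assert (Hsum : forall f, sumz (fun i => f i * x i) 0 n = sumz (fun i => f i * P i) 0 n
      + sumz (fun i => f i * (TK (2 * i) - TK (2 * i + 1))) 0 n).
    { intros f. rewrite <- sumz_add. apply sumz_ext. intros i Hi. rewrite W1 by auto. lia. }
    assert (Hvx : sumz (fun i => vl i * x i) 0 n = sumz (fun i => V i * x i) 0 n).
    { apply sumz_ext. intros i Hi. specialize (Hx i Hi). rewrite HV by auto.
      rewrite HU in Hx by auto. destruct (Z.ltb_spec (vl i) 1); [|auto].
      replace (x i) with 0 by lia. lia. }
    split; [|split; [|split]].
    + intros i Hi. specialize (Hx i Hi). rewrite HU in Hx by auto.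
      destruct (Hin i Hi) as (_ & _ & _ & _ & _ & R). destruct (Z.ltb_spec (vl i) 1); lia.
    + rewrite (sumz_ext _ (fun i => S i * x i)) by (intros i Hi; now rewrite HS by auto).
      rewrite Hsum, M3. fold L. lia.
    + intros y Hy Hyt.
      (* Dropping the items of value below 1 keeps [y] feasible, does not lower its value, and
         respects the multiplicities [U]. *)
      set (y' := fun i => if vl i <? 1 then 0 else y i).
      destruct (proximity n sm t xv xs S V U P) with (x := y')
        as (x' & X1 & X2' & X3' & X4'); auto; try lia.
      * intros i Hi. destruct (Hrg i Hi) as (R1 & R2 & R3). specialize (G1 i Hi). lia.
      * destruct G7 as [G7|G7]; [left; lia|right; auto].
      * intros i Hi. unfold y'. rewrite HU by auto. specialize (Hy i Hi).
        destruct (vl i <? 1); lia.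
      * etransitivity; [|exact Hyt]. apply sumz_le. intros i Hi. unfold y'.
        rewrite HS by auto. specialize (Hy i Hi). destruct (Hin i Hi) as (_ & _ & _ & R & _).
        assert (0 <= sz i * y i) by (apply Z.mul_nonneg_nonneg; lia).
        destruct (vl i <? 1); lia.
      * specialize (Hcomp x' X1 X4' X2').
        assert (E : sumz (fun i => V i * (x' i - P i)) 0 n
          = sumz (fun i => V i * x' i) 0 n + -1 * sumz (fun i => V i * P i) 0 n).
        { rewrite <- sumz_scal, <- sumz_add. apply sumz_ext. intros; lia. }
        rewrite Hvx, Hsum, M2.
        transitivity (sumz (fun i => V i * y' i) 0 n).
        -- apply sumz_le. intros i Hi. rewrite HV by auto. unfold y'. specialize (Hy i Hi).
           destruct (Z.ltb_spec (vl i) 1); [|lia].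
           assert (vl i * y i <= 0) by (apply Z.mul_nonpos_nonneg; lia). lia.
        -- frs. fold g. lia.
    + exists sm. split; [lia|]. split; [apply A2|].
      (* Every item belongs to the classes of exactly two steps, so the class sizes add up to
         [2 n]. *)
      assert (Hcs : sumz (fun q => 4006 * class_size n S (q_size q) + (110 * NN + 1)) 0 (2 * sm)
        = 4006 * (2 * n) + (110 * NN + 1) * (2 * sm)).
      { rewrite sumz_add, sumz_const, sumz_scal by lia. f_equal; [|lia]. f_equal.
        rewrite (sumz_ext _ (fun q => sumz (pick q S (fun _ => 1) (fun _ => 1)) 0 n)).
        - rewrite sum_steps by (try lia; intros i Hi; apply Hrg; auto).
          rewrite sumz_const; lia.
        - intros q Hq. unfold class_size. apply sumz_ext. intros i Hi. unfold pick.
          now destruct (q_par q =? 0). }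
      rewrite Hcs in Ht4'.
      replace (sm ^ 3) with (sm * (sm * sm)) by ring.
      unfold NN, L in *. lia.
Qed.

(** * Instances as functions *)

Definition item0 : item := Item 1 0 1.

Definition nth_item (I : instance) (i : Z) : item := nth (Z.to_nat i) (items I) item0.

Lemma weighted_sum_sumz f I x :
  length x = num_items I ->
  weighted_sum f I x
  = sumz (fun i => f (nth_item I i) * nth (Z.to_nat i) x 0) 0 (Z.of_nat (num_items I)).
Proof.
  unfold weighted_sum, num_items, nth_item. revert x.
  induction (items I) as [|it l IH]; intros x Hx.
  - now rewrite sumz_empty by (cbn; lia).
  - destruct x as [|a x]; [discriminate|]. cbn [combine map zsum fold_right length fst snd].
    injection Hx as Hx. fold (zsum (map (fun p => f (fst p) * snd p) (combine l x))).
    rewrite IH by auto.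
    rewrite (sumz_first _ 0 (Z.of_nat (Datatypes.S (length l)))) by lia.
    replace (sumz _ (0 + 1) (Z.of_nat (Datatypes.S (length l)))) with
      (sumz (fun i => f (nth (Z.to_nat i) (it :: l) item0) * nth (Z.to_nat i) (a :: x) 0)
         (0 + 1) (Z.of_nat (length l) + 1)) by (f_equal; lia).
    rewrite sumz_shift. cbn [Z.to_nat nth]. f_equal. apply sumz_ext. intros i Hi.
    replace (Z.to_nat (i + 1)) with (Datatypes.S (Z.to_nat i)) by lia. auto.
Qed.

Lemma Forall2_nth_iff {A B} (R : A -> B -> Prop) l l' a b :
  Forall2 R l l' <->
  length l' = length l /\ forall i, (i < length l)%nat -> R (nth i l a) (nth i l' b).
Proof.
  split.
  - induction 1 as [|x y l l' H H0 [IH1 IH2]]; cbn [length nth]; [split; [auto|lia]|].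
    split; [lia|]. intros [|i] Hi; auto. apply IH2. lia.
  - revert l'. induction l as [|x l IH]; intros [|y l'] [Hl H]; try discriminate; constructor.
    + apply (H O). cbn; lia.
    + apply IH. split; [injection Hl; auto|]. intros i Hi. apply (H (Datatypes.S i)). cbn; lia.
Qed.

Lemma feasible_iff I x :
  feasible I x <-> length x = num_items I
    /\ (forall i, 0 <= i < Z.of_nat (num_items I) ->
          0 <= nth (Z.to_nat i) x 0 <= item_mult (nth_item I i))
    /\ sumz (fun i => item_size (nth_item I i) * nth (Z.to_nat i) x 0)
         0 (Z.of_nat (num_items I)) <= capacity I.
Proof.
  unfold feasible. rewrite (Forall2_nth_iff _ _ _ item0 0). fold (num_items I).
  split; intros H.
  - destruct H as ((H1 & H2) & H3). rewrite weighted_sum_sumz in H3 by auto.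
    split; [auto|]. split; [|auto]. intros i Hi. apply H2. lia.
  - destruct H as (H1 & H2 & H3). rewrite weighted_sum_sumz by auto.
    split; [|auto]. split; [auto|]. intros i Hi. specialize (H2 (Z.of_nat i) ltac:(lia)).
    unfold nth_item in H2. rewrite Nat2Z.id in H2. auto.
Qed.

Lemma encode_items_nth l : forall i, (i < length l)%nat ->
  nth (3 * i) (encode_items l) 0 = item_size (nth i l item0)
  /\ nth (3 * i + 1) (encode_items l) 0 = item_value (nth i l item0)
  /\ nth (3 * i + 2) (encode_items l) 0 = item_mult (nth i l item0).
Proof.
  induction l as [|it l IH]; intros i Hi; cbn [length] in Hi; [lia|].
  destruct i as [|i]; [cbn; auto|].
  destruct (IH i ltac:(lia)) as (H1 & H2 & H3).
  replace (3 * Datatypes.S i)%nat with (3 + 3 * i)%nat by lia.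
  change (encode_items (it :: l)) with
    ([item_size it; item_value it; item_mult it] ++ encode_items l).
  rewrite <- !Nat.add_assoc.
  rewrite !(app_nth2_plus [item_size it; item_value it; item_mult it]). auto.
Qed.

Lemma encode_items_length l : length (encode_items l) = (3 * length l)%nat.
Proof.
  induction l as [|it l IH]; [auto|].
  change (encode_items (it :: l)) with
    ([item_size it; item_value it; item_mult it] ++ encode_items l).
  rewrite length_app, IH. cbn [length]. lia.
Qed.

Lemma fold_max_ge l z : In z l -> z <= fold_right Z.max 0 l.
Proof.
  induction l as [|a l IH]; cbn; [easy|]. intros [->|H]; [lia|]. specialize (IH H). lia.
Qed.

Lemma zsum_nonneg l : (forall z, In z l -> 0 <= z) -> 0 <= zsum l.
Proof.
  induction l as [|a l IH]; cbn [zsum fold_right]; intros H; [lia|].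
  fold (zsum l). pose proof (H a (or_introl eq_refl)).
  specialize (IH (fun z Hz => H z (or_intror Hz))). lia.
Qed.

Lemma zsum_ge l z : (forall z, In z l -> 0 <= z) -> In z l -> z <= zsum l.
Proof.
  induction l as [|a l IH]; [easy|]. intros H Hz. cbn [zsum fold_right]. fold (zsum l).
  pose proof (zsum_nonneg l (fun z Hz => H z (or_intror Hz))).
  pose proof (H a (or_introl eq_refl)).
  destruct Hz as [->|Hz]; [lia|]. specialize (IH (fun z Hz => H z (or_intror Hz)) Hz). lia.
Qed.

Lemma zsum_length l : (forall z, In z l -> 1 <= z) -> Z.of_nat (length l) <= zsum l.
Proof.
  induction l as [|a l IH]; cbn [zsum fold_right length]; intros H; [lia|].
  fold (zsum l). pose proof (H a (or_introl eq_refl)).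
  specialize (IH (fun z Hz => H z (or_intror Hz))). lia.
Qed.

(** Each item contributes at least 1 to [input_sum], so even the number of items is bounded by it.
    The summand 2 makes the base of the word bound at least 2. *)
Lemma valid_bounds I : valid I ->
  let X := input_sum I + 2 in
  2 <= X /\ Z.of_nat (num_items I) <= X /\ 0 <= capacity I <= X
  /\ forall i, 0 <= i < Z.of_nat (num_items I) ->
       1 <= item_size (nth_item I i) <= X /\ Z.abs (item_value (nth_item I i)) <= X
       /\ 1 <= item_mult (nth_item I i) <= X
       /\ item_size (nth_item I i) <= max_size I.
Proof.
  intros [Hv Hc] X. rewrite Forall_forall in Hv.
  set (w := fun it => item_size it + Z.abs (item_value it) + item_mult it).
  assert (Hpos : forall z, In z (map w (items I)) -> 1 <= z).
  { intros z Hz. apply in_map_iff in Hz as (it & <- & Hit). destruct (Hv it Hit). unfold w. lia. }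
  assert (Hnn : forall z, In z (map w (items I)) -> 0 <= z)
    by (intros z Hz; specialize (Hpos z Hz); lia).
  assert (EX : X = capacity I + zsum (map w (items I)) + 2) by reflexivity.
  pose proof (zsum_nonneg _ Hnn). pose proof (zsum_length _ Hpos) as Hlen.
  rewrite length_map in Hlen. fold (num_items I) in Hlen.
  split; [lia|]. split; [lia|]. split; [lia|].
  intros i Hi. assert (Hin : In (nth_item I i) (items I)).
  { apply nth_In. unfold num_items in Hi. lia. }
  destruct (Hv _ Hin). pose proof (zsum_ge _ (w (nth_item I i)) Hnn (in_map w _ _ Hin)) as Hw.
  unfold w in Hw at 1.
  assert (item_size (nth_item I i) <= max_size I) by (apply fold_max_ge, in_map; auto).
  lia.
Qed.

Theorem theorem1 :
  exists (P : program) (C k : Z),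
    0 <= C /\ 0 <= k /\
    forall I : instance, valid I ->
      exists (T : nat) (st : state),
        exec ((input_sum I + 2) ^ k) P (init_state I) T st
        /\ optimal I (output I st)
        /\ Z.of_nat T <= C * (Z.of_nat (num_items I) + max_size I ^ 3 + 1).
Proof.
  (* The time is the code length times one more than the number of loop tests. Words up to [X ^ 12]
     suffice for the structured program, and [X ^ 8 >= 256] leaves room for the addresses of the
     32-fold interleaving. *)
  exists (cc 0 main ++ [IHalt]), (Z.of_nat (length (cc 0 main ++ [IHalt])) * 40001), 20.
  set (N := Z.of_nat (length (cc 0 main ++ [IHalt]))).
  assert (HN : 0 <= N) by (unfold N; lia).
  split; [lia|]. split; [lia|]. intros I HI.
  destruct (valid_bounds I HI) as (HX & HnX & HtX & Hit).
  set (X := input_sum I + 2) in *. set (n := Z.of_nat (num_items I)) in *.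
  set (s0 := St (fun r => nth r [n; capacity I] 0)
    (fun q i => match q with O => nth (Z.to_nat i) (encode_items (items I)) 0 | _ => 0 end)).
  assert (Hraw : forall i, 0 <= i < n ->
    ar s0 0%nat (3 * i) = item_size (nth_item I i)
    /\ ar s0 0%nat (3 * i + 1) = item_value (nth_item I i)
    /\ ar s0 0%nat (3 * i + 2) = item_mult (nth_item I i)).
  { intros i Hi. cbn [ar s0]. unfold nth_item.
    destruct (encode_items_nth (items I) (Z.to_nat i)) as (E1 & E2 & E3).
    { unfold n, num_items in Hi. lia. }
    replace (Z.to_nat (3 * i)) with (3 * Z.to_nat i)%nat by lia.
    replace (Z.to_nat (3 * i + 1)) with (3 * Z.to_nat i + 1)%nat by lia.
    replace (Z.to_nat (3 * i + 2)) with (3 * Z.to_nat i + 2)%nat by lia. auto. }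
  set (B := X ^ 12).
  assert (HB : 4096 <= B).
  { change 4096 with (2 ^ 12). apply Z.pow_le_mono_l. lia. }
  assert (HXB : X <= B).
  { unfold B. replace X with (X ^ 1) at 1 by ring. apply Z.pow_le_mono_r; lia. }
  assert (HW : 32 * (n + B) + 32 <= X ^ 20).
  { replace (X ^ 20) with (B * X ^ 8) by (unfold B; ring).
    assert (2 ^ 8 <= X ^ 8) by (apply Z.pow_le_mono_l; lia).
    change (2 ^ 8) with 256 in H.
    assert (B * 256 <= B * X ^ 8) by (apply Z.mul_le_mono_nonneg_l; lia). lia. }
  destruct (main_spec B n s0 X (capacity I) (fun i => item_size (nth_item I i))
    (fun i => item_value (nth_item I i)) (fun i => item_mult (nth_item I i)))
    as (s' & t & Hbs & Hx1 & Hx2 & Hx3 & sm & Hsm1 & Hsm2 & Ht); auto; try lia.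
  { intros i Hi. destruct (Hraw i Hi) as (E1 & E2 & E3). destruct (Hit i Hi) as (R1 & R2 & R3 & _).
    repeat split; auto; lia. }
  assert (Hwf : wf B n s0).
  { split; [|split].
    - intros r Hr. cbn [rg s0]. destruct r as [|[|r]]; cbn [nth]; try lia.
      destruct r; cbn; lia.
    - intros q i. cbn [ar s0]. destruct q; [|lia].
      destruct (Z_lt_le_dec i (3 * n)) as [Hi|Hi].
      + destruct (Z_lt_le_dec i 0) as [Hneg|Hpos].
        (* [Z.to_nat] sends negative indices to cell 0, so they read the first size, if there is
           one. *)
        * replace (Z.to_nat i) with (Z.to_nat 0) by lia.
          destruct (Z.eq_dec n 0) as [E|E].
          -- rewrite nth_overflow; [lia|]. rewrite encode_items_length. unfold n, num_items in E. lia.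
          -- destruct (Hraw 0 ltac:(lia)) as (E1 & _). cbn [ar s0] in E1.
             change (3 * 0) with 0 in E1. rewrite E1. destruct (Hit 0 ltac:(lia)) as (R1 & _). lia.
        (* An input cell holds one of the three fields of item [i / 3]. *)
        * pose proof (Z.div_mod i 3 ltac:(lia)) as Dm.
          pose proof (Z.mod_pos_bound i 3 ltac:(lia)) as Mb.
          destruct (Hraw (i / 3) ltac:(lia)) as (E1 & E2 & E3).
          destruct (Hit (i / 3) ltac:(lia)) as (R1 & R2 & R3 & _). cbn [ar s0] in E1, E2, E3.
          assert (Hm : i mod 3 = 0 \/ i mod 3 = 1 \/ i mod 3 = 2) by lia.
          destruct Hm as [Hm|[Hm|Hm]]; rewrite Hm in Dm; rewrite Dm;
            rewrite ?Z.add_0_r, ?E1, ?E2, ?E3; lia.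
      + rewrite nth_overflow; [lia|]. rewrite encode_items_length. unfold n, num_items in Hi. lia.
    - reflexivity. }
  destruct (compile_exec B n (X ^ 20) main s0 t s' (fun a => nth a (encode_items (items I)) 0))
    as (T & st & Hexec & Hmem & HT); auto; try lia.
  (* Arrays other than 0 lie beyond the encoded input, where memory is initially 0. *)
  { intros q i Hq Hvi. destruct q as [|q]; [reflexivity|]. cbn [cell ar s0 valid_idx] in *.
    apply nth_overflow. rewrite encode_items_length. fold (num_items I). lia. }
  exists T, st. split; [exact Hexec|].
  assert (Hout : forall i, 0 <= i < n -> nth (Z.to_nat i) (output I st) 0 = ar s' 0%nat i).
  { intros i Hi. unfold output.
    rewrite nth_indep with (d' := mem st 0%nat)
      by (rewrite length_map, length_seq; unfold n in Hi; lia).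
    rewrite map_nth, seq_nth by (unfold n in Hi; lia).
    rewrite <- (Hmem 0%nat i) by (cbn [valid_idx]; lia). reflexivity. }
  assert (Hlen : length (output I st) = num_items I)
    by (unfold output; now rewrite length_map, length_seq).
  assert (Hsum : forall f, sumz (fun i => f (nth_item I i) * nth (Z.to_nat i) (output I st) 0) 0 n
    = sumz (fun i => f (nth_item I i) * ar s' 0%nat i) 0 n)
    by (intros f; apply sumz_ext; intros i Hi; now rewrite Hout).
  split.
  - split.
    + apply feasible_iff. fold n. split; [auto|]. split.
      * intros i Hi. rewrite Hout by auto. auto.
      * rewrite Hsum. auto.
    + intros y Hy. apply feasible_iff in Hy as (Y1 & Y2 & Y3).
      rewrite !weighted_sum_sumz by auto. fold n. rewrite Hsum. apply Hx3; auto.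
  (* Without items [sm] is 1 while [max_size] is 0; the [+ 1] in the time bound covers this. *)
  - assert (Hsm : sm ^ 3 <= max_size I ^ 3 + 1).
    { assert (0 <= max_size I).
      { unfold max_size. induction (map item_size (items I)); cbn [fold_right]; lia. }
      assert (0 <= max_size I ^ 3) by (apply Z.pow_nonneg; auto).
      destruct Hsm2 as [->|(i & Hi & ->)]; [lia|].
      destruct (Hit i Hi) as (_ & _ & _ & R).
      assert (item_size (nth_item I i) ^ 3 <= max_size I ^ 3) by (apply Z.pow_le_mono_l; lia).
      lia. }
    assert (0 <= sm ^ 3) by (apply Z.pow_nonneg; lia).
    fold N in HT. etransitivity; [exact HT|].
    rewrite <- Z.mul_assoc. apply Z.mul_le_mono_nonneg_l; lia.
Qed.
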